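(* Consider the problem $F2\,|\,\text{exact } l_j\in\{0,L\}\,|\,C_{\max}$: the two-machine flow shop with exact delays in which every delay $l_j$ equals either $0$ or a common value $L$ (where $L$ is part of the input). If this problem admits a polynomial-time $(1.25-\varepsilon)$-approximation algorithm for some fixed $\varepsilon>0$, then $\mathrm{P}=\mathrm{NP}$.
   Context: The two-machine flow shop problem with exact delays: an instance consists of a set of jobs $J=\{1,\dots,n\}$ and, for each job $j$, a triple $(a_j,l_j,b_j)$ of nonnegative integers. Each job $j$ has an operation of length $a_j$ on machine 1 and then an operation of length $b_j$ on machine 2; the operation on machine 2 must start exactly $l_j$ time units after the operation on machine 1 is completed. Each machine processes at most one operation at a time, operations are not preempted, and all start times are nonnegative. A feasible schedule assigns start times satisfying these constraints; its makespan $C_{\max}$ is the latest completion time of an operation. The objective is to minimize the makespan. A $\rho$-approximation algorithm is one that always outputs a feasible schedule of makespan at most $\rho$ times the optimum. *)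

(* Defs.v *)
From mathcomp Require Import all_boot all_order all_algebra.
From mathcomp Require Import reals.

Set Implicit Arguments.
Unset Strict Implicit.
Unset Printing Implicit Defensive.

Import GRing.Theory.

(** * Deterministic multi-tape Turing machines *)

Inductive move := MoveLeft | Stay | MoveRight.

(** Machines have [ntapes.+1] >= 1 tapes.  The tape alphabet consists of the
    blank, the two bits and the symbols of a further finite type [sym]. *)
Record machine := Machine {
  ntapes : nat;
  state : finType;
  sym : finType;
  start : state;
  halting : pred state;
  trans : state -> {ffun 'I_ntapes.+1 -> option (bool + sym)} ->
          state * {ffun 'I_ntapes.+1 -> option (bool + sym) * move} }.

Section Run.
Variable M : machine.

(** [None] is the blank. *)
Definition cell := option (bool + sym M).

(** A two-way infinite tape with finitely many nonblank cells: [(l, r)] has the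
    cells of [l], nearest first, to the left of the head, and those of [r] from
    the head rightwards; all other cells are blank. *)
Definition tape := (seq cell * seq cell)%type.

Definition read (t : tape) : cell := head None t.2.

Definition write_move (t : tape) (cm : cell * move) : tape :=
  let: (l, r) := (t.1, cm.1 :: behead t.2) in
  match cm.2 with
  | MoveLeft => (behead l, head None l :: r)
  | Stay => (l, r)
  | MoveRight => (head None r :: l, behead r)
  end.

Definition config := (state M * {ffun 'I_(ntapes M).+1 -> tape})%type.

Definition step (c : config) : config :=
  if halting c.1 then c else
  let: (q, act) := trans c.1 [ffun i => read (c.2 i)] in
  (q, [ffun i => write_move (c.2 i) (act i)]).

(** The input is written on tape 0, with the head on its first symbol. *)
Definition initial (x : seq bool) : config :=
  (start M,
   [ffun i => if i == ord0 then ([::], [seq Some (inl b) | b <- x])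
              else ([::], [::])]).

Fixpoint leading_bits (r : seq cell) : seq bool :=
  if r is Some (inl b) :: r' then b :: leading_bits r' else [::].

(** The output is the maximal block of bits on tape 0 that starts at the head. *)
Definition output (c : config) : seq bool := leading_bits (c.2 ord0).2.

Definition outputs_within (t : nat) (x y : seq bool) : Prop :=
  let c := iter t step (initial x) in halting c.1 /\ output c = y.

End Run.

(** * Polynomial time, P and NP *)

Definition language := seq bool -> Prop.

Definition in_P (A : language) : Prop :=
  exists (M : machine) (p : {poly nat}), forall x,
    exists2 b : bool, outputs_within M p.[size x]%R x [:: b] & (b <-> A x).

(** Self-delimiting: each bit is preceded by [true], the end is marked by
    [false]. *)
Definition enc_bits (x : seq bool) : seq bool :=
  rcons (flatten [seq [:: true; b] | b <- x]) false.

Definition enc_pair (x y : seq bool) : seq bool := enc_bits x ++ y.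

Definition in_NP (A : language) : Prop :=
  exists (V : language) (q : {poly nat}), in_P V /\
    forall x, A x <-> exists2 y, size y <= q.[size x]%R & V (enc_pair x y).

Definition P_eq_NP : Prop := forall A : language, in_P A <-> in_NP A.

(** * The two-machine flow shop with exact delays *)

Record instance := Instance {
  njobs : nat;
  len1 : 'I_njobs -> nat;
  delay : 'I_njobs -> nat;
  len2 : 'I_njobs -> nat }.

Definition delays_0_or (L : nat) (I : instance) : Prop :=
  forall j : 'I_(njobs I), delay j = 0 \/ delay j = L.

(** Since all data are integers, rounding all start times of a schedule down
    keeps it feasible and does not increase its makespan; start times are
    therefore taken to be integers. *)
Record schedule (I : instance) := Schedule {
  start1 : 'I_(njobs I) -> nat;
  start2 : 'I_(njobs I) -> nat }.

(** An operation started at [s i] occupies the half-open interval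
    [s i, s i + len i), which is empty if its length is 0. *)
Definition one_at_a_time n (s len : 'I_n -> nat) : Prop :=
  forall (t : nat) (i j : 'I_n),
    s i <= t < s i + len i -> s j <= t < s j + len j -> i = j.

Definition feasible (I : instance) (S : schedule I) : Prop :=
  [/\ forall j, start2 S j = start1 S j + len1 j + delay j,
      one_at_a_time (start1 S) (@len1 I) &
      one_at_a_time (start2 S) (@len2 I)].

Definition makespan (I : instance) (S : schedule I) : nat :=
  \max_(j < njobs I) maxn (start1 S j + len1 j) (start2 S j + len2 j).

Definition optimum (I : instance) (m : nat) : Prop :=
  (exists2 S : schedule I, feasible S & makespan S = m) /\
  (forall S : schedule I, feasible S -> m <= makespan S).

(** Binary digits, least significant first, without leading zeros; [bits 0] is
    empty. *)
Definition bits (n : nat) : seq bool :=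
  mkseq (fun i => odd (n %/ 2 ^ i)) (up_log 2 n.+1).

Definition enc_nats (s : seq nat) : seq bool :=
  flatten [seq enc_bits (bits n) | n <- s].

Definition enc_instance (L : nat) (I : instance) : seq bool :=
  enc_nats
    (L :: flatten [seq [:: len1 j; delay j; len2 j] | j <- enum 'I_(njobs I)]).

Definition enc_schedule (I : instance) (S : schedule I) : seq bool :=
  enc_nats (flatten [seq [:: start1 S j; start2 S j] | j <- enum 'I_(njobs I)]).

Definition polytime_approx_0L (R : realType) (rho : R) : Prop :=
  exists (M : machine) (p : {poly nat}),
    forall (L : nat) (I : instance), delays_0_or L I ->
    let x := enc_instance L I in
    exists S : schedule I,
      [/\ outputs_within M p.[size x]%R x (enc_schedule S),
          feasible S &
          forall m, optimum I m -> ((makespan S)%:R <= rho * m%:R)%R].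

(* Main.v *)
Require Import Defs.
From mathcomp Require Import all_boot all_order all_algebra.
From mathcomp Require Import reals.
From mathcomp Require Import boolp zify lra.

(** Every language in NP is reduced to the gap version of the scheduling problem.

    A computation is a tiling of an N x N torus cut open vertically: row t + 1
    holds the configuration at time t, with cells indexed relative to the heads,
    and the bottom row guesses the certificate.  A tile placed at a cell becomes
    a number with few nonzero digits, and the tilings correspond to the sets of
    such numbers with a given sum tA; let tB be the sum of the others.

    Let H exceed tA + tB, let R = 2^c H and L = 3R + tA + tB.  The instance has
    a job (R, 0, 2R + tB), a job (2R, 0, R + tA), two jobs (H, L, 1) and a job
    (w, L, 1) for every number w.  If a set of numbers has sum tA, the makespan
    4R + 4H is attainable.  Conversely, if all first operations start before 2R,
    then the first large job precedes the second, and the operations with delay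
    L have to fit exactly into one window before the first large job and one
    between the two, so that the numbers split into sums tA and tB.  A makespan
    below 5R forces all first operations to start before 2R; hence a
    (5/4 - eps)-approximation, for c large enough, decides the language by
    comparing the start times of its output with 2R. *)

Set Implicit Arguments.
Unset Strict Implicit.
Unset Printing Implicit Defensive.

(** * Programs on stream tapes *)

(** The ratio 5/4 has two sources. Every job occupies at least 3R from its first start to its end,
    so a start at 2R or later costs 5R; a solution costs 4R plus 4H, and 4H is a fraction 2^-c of
    4R. As eps is fixed, c is a constant and the numbers keep polynomially many digits.

    A tile sees only neighbouring columns, whereas heads wander. Indexing cells relative to the
    heads pins all heads to column 0, and a move becomes a shift of that tape by one column. Cyclic
    rows let the cells left of the heads count down from column N - 1; N exceeds the space used, so
    the two sides never meet.

    The reduction also has to run on a Turing machine as defined. H and R are powers of two, so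
    every number is a string of fixed-width blocks, printed by nested loops over the columns without
    arithmetic. As 2R is a power of two as well, the final comparison only counts binary digits. *)

Section StreamTapes.
Variable C : Type.

Definition scons (c : C) (f : nat -> C) (n : nat) : C :=
  if n is n'.+1 then f n' else c.

(** Streams forget how many explicit blanks a finite tape carries, so equal contents give equal
    tapes. *)
Definition stape := ((nat -> C) * (nat -> C))%type.

Definition swrite (t : stape) (cm : C * move) : stape :=
  match cm.2 with
  | MoveLeft => (t.1 \o succn, scons (t.1 0) (scons cm.1 (t.2 \o succn)))
  | Stay => (t.1, scons cm.1 (t.2 \o succn))
  | MoveRight => (scons cm.1 t.1, t.2 \o succn)
  end.

Lemma scons_eta (f : nat -> C) : scons (f 0) (f \o succn) = f.
Proof. by apply/funext => -[]. Qed.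

Lemma swrite_stay (t : stape) : swrite t (t.2 0, Stay) = t.
Proof. by case: t => l r; rewrite /swrite /= scons_eta. Qed.

End StreamTapes.

Section MapStream.
Variables (C D : Type) (h : C -> D).

Lemma comp_scons c (f : nat -> C) : h \o scons c f = scons (h c) (h \o f).
Proof. by apply/funext => -[]. Qed.

Definition smap (t : stape C) : stape D := (h \o t.1, h \o t.2).

Lemma smap_write t cm : smap (swrite t cm) = swrite (smap t) (h cm.1, cm.2).
Proof. by case: t cm => l r [c []]; rewrite /smap /swrite /= !comp_scons. Qed.

End MapStream.

Section Streams.
Variable M : machine.

Definition stream_of (t : tape M) : stape (cell M) := (nth None t.1, nth None t.2).

Lemma stream_of_write t cm :
  stream_of (write_move t cm) = swrite (stream_of t) cm.
Proof.
case: t cm => l r [c []]; rewrite /stream_of /write_move /swrite /=.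
- congr pair; apply/funext; first by move=> i; rewrite nth_behead.
  by case=> [|[|i]] /=; rewrite ?nth0 ?nth_behead.
- by congr pair; apply/funext => -[|i] //=; rewrite nth_behead.
- congr pair; apply/funext; last by move=> i; rewrite nth_behead.
  by case.
Qed.

Lemma read_stream (t : tape M) : read t = (stream_of t).2 0.
Proof. by case: t => l []. Qed.

Lemma leading_bits_stream (r : seq (cell M)) (y : seq bool) :
  (forall i, i < size y -> nth None r i = Some (inl (nth false y i))) ->
  (if nth None r (size y) is Some (inl _) then False else True) ->
  leading_bits r = y.
Proof.
elim: y r => [|b y IH] r H E.
  by case: r E {H} => [|[[b|s]|] r].
case: r H E => [|c r] H E; first by have := H 0 isT.
have /= -> := H 0 isT.
by rewrite IH // => i Hi; have := H i.+1 Hi.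
Qed.

End Streams.

Section Prog.
Variables (I S : finType).
Notation cel := (option (bool + S)).
Notation reads := (I -> cel).
Notation store := (I -> stape cel).

(** Actions and tests see only the symbols under the heads, so the position in the program is its
    only memory and becomes the machine state. *)
Inductive prog :=
| Act of (reads -> I -> cel * move)
| Seq of prog & prog
| If of (reads -> bool) & prog & prog
| While of (reads -> bool) & prog.

Fixpoint pstate (p : prog) : finType :=
  match p with
  | Act _ => bool
  | Seq p q => (pstate p + pstate q)%type
  | If _ p q => (pstate p + pstate q + bool)%type
  | While _ p => (pstate p + bool)%type
  end.

Fixpoint pstart p : pstate p :=
  match p with
  | Act _ => false
  | Seq p q => inl (pstart p)
  | If _ p q => inr false
  | While _ p => inr false
  end.

Fixpoint pdone p : pstate p :=
  match p with
  | Act _ => true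
  | Seq p q => inr (pdone q)
  | If _ p q => inr true
  | While _ p => inr true
  end.

Definition stay (r : reads) : I -> cel * move := fun i => (r i, Stay).

(** Control passes between subprograms in steps that leave the tapes as they are; these are the
    additive constants in the time bounds below. *)
Fixpoint ptrans p : pstate p -> reads -> pstate p * (I -> cel * move) :=
  match p with
  | Act f => fun s r => if s then (true, stay r) else (true, f r)
  | Seq p q => fun s r =>
    match s with
    | inl s => if s == pdone p then (inr (pstart q), stay r)
               else let x := ptrans s r in (inl x.1, x.2)
    | inr s => let x := ptrans s r in (inr x.1, x.2)
    end
  | If b p q => fun s r =>
    match s with
    | inl (inl s) => if s == pdone p then (inr true, stay r)
                     else let x := ptrans s r in (inl (inl x.1), x.2)
    | inl (inr s) => if s == pdone q then (inr true, stay r)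
                     else let x := ptrans s r in (inl (inr x.1), x.2)
    | inr false => if b r then (inl (inl (pstart p)), stay r)
                   else (inl (inr (pstart q)), stay r)
    | inr true => (inr true, stay r)
    end
  | While b p => fun s r =>
    match s with
    | inl s => if s == pdone p then (inr false, stay r)
               else let x := ptrans s r in (inl x.1, x.2)
    | inr false => if b r then (inl (pstart p), stay r)
                   else (inr true, stay r)
    | inr true => (inr true, stay r)
    end
  end.

Definition heads (T : store) : reads := fun i => (T i).2 0.

Definition swrites (T : store) (a : I -> cel * move) : store :=
  fun i => swrite (T i) (a i).

Lemma swrites_stay T : swrites T (stay (heads T)) = T.
Proof. by apply/funext => i; apply: swrite_stay. Qed.

Definition pstep p (c : pstate p * store) : pstate p * store :=
  let x := ptrans c.1 (heads c.2) in (x.1, swrites c.2 x.2).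

(** Every step leaves from an unfinished state: a compound program takes over as soon as its part is
    done, so a run idling in the final state could not be embedded. *)
Fixpoint reach p n (c c' : pstate p * store) : Prop :=
  if n is n'.+1 then c.1 != pdone p /\ reach n' (pstep c) c' else c = c'.

Definition runs p (T T' : store) t :=
  exists2 t', t' <= t & reach t' (pstart p, T) (pdone p, T').

Lemma reach_cat p n m (c1 c2 c3 : pstate p * store) :
  reach n c1 c2 -> reach m c2 c3 -> reach (n + m) c1 c3.
Proof.
by elim: n c1 => [c1 ->|n IH c1 [H1 H2] H3] //; split=> //; apply: IH.
Qed.

Lemma reach_embed p q (f : pstate p -> pstate q) n (c c' : pstate p * store) :
  (forall s, f s != pdone q) ->
  (forall s r, s != pdone p ->
     ptrans (f s) r = (f (ptrans s r).1, (ptrans s r).2)) ->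
  reach n c c' -> reach n (f c.1, c.2) (f c'.1, c'.2).
Proof.
move=> Hf Ht; elim: n c => [|n IH] c; first by move=> ->.
case=> H1 H2; split => //=; rewrite /pstep /= Ht //.
by have := IH _ H2.
Qed.

Lemma runs_le p T T' t u : runs p T T' t -> t <= u -> runs p T T' u.
Proof. by case=> n H1 H2 H3; exists n => //; apply: leq_trans H3. Qed.

Lemma runs_act f T : runs (Act f) T (swrites T (f (heads T))) 1.
Proof. by exists 1. Qed.

Lemma runs_seq p q T1 T2 T3 t1 t2 :
  runs p T1 T2 t1 -> runs q T2 T3 t2 -> runs (Seq p q) T1 T3 (t1 + t2).+1.
Proof.
case=> n1 L1 R1 [n2 L2 R2]; exists (n1 + n2.+1).
  by rewrite addnS ltnS leq_add.
apply: (@reach_cat (Seq p q) _ _ _ (inl (pdone p), T2)).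
  apply: (reach_embed (f := fun s => inl s : pstate (Seq p q)) _ _ R1) => //.
  by move=> s r /negbTE /= ->.
split=> //; rewrite /pstep /= eqxx /= swrites_stay.
(* [reach_embed] does not apply here, since [inr] sends the final state of [q] to the final state of
   the whole program. *)
have H : forall n (c c' : pstate q * store), reach n c c' ->
    @reach (Seq p q) n (inr c.1, c.2) (inr c'.1, c'.2).
  elim=> [|n IH] c c'; first by move=> ->.
  by case=> A B; split=> //; rewrite /pstep /=; apply: (IH _ _ B).
exact: (H _ _ _ R2).
Qed.

Lemma runs_if b p q T T' t :
  runs (if b (heads T) then p else q) T T' t -> runs (If b p q) T T' t.+2.
Proof.
move=> R; suff [n L H] : exists2 n, n <= t.+1 & @reach (If b p q) n
   ((if b (heads T) then inl (inl (pstart p)) else inl (inr (pstart q))), T)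
   (inr true, T').
  exists n.+1 => //; split=> //; rewrite /pstep /=.
  by move: H; case: (b _); rewrite /= swrites_stay.
case: (b _) R => -[n L R]; exists n.+1 => //; rewrite -addn1.
  apply: (@reach_cat (If b p q) _ _ _ (inl (inl (pdone p)), T')).
    apply: (reach_embed (f := fun s => inl (inl s) : pstate (If b p q)) _ _ R) => //.
    by move=> s r /negbTE /= ->.
  by split=> //=; rewrite /pstep /= eqxx /= swrites_stay.
apply: (@reach_cat (If b p q) _ _ _ (inl (inr (pdone q)), T')).
  apply: (reach_embed (f := fun s => inl (inr s) : pstate (If b p q)) _ _ R) => //.
  by move=> s r /negbTE /= ->.
by split=> //=; rewrite /pstep /= eqxx /= swrites_stay.
Qed.

Lemma runs_while0 (b : reads -> bool) p T : ~~ b (heads T) -> runs (While b p) T T 1.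
Proof.
move=> H; exists 1 => //; split=> //=.
by rewrite /pstep /= (negbTE H) /= swrites_stay.
Qed.

Lemma runs_whileS (b : reads -> bool) p T1 T2 T3 t1 t2 : b (heads T1) ->
  runs p T1 T2 t1 -> runs (While b p) T2 T3 t2 ->
  runs (While b p) T1 T3 (t1 + t2).+2.
Proof.
move=> H [n1 L1 R1] [n2 L2 R2]; exists (n1 + n2.+1).+1.
  by rewrite addnS !ltnS leq_add.
split=> //=; rewrite /pstep /= H /= swrites_stay.
apply: (@reach_cat (While b p) _ _ _ (inl (pdone p), T2)).
  apply: (reach_embed (f := fun s => inl s : pstate (While b p)) _ _ R1) => //.
  by move=> s r /negbTE /= ->.
by split=> //; rewrite /pstep /= eqxx /= swrites_stay.
Qed.

(** * From structured programs to multi-tape machines *)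

Section Compile.
Variables (k : nat) (ti : 'I_k.+1 -> I) (it : I -> 'I_k.+1).
Hypotheses (tiK : cancel ti it) (itK : cancel it ti).
Variable p : prog.

Definition compile : machine :=
  @Machine k (pstate p) S (pstart p) (fun s => s == pdone p)
    (fun s r => let x := ptrans s (fun i => r (it i)) in
       (x.1, [ffun j => x.2 (ti j)])).

Definition abs (c : config compile) : pstate p * store :=
  (c.1, fun i => stream_of (c.2 (it i))).

Lemma abs_step (c : config compile) : c.1 != pdone p -> abs (step c) = pstep (abs c).
Proof.
move=> H; rewrite /step /= (negbTE H) /abs /pstep /=.
have -> : (fun i => [ffun j => read (c.2 j)] (it i)) = heads (abs c).2.
  by apply/funext => i; rewrite ffunE read_stream.
congr pair; apply/funext => i.
by rewrite ffunE stream_of_write ffunE /swrites /= itK.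
Qed.

Lemma abs_reach n (c : config compile) c' : reach n (abs c) c' -> abs (iter n (@step compile) c) = c'.
Proof.
elim: n c => [|n IH] c //.
by case=> A B; rewrite iterSr; apply: IH; rewrite abs_step.
Qed.

Lemma halted_iter (M : machine) n (c : config M) : halting c.1 -> iter n (@step M) c = c.
Proof. by move=> H; elim: n => //= n ->; rewrite /step H. Qed.

Definition input_store (x : seq bool) : store := fun i =>
  (fun _ => None, nth None (if i == ti ord0 then [seq Some (inl b) | b <- x] else [::])).

(** A halted configuration repeats, so finishing before time [t] is harmless. The condition at
    position [size y] makes the block of output bits end exactly there. *)
Lemma compile_outputs t x y T :
  runs p (input_store x) T t ->
  (forall j, j < size y -> (T (ti ord0)).2 j = Some (inl (nth false y j))) ->
  (if (T (ti ord0)).2 (size y) is Some (inl _) then False else True) ->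
  outputs_within compile t x y.
Proof.
case=> n L R H1 H2.
have E : abs (initial compile x) = (pstart p, input_store x).
  rewrite /abs /=; congr pair; apply/funext => i; rewrite ffunE /input_store.
  rewrite -(inj_eq (can_inj tiK)) itK.
  by case: (i == _) => //; rewrite /stream_of /=; congr pair; apply/funext => -[].
have {}R : abs (iter n (@step compile) (initial compile x)) = (pdone p, T).
  by apply: abs_reach; rewrite E.
have Hh : halting (iter n (@step compile) (initial compile x)).1.
  by case: R => /= -> _; rewrite eqxx.
rewrite /outputs_within /= -(subnK L) iterD halted_iter //; split=> //.
case: R => _ ET; rewrite /output; apply: leading_bits_stream.
  by move=> j Hj; rewrite -H1 // -ET /= tiK.
by move: H2; rewrite -ET /= tiK.
Qed.

End Compile.
End Prog.

(** * Stack programs *)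

Definition upd (I : eqType) (A : Type) (f : I -> A) (i : I) (v : A) : I -> A :=
  fun j => if j == i then v else f j.

Ltac ext := let j := fresh "j" in
  rewrite /= ; try apply/funext => j; rewrite /upd;
  repeat match goal with
  | |- context [if ?a == ?b then _ else _] => case: (a =P b) => ?
  end; try congruence.

Section Stack.
Variables (I S : finType).
Notation cel := (option (bool + S)).
Notation store := (I -> seq cel).
Variable b : bool.

(** A stack is the part of a tape from its head rightwards. The flag [b] records that everything to
    the left is blank: a machine can be started only on such tapes, and this is lost once it has
    run. *)
Definition rep (T : I -> stape cel) (s : store) : Prop :=
  forall i, (T i).2 = nth None (s i) /\ (b -> (T i).1 = fun _ => None).

Definition srun (p : prog I S) (s s' : store) (t : nat) : Prop :=
  forall T, rep T s -> exists2 T', rep T' s' & runs p T T' t.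

Definition tops (s : store) : I -> cel := fun i => head None (s i).

Definition ne (i : I) : (I -> cel) -> bool := fun r => isSome (r i).

Lemma rep_heads T s : rep T s -> heads T = tops s.
Proof. by move=> H; apply/funext => i; rewrite /heads (H i).1 nth0. Qed.

Lemma srun_le p s s' t u : srun p s s' t -> t <= u -> srun p s s' u.
Proof.
by move=> H L T /H[T' ? R]; exists T' => //; apply: runs_le L.
Qed.

Lemma srun_seq p q s1 s2 s3 t1 t2 :
  srun p s1 s2 t1 -> srun q s2 s3 t2 -> srun (Seq p q) s1 s3 (t1 + t2).+1.
Proof.
move=> H1 H2 T /H1[T1 /H2[T2 ? R2] R1].
by exists T2 => //; apply: runs_seq R1 R2.
Qed.

Lemma srun_if c p q s s' t :
  srun (if c (tops s) then p else q) s s' t -> srun (If c p q) s s' t.+2.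
Proof.
move=> H T R; have [T' ? R'] := H _ R; exists T' => //.
by apply: runs_if; rewrite (rep_heads R).
Qed.

Lemma srun_while0 (c : (I -> cel) -> bool) p s : c (tops s) = false -> srun (While c p) s s 1.
Proof.
by move=> H T R; exists T => //; apply: runs_while0; rewrite (rep_heads R) H.
Qed.

Lemma srun_whileS (c : (I -> cel) -> bool) p s1 s2 s3 t1 t2 : c (tops s1) ->
  srun p s1 s2 t1 -> srun (While c p) s2 s3 t2 ->
  srun (While c p) s1 s3 (t1 + t2).+2.
Proof.
move=> H H1 H2 T R; have [T1 R1 E1] := H1 _ R; have [T2 R2 E2] := H2 _ R1.
exists T2 => //; apply: runs_whileS E1 E2; by rewrite (rep_heads R).
Qed.

Definition Skip : prog I S := Act (@stay I S).

Lemma srun_skip s : srun Skip s s 1.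
Proof.
move=> T R; exists T => //; have := runs_act (@stay I S) T.
by rewrite swrites_stay.
Qed.

(** On an empty stack this creates a top element, so it can also raise a flag. *)
Definition Put (i : I) (f : (I -> cel) -> cel) : prog I S :=
  Act (fun r j => (if j == i then f r else r j, Stay)).

Lemma nth_scons (c : cel) s : nth None (c :: behead s) = scons c (nth None s \o succn).
Proof. by apply/funext => -[|n] //=; rewrite nth_behead. Qed.

Lemma srun_put i f s :
  srun (Put i f) s (upd s i (f (tops s) :: behead (s i))) 1.
Proof.
move=> T R; eexists; last exact: runs_act.
move=> j; rewrite /swrites /upd (rep_heads R); case: eqP => [->|_].
  by split=> /=; rewrite ?(R i).1 ?nth_scons //; apply (R i).2.
have := swrite_stay (T j); rewrite (R j).1 nth0 => ->; exact: R.
Qed.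

Definition Pop (i : I) : prog I S :=
  Act (fun r j => if j == i then (None, MoveRight) else (r j, Stay)).

Lemma srun_pop i s : srun (Pop i) s (upd s i (behead (s i))) 1.
Proof.
move=> T R; eexists; last exact: runs_act.
move=> j; rewrite /swrites /upd (rep_heads R); case: eqP => [->|_].
  split=> /=; first by rewrite (R i).1; apply/funext => n; rewrite nth_behead.
  by move=> /(R i).2 ->; apply/funext => -[].
have := swrite_stay (T j); rewrite (R j).1 nth0 => ->; exact: R.
Qed.

(* [f] must not depend on tape [i], whose head has left the top of the stack
   when the value of [f] is written. *)
Definition Push (i : I) (f : (I -> cel) -> cel) : prog I S :=
  Seq (Act (fun r j => (r j, if j == i then MoveLeft else Stay)))
      (Put i (fun r => f (upd r i None))).

Lemma srun_push i f s :
  srun (Push i f) s (upd s i (f (upd (tops s) i None) :: s i)) 3.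
Proof.
move=> T R.
pose T1 := swrites T (fun j => (heads T j, if j == i then MoveLeft else Stay)).
have E j : j != i -> T1 j = T j.
  by rewrite /T1 /swrites => /negbTE ->; apply: swrite_stay.
eexists; last first.
  apply: (@runs_seq _ _ _ _ T T1 _ 1 1); exact: runs_act.
move=> j; rewrite {1 2}/swrites /upd -/T1; case: eqP => [->|/eqP ji]; last first.
  by have := swrite_stay (T1 j); rewrite -/(heads T1 j) => ->; rewrite E //; apply: R.
split=> /=; last first.
  by rewrite /T1 /swrites eqxx /= => /(R i).2 ->.
set f1 := f _; set f2 := f _; have -> : f1 = f2.
  rewrite /f1 /f2; congr f; apply/funext => l; case: (altP (l =P i)) => // li.
  by rewrite /heads E // (R l).1 nth0.
apply/funext => -[|n] //=; rewrite /T1 /swrites eqxx /=.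
case: n => [|n]; rewrite /= /heads (R i).1 //.
Qed.

Arguments srun_push i f s : clear implicits.
Arguments srun_pop i s : clear implicits.
Arguments srun_put i f s : clear implicits.

Definition Mv (i j : I) : prog I S := Seq (Push j (fun r => r i)) (Pop i).

Lemma srun_mv i j c u s : i <> j -> s i = c :: u ->
  srun (Mv i j) s (upd (upd s j (c :: s j)) i u) 5.
Proof.
move=> /eqP ij E; have := srun_seq (srun_push j (fun r => r i) s) (srun_pop i _).
by rewrite /upd (negbTE ij) /tops E /=.
Qed.

Lemma srun_eq p s s' s'' t : srun p s s' t -> s' = s'' -> srun p s s'' t.
Proof. by move=> H <-. Qed.

Lemma srun_iter (c : (I -> cel) -> bool) p (s : nat -> store) n t :
  (forall k, k < n -> c (tops (s k))) ->
  (forall k, k < n -> srun p (s k) (s k.+1) t) ->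
  c (tops (s n)) = false -> srun (While c p) (s 0) (s n) (n * t.+2).+1.
Proof.
elim: n s => [|n IH] s H1 H2 H3; first exact: srun_while0.
apply: srun_le; first apply: (srun_whileS (H1 0 _) (H2 0 _)) => //.
  by apply: (IH (s \o succn)) => // k Hk; [apply: H1|apply: H2].
by lia.
Qed.

Lemma srun_moves i j u s : i <> j -> s i = u -> all isSome u ->
  srun (While (ne i) (Mv i j)) s (upd (upd s j (rev u ++ s j)) i [::])
    (size u * 7).+1.
Proof.
move=> ij; elim: u s => [|c u IH] s E /=.
  move=> _; apply: srun_eq (srun_while0 _ _) _; first by rewrite /ne /tops E.
  by ext.
case/andP=> hc hu; apply: srun_le.
  apply: srun_whileS; first by rewrite /ne /tops E.
    exact: srun_mv E.
  apply: (srun_eq (IH _ _ hu)); first by ext.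
  by rewrite rev_cons cat_rcons; ext.
by lia.
Qed.

End Stack.
Arguments srun_push {I S b} i f s.
Arguments srun_pop {I S b} i s.
Arguments srun_put {I S b} i f s.
Arguments srun_skip {I S b} s.
Arguments Skip {I S}.

(** * Running a machine as a subprogram *)

Section RunMachine.
Variables (M : machine) (I S : finType).
Variables (sy : sym M -> S) (uns : S -> option (sym M)).
Variables (st : state M -> S) (unst : S -> option (state M)).
Hypotheses (syK : pcancel sy uns) (stK : pcancel st unst).
Variables (mi : 'I_(ntapes M).+1 -> I) (im : I -> option 'I_(ntapes M).+1) (tq : I).
Hypotheses (miK : pcancel mi im) (imK : ocancel im mi) (tq_im : im tq = None).
Notation cel := (option (bool + S)).

Definition emb (c : cell M) : cel :=
  match c with
  | None => None
  | Some (inl b) => Some (inl b)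
  | Some (inr s) => Some (inr (sy s))
  end.

Definition unemb (c : cel) : cell M :=
  match c with
  | None => None
  | Some (inl b) => Some (inl b)
  | Some (inr s) => omap inr (uns s)
  end.

Lemma embK : cancel emb unemb.
Proof. by case=> [[b|s]|] //=; rewrite syK. Qed.

Definition cur_state (r : I -> cel) : state M :=
  if r tq is Some (inr s) then odflt (start M) (unst s) else start M.

Definition mact (r : I -> cel) (j : I) : cel * move :=
  let x := trans (cur_state r) [ffun i => unemb (r (mi i))] in
  if im j is Some i then (emb (x.2 i).1, (x.2 i).2)
  else if j == tq then (Some (inr (st x.1)), Stay) else (r j, Stay).

(** The state of [M] is a symbol on tape [tq], so a single action in a loop simulates one step. *)
Definition RunM : prog I S :=
  While (fun r => ~~ halting (cur_state r)) (Act mact).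

Definition tapes_of (c : config M) (T : I -> stape cel) (l : nat -> cel) (j : I)
    : stape cel :=
  if im j is Some i then smap emb (stream_of (c.2 i))
  else if j == tq then (l, nth None [:: Some (inr (st c.1))]) else T j.

Lemma cur_state_tapes c T l : cur_state (heads (tapes_of c T l)) = c.1.
Proof. by rewrite /cur_state /heads /tapes_of tq_im eqxx /= stK. Qed.

Lemma runM c T l n : halting (iter n (@step M) c).1 ->
  runs RunM (tapes_of c T l) (tapes_of (iter n (@step M) c) T l) (n * 3).+1.
Proof.
elim: n c => [|n IH] c H.
  by apply: runs_while0; rewrite cur_state_tapes negbK.
have [hc|hc] := boolP (halting c.1).
  rewrite halted_iter //; apply: runs_le (_ : 1 <= _) => //.
  by apply: runs_while0; rewrite cur_state_tapes negbK.
rewrite iterSr in H *; apply: runs_le.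
  apply: runs_whileS (IH _ H); first by rewrite cur_state_tapes.
  have X := runs_act mact (tapes_of c T l); set T2 := tapes_of (step c) T l; move: X.
  set T1 := swrites _ _; move=> X; suff <- : T1 = T2 by exact: X.
  apply/funext => j; rewrite /T1 /T2 /swrites /mact cur_state_tapes.
  have -> : [ffun i => unemb (heads (tapes_of c T l) (mi i))] = [ffun i => read (c.2 i)].
    by apply/ffunP => i; rewrite !ffunE /heads /tapes_of miK /= embK read_stream.
  rewrite /tapes_of /step (negbTE hc); case: (trans c.1 _) => q a /=.
  case Ej: (im j) => [i|].
    by rewrite ffunE stream_of_write smap_write.
  case: eqP => [_|ne]; last first.
    rewrite /heads /tapes_of Ej; case: eqP => [//|_]; exact: swrite_stay.
  rewrite /swrite /=; congr pair; apply/funext => -[|[|k]] //=.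
by lia.
Qed.

(** An initial configuration has blank left halves, hence the flag [true] before the run. Afterwards
    only the right halves are described, which is all that the output depends on. *)
Lemma runM_rep (s : I -> seq cel) (x : seq bool) n :
  s tq = [:: Some (inr (st (start M)))] ->
  (forall i, s (mi i) = if i == ord0 then [seq Some (inl b) | b <- x] else [::]) ->
  halting (iter n (@step M) (initial M x)).1 ->
  forall T, rep true T s -> exists2 T', runs RunM T T' (n * 3).+1 &
    rep false T' (fun j => if im j is Some i then
                   map emb ((iter n (@step M) (initial M x)).2 i).2
                 else if j == tq then
                   [:: Some (inr (st (iter n (@step M) (initial M x)).1))] else s j).
Proof.
move=> sq si H T R.
exists (tapes_of (iter n (@step M) (initial M x)) T (fun _ => None)).
  suff -> : T = tapes_of (initial M x) T (fun _ => None).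
    have := runM T (fun _ => None) H; congr (runs _ _ _ _).
    apply/funext => j; rewrite /tapes_of; case: (im j) => //; by case: (j == tq).
  apply/funext => j; rewrite /tapes_of; case Ej: (im j) => [i|].
    have := imK j; rewrite Ej /= => <-; rewrite [LHS]surjective_pairing (R _).1 si.
    rewrite (R _).2 // ffunE /stream_of; case: (i == ord0) => /=; congr pair.
    - by apply/funext => -[].
    - apply/funext => k /=; elim: x k {H si} => [|a x IHx] [|k] //=; exact: IHx.
    - by apply/funext => -[].
    - by apply/funext => -[].
  case: eqP => [->|//]; rewrite [LHS]surjective_pairing (R _).1 (R _).2 // sq.
  by [].
move=> j; rewrite /tapes_of; split => //; case Ej: (im j) => [i|]; last first.
  by case: eqP => // _; apply (R j).1.
rewrite /=; apply/funext => k /=; elim: (_.2) k => [|a r IHr] [|k] //=; exact: IHr.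
Qed.

End RunMachine.

(** * Emitting sequences by nested loops *)

Section Gen.
Variables (I S : finType) (b : bool).
Notation cel := (option (bool + S)).
Notation store := (I -> seq cel).
Notation srun := (@srun I S b).

Inductive gtest :=
| TEq of I & I
| TSucc of I & I
| TCyc of I & I
| TLab of I & (cel -> bool).

Inductive gen :=
| GNil
| GSeq of gen & gen
| GEmit of cel
| GFor of I & gen
| GIf of gtest & gen & gen.

Variable Lam : seq cel.
Notation N := (size Lam).

Definition tval (r : I -> nat) (t : gtest) : bool :=
  match t with
  | TEq v w => r v == r w
  | TSucc v w => r v == (r w).+1
  | TCyc v w => r v == (if (r w).+1 == N then 0 else (r w).+1)
  | TLab v P => P (nth None Lam (r v))
  end.

Fixpoint gout (r : I -> nat) (g : gen) : seq cel :=
  match g with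
  | GNil => [::]
  | GSeq g1 g2 => gout r g1 ++ gout r g2
  | GEmit c => [:: c]
  | GFor v g => flatten [seq gout (upd r v k) g | k <- iota 0 N]
  | GIf t g1 g2 => if tval r t then gout r g1 else gout r g2
  end.

Definition tscope (sc : seq I) (t : gtest) : bool :=
  match t with
  | TEq v w | TSucc v w | TCyc v w => [&& v != w, v \in sc & w \in sc]
  | TLab v _ => v \in sc
  end.

Fixpoint gscope (vars sc : seq I) (g : gen) : bool :=
  match g with
  | GNil | GEmit _ => true
  | GSeq g1 g2 => gscope vars sc g1 && gscope vars sc g2
  | GFor v g => [&& v \in vars, v \notin sc & gscope vars (v :: sc) g]
  | GIf t g1 g2 => [&& tscope sc t, gscope vars sc g1 & gscope vars sc g2]
  end.

Variables (tL tA tB tH tF tO : I) (vars : seq I).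
Hypothesis tapes_uniq : uniq [:: tL, tA, tB, tH, tF, tO & vars].
Variable isHead : cel -> bool.
Hypothesis isHeadP : forall k, k < N -> isHead (nth None Lam k) = (k == 0).
Hypothesis LamS : all isSome Lam.

Definition mark : cel := Some (inl true).

(** Both stacks are unloaded in parallel; their heights agree iff they run empty together. The
    answer is a mark on [tF], and the unloaded cells are put back. *)
Definition EqProg v w : prog I S :=
  Seq (While (fun r => isSome (r v) && isSome (r w)) (Seq (Mv S v tA) (Mv S w tB)))
  (Seq (If (fun r => ~~ isSome (r v) && ~~ isSome (r w)) (Push tF (fun _ => mark)) Skip)
       (While (fun r => isSome (r tA)) (Seq (Mv S tA v) (Mv S tB w)))).

(** Parking the top of [w] on [tH] turns the value of [w] into its successor. If this empties [w],
    the cyclic successor is 0, and [v] has that value iff its top is a head label. *)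
Definition tprog (t : gtest) : prog I S :=
  match t with
  | TEq v w => EqProg v w
  | TSucc v w => Seq (Mv S w tH) (Seq (EqProg v w) (Mv S tH w))
  | TCyc v w =>
    Seq (Mv S w tH) (Seq
      (If (fun r => isSome (r w)) (EqProg v w)
          (If (fun r => isHead (r v)) (Push tF (fun _ => mark)) Skip))
      (Mv S tH w))
  | TLab v P => If (fun r => P (r v)) (Push tF (fun _ => mark)) Skip
  end.

Fixpoint gprog (g : gen) : prog I S :=
  match g with
  | GNil => Skip
  | GSeq g1 g2 => Seq (gprog g1) (gprog g2)
  | GEmit c => Push tO (fun _ => c)
  | GFor v g =>
    Seq (Seq (While (@ne I S tL) (Mv S tL tA))
             (While (@ne I S tA) (Seq (Push v (fun r => r tA)) (Mv S tA tL))))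
        (While (@ne I S v) (Seq (gprog g) (Pop S v)))
  | GIf t g1 g2 =>
    Seq (tprog t) (If (@ne I S tF) (Seq (Pop S tF) (gprog g1)) (gprog g2))
  end.

Fixpoint gtime (g : gen) (n : nat) : nat :=
  match g with
  | GNil => 1
  | GSeq g1 g2 => (gtime g1 n + gtime g2 n).+1
  | GEmit _ => 3
  | GFor v g => 18 * n + 6 + n * (gtime g n + 4)
  | GIf t g1 g2 => 26 * n + 40 + gtime g1 n + gtime g2 n
  end.

(** A loop variable of value [k] is the stack [drop k Lam]: its top is the label of column [k],
    popping increments it, and equality of values is equality of heights. Outside its loop its stack
    is empty. *)
Definition ginv (sc : seq I) (r : I -> nat) (s : store) : Prop :=
  [/\ s tL = Lam, [/\ s tA = [::], s tB = [::], s tH = [::] & s tF = [::]],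
      forall v, v \in sc -> v \in vars /\ s v = drop (r v) Lam /\ r v < N &
      forall v, v \in vars -> v \notin sc -> s v = [::]].

Lemma tapes_neq v : v \in vars ->
  [/\ v <> tL, v <> tA, v <> tB, v <> tH & v <> tF /\ v <> tO].
Proof.
move: tapes_uniq => /=; rewrite !inE !negb_or -!andbA.
do !case/andP=> ?; move=> _ hv.
by split; try split; move=> E; subst v; move: hv; apply/negP.
Qed.

Lemma fixed_neq : [/\ [/\ tL <> tA, tL <> tB, tL <> tH, tL <> tF & tL <> tO],
  [/\ tA <> tB, tA <> tH, tA <> tF & tA <> tO],
  [/\ tB <> tH, tB <> tF & tB <> tO] & [/\ tH <> tF, tH <> tO & tF <> tO]].
Proof.
move: tapes_uniq => /=; rewrite !inE !negb_or -!andbA.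
do !case/andP=> ?; move=> _.
by split; split; apply/eqP.
Qed.

Lemma run_eq v w u u' s : v \in vars -> w \in vars -> v <> w ->
  s tA = [::] -> s tB = [::] -> s v = u -> s w = u' ->
  all isSome u -> all isSome u' -> size u <= N -> size u' <= N ->
  srun (EqProg v w) s (if size u == size u' then upd s tF (mark :: s tF) else s)
    (26 * N + 10).
Proof.
case/tapes_neq=> vL vA vB vH [vF vO] /tapes_neq[wL wA wB wH [wF wO]] vw EA EB Ev Ew Hu Hu' Lu Lu'.
have [[LA LB LH LF LO] [AB AH AF AO] [BH BF BO] [HF HO FO]] := fixed_neq.
(* The store after [k] parallel moves; read backwards, the same family describes the restoring
   loop. *)
pose F (s : store) k := upd (upd (upd (upd s v (drop k u)) w (drop k u'))
  tA (rev (take k u))) tB (rev (take k u')).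
pose n := minn (size u) (size u').
have nu : n <= size u by rewrite geq_minl.
have nu' : n <= size u' by rewrite geq_minr.
have top_drop k (z : seq cel) : k < size z -> all isSome z -> isSome (head None (drop k z)).
  by move=> hk hz; rewrite -nth0 nth_drop addn0; apply: all_nthP hk.
have forward s1 : srun (While (fun r => isSome (r v) && isSome (r w))
    (Seq (Mv S v tA) (Mv S w tB))) (F s1 0) (F s1 n) (n * 13).+1.
  apply: srun_iter => [k hk|k hk|].
  - rewrite /tops /F /upd; have [/eqP/negbTE e1 /eqP/negbTE e2] := (vA, vB).
    have [/eqP/negbTE e3 /eqP/negbTE e4] := (wA, wB); have /eqP/negbTE e5 := vw.
    by rewrite e1 e2 e3 e4 e5 !eqxx !top_drop //; lia.
  - have hku : k < size u by lia.
    have hku' : k < size u' by lia.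
    apply: srun_eq; first apply: (srun_seq (t1 := 5) (t2 := 5)).
    + apply: (@srun_mv _ _ _ _ _ (nth None u k) (drop k.+1 u)) => //.
      by rewrite /F; ext; exact: drop_nth.
    + apply: (@srun_mv _ _ _ _ _ (nth None u' k) (drop k.+1 u')) => //.
      by rewrite /F; ext; exact: drop_nth.
    by rewrite /F !(take_nth None) // !rev_rcons; ext.
  - rewrite /tops /F /upd; have [/eqP/negbTE e1 /eqP/negbTE e2] := (vA, vB).
    have [/eqP/negbTE e3 /eqP/negbTE e4] := (wA, wB); have /eqP/negbTE e5 := vw.
    rewrite e1 e2 e3 e4 e5 !eqxx; have [/eqP E|/eqP E] : n == size u \/ n == size u'.
      by rewrite /n; lia.
      by rewrite E drop_size.
    by rewrite E drop_size andbF.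
have backward s1 : srun (While (fun r => isSome (r tA))
    (Seq (Mv S tA v) (Mv S tB w))) (F s1 n) (F s1 0) (n * 13).+1.
  have := @srun_iter I S b (fun r => isSome (r tA)) (Seq (Mv S tA v) (Mv S tB w))
     (fun k => F s1 (n - k)) n 11; rewrite subn0 subnn; apply=> [k hk|k hk|].
  - rewrite /tops /F /upd; have /eqP/negbTE -> := AB; rewrite eqxx.
    have -> : n - k = (n - k.+1).+1 by lia.
    rewrite (take_nth None) ?rev_rcons /=; last by lia.
    by apply: all_nthP Hu _ _; lia.
  - have -> : n - k = (n - k.+1).+1 by lia.
    have h1 : n - k.+1 < size u by lia.
    have h2 : n - k.+1 < size u' by lia.
    apply: srun_eq; first apply: (srun_seq (t1 := 5) (t2 := 5)).
    + apply: (@srun_mv _ _ _ _ _ (nth None u (n - k.+1)) (rev (take (n - k.+1) u))); first congruence.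
      by rewrite /F (take_nth None) // rev_rcons; ext.
    + apply: (@srun_mv _ _ _ _ _ (nth None u' (n - k.+1)) (rev (take (n - k.+1) u'))); first congruence.
      by rewrite /F !(take_nth None) // !rev_rcons; ext.
    by rewrite /F [in RHS](drop_nth None h1) [in RHS](drop_nth None h2); ext.
  - by rewrite /tops /F take0; ext.
have E0 s1 : s1 v = u -> s1 w = u' -> s1 tA = [::] -> s1 tB = [::] -> F s1 0 = s1.
  by move=> *; rewrite /F !take0 !drop0 /rev /=; ext.
apply: srun_le.
  apply: srun_seq; first by rewrite -{1}(E0 s) //; apply: forward.
  apply: (@srun_seq _ _ _ _ _ _ (if size u == size u' then F (upd s tF (mark :: s tF)) n else F s n) _ 5).
    apply: (@srun_le _ _ _ _ _ _ 5); last by [].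
    apply: srun_if; rewrite /tops {1 2}/F /upd.
    have [/eqP/negbTE e1 /eqP/negbTE e2] := (vA, vB).
    have [/eqP/negbTE e3 /eqP/negbTE e4] := (wA, wB); have /eqP/negbTE e5 := vw.
    rewrite e1 e2 e3 e4 e5 !eqxx; case: eqP => E.
      have en : n = size u by lia.
      rewrite !drop_oversize -?E ?en //=; apply: (srun_eq (srun_push _ _ _)).
      by rewrite /F; ext.
    suff -> : ~~ isSome (head None (drop n u)) && ~~ isSome (head None (drop n u')) = false.
      by apply: srun_le; first exact: srun_skip.
    have [h|h] : n < size u \/ n < size u' by lia.
      by rewrite top_drop.
    by rewrite (top_drop _ u') // andbF.
  have [|] := eqVneq (size u) (size u') => _; apply: (srun_eq (backward _)).
    by apply: E0; ext.
  exact: E0.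
by rewrite /n; lia.
Qed.

Lemma run_test sc r s t : tscope sc t -> ginv sc r s ->
  srun (tprog t) s (if tval r t then upd s tF [:: mark] else s) (26 * N + 30).
Proof.
move=> Ht [EL [EA EB EH EF] Hsc _].
have [[LA LB LH LF LO] [AB AH AF AO] [BH BF BO] [HF HO FO]] := fixed_neq.
have dS k : all isSome (drop k Lam).
  by apply/allP => c /mem_drop; apply: (allP LamS).
have split_drop k : k < N -> drop k Lam = nth None Lam k :: drop k.+1 Lam.
  exact: drop_nth.
(* The frame common to both successor tests: park the top of [w], test, put it back. *)
have hold v w p : v \in sc -> w \in sc -> v != w ->
    (forall s1, s1 = upd (upd s tH [:: nth None Lam (r w)]) w (drop (r w).+1 Lam) ->
       srun p s1 (if tval r t then upd s1 tF [:: mark] else s1) (26 * N + 15)) ->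
    srun (Seq (Mv S w tH) (Seq p (Mv S tH w))) s
      (if tval r t then upd s tF [:: mark] else s) (26 * N + 30).
  move=> /Hsc[/tapes_neq[vL vA vB vH [vF vO]] [Ev vN]]
    /Hsc[/tapes_neq[wL wA wB wH [wF wO]] [Ew wN]] /eqP vw Hp.
  apply: srun_le.
    apply: srun_seq; first apply: (@srun_mv _ _ _ w tH _ _ s wH).
      by rewrite Ew split_drop.
    apply: srun_seq; first by apply: Hp; rewrite EH.
    apply: srun_eq.
      apply: (@srun_mv _ _ _ tH w (nth None Lam (r w)) [::]); first congruence.
      by case: ifP => _; ext.
    by case: ifP => _; have E := split_drop _ wN; ext.
  by lia.
case: t Ht hold => [v w|v w|v w|v P] /= Ht hold.
- case/and3P: Ht => /eqP vw /Hsc[hv [Ev vN]] /Hsc[hw [Ew wN]].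
  apply: srun_le.
    apply: srun_eq.
      apply: (run_eq hv hw vw EA EB Ev Ew); rewrite // size_drop; lia.
    rewrite EF !size_drop; congr (if _ then _ else _).
    by apply/eqP/eqP; lia.
  by lia.
- case/and3P: Ht => vw hv hw; apply: (hold v w) => // s1 Es1.
  have [hv' [Ev vN]] := Hsc _ hv; have [hw' [Ew wN]] := Hsc _ hw.
  have [vL vA vB vH [vF vO]] := tapes_neq hv'.
  have [wL wA wB wH [wF wO]] := tapes_neq hw'; move/eqP: vw => vw.
  apply: srun_le.
    apply: srun_eq.
      apply: (@run_eq v w (drop (r v) Lam) (drop (r w).+1 Lam)); rewrite ?size_drop //; try lia.
      all: try by rewrite Es1; ext.
    rewrite !size_drop; have -> : (N - r v == N - (r w).+1) = (r v == (r w).+1).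
      by apply/eqP/eqP; lia.
    by case: ifP => // _; rewrite Es1; ext.
  by lia.
- case/and3P: Ht => vw hv hw; apply: (hold v w) => // s1 Es1.
  have [hv' [Ev vN]] := Hsc _ hv; have [hw' [Ew wN]] := Hsc _ hw.
  have [vL vA vB vH [vF vO]] := tapes_neq hv'.
  have [wL wA wB wH [wF wO]] := tapes_neq hw'; move/eqP: vw => vw.
  have e1 : s1 w = drop (r w).+1 Lam by rewrite Es1; ext.
  have e2 : s1 v = drop (r v) Lam by rewrite Es1; ext.
  have e3 : s1 tF = [::] by rewrite Es1; ext.
  apply: (@srun_le _ _ _ _ _ _ (26 * N + 10).+2); last by lia.
  apply: srun_if; rewrite /tops e1; case: (eqVneq (r w).+1 N) => E.
    rewrite E drop_size; apply: (@srun_le _ _ _ _ _ _ 5); last by lia.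
    apply: srun_if; rewrite /tops e2 split_drop //= isHeadP //.
    case: ifP => _; last by apply: srun_le; first exact: srun_skip.
    by apply: (srun_eq (srun_push _ _ _)); rewrite e3.
  rewrite (split_drop (r w).+1) /=; last by lia.
  have -> : isSome (nth None Lam (r w).+1) by apply: all_nthP LamS _ _; lia.
  apply: srun_eq.
    apply: (@run_eq v w (drop (r v) Lam) (drop (r w).+1 Lam)); rewrite ?size_drop //; try lia.
    all: try by rewrite Es1; ext.
  rewrite !size_drop e3; congr (if _ then _ else _).
  by apply/eqP/eqP; lia.
- have [hv' [Ev vN]] := Hsc _ Ht.
  apply: (@srun_le _ _ _ _ _ _ 5); last by lia.
  apply: srun_if; rewrite /tops Ev split_drop //=.
  case: ifP => _; last by apply: srun_le; first exact: srun_skip.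
  by apply: (srun_eq (srun_push _ _ _)); rewrite EF.
Qed.

Lemma run_copy v s : v \in vars -> s tL = Lam -> s tA = [::] -> s v = [::] ->
  srun (Seq (While (@ne I S tL) (Mv S tL tA))
       (While (@ne I S tA) (Seq (Push v (fun r => r tA)) (Mv S tA tL))))
    s (upd s v Lam) (18 * N + 3).
Proof.
move=> hv EL EA Ev; have [vL vA vB vH [vF vO]] := tapes_neq hv.
have [[LA LB LH LF LO] _ _ _] := fixed_neq.
have copy u s1 : s1 tA = u -> all isSome u ->
    srun (While (@ne I S tA) (Seq (Push v (fun r => r tA)) (Mv S tA tL))) s1
      (upd (upd (upd s1 v (rev u ++ s1 v)) tL (rev u ++ s1 tL)) tA [::])
      (size u * 11).+1.
  elim: u s1 => [|c u IH] s1 E /=.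
    move=> _; apply: srun_eq; first by apply: srun_while0; rewrite /ne /tops E.
    by ext.
  case/andP=> hc hu; apply: srun_le.
    apply: srun_whileS; first by rewrite /ne /tops E.
      apply: srun_seq; first exact: srun_push.
      apply: (@srun_mv _ _ _ tA tL c u); first congruence.
      by ext.
    apply: srun_eq; first by apply: (IH _ _ hu); ext.
    by rewrite !rev_cons !cat_rcons /tops; ext; rewrite E.
  by lia.
apply: srun_le.
  apply: srun_seq; first exact: (@srun_moves I S b tL tA Lam s LA EL LamS).
  apply: srun_eq; first apply: (copy (rev Lam)).
  - by rewrite EA cats0; ext.
  - by rewrite all_rev.
  by rewrite revK EA; ext; rewrite ?Ev cats0 //; congruence.
by rewrite size_rev; lia.
Qed.

(** The output piles up on a stack and so ends up reversed. This suits the next pass, which reads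
    numbers from their most significant bits. *)
Lemma run_gen g sc r s : gscope vars sc g -> ginv sc r s ->
  srun (gprog g) s (upd s tO (rev (gout r g) ++ s tO)) (gtime g N).
Proof.
have [[LA LB LH LF LO] [AB AH AF AO] [BH BF BO] [HF HO FO]] := fixed_neq.
have keep sc1 r1 s1 x : ginv sc1 r1 s1 -> ginv sc1 r1 (upd s1 tO x).
  case=> EL [EA EB EH EF] Hsc Hv; split; first by ext.
  - by split; ext.
  - move=> v /Hsc[hv [Ev vN]]; have [_ _ _ _ [_ vO]] := tapes_neq hv.
    by split=> //; split=> //; ext.
  - by move=> v hv /(Hv v hv) Ev; have [_ _ _ _ [_ vO]] := tapes_neq hv; ext.
elim: g sc r s => [|g1 IH1 g2 IH2|c|v g IH|t g1 IH1 g2 IH2] sc r s /=.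
- move=> _ _; apply: srun_eq; first exact: srun_skip. by rewrite /rev /=; ext.
- case/andP=> h1 h2 H; apply: srun_le.
    apply: srun_seq; first exact: IH1 h1 H.
    apply: srun_eq; first exact: (IH2 sc r _ h2 (keep _ _ _ _ H)).
    by rewrite rev_cat -catA; ext.
  by [].
- by move=> _ _; apply: srun_eq; [exact: srun_push|].
- case/and3P=> hv nv hg H; have [EL [EA EB EH EF] Hsc Hv] := H.
  have [vL vA vB vH [vF vO]] := tapes_neq hv.
  (* Output of the first [k] rounds; [F k] is the store at the start of round [k]. *)
  pose out k := flatten [seq gout (upd r v k) g | k <- iota 0 k].
  pose F k := upd (upd s tO (rev (out k) ++ s tO)) v (drop k Lam).
  have loop : srun (While (@ne I S v) (Seq (gprog g) (Pop S v))) (F 0) (F N)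
      (N * (gtime g N + 2).+2).+1.
    apply: srun_iter => [k hk|k hk|].
    - rewrite /ne /tops /F /upd eqxx -nth0 nth_drop addn0.
      exact: all_nthP LamS _ _.
    - apply: srun_le.
        apply: srun_seq.
          apply: (IH _ (upd r v k)) hg _; split.
          + by rewrite /F; ext.
          + by rewrite /F; split; ext.
          + move=> w; rewrite inE; case: (eqVneq w v) => [->|wv] /= hw.
              by split=> //; split; rewrite /F; ext.
            have [hw' [Ew wN]] := Hsc _ hw; have [_ _ _ _ [_ wO]] := tapes_neq hw'.
            by split=> //; move/eqP: wv => wv; split; rewrite /F; ext.
          + move=> w hw; rewrite inE negb_or; case/andP=> /eqP wv nw.
            by have [_ _ _ _ [_ wO]] := tapes_neq hw; rewrite /F; ext; apply: Hv.
        apply: srun_eq; first exact: srun_pop.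
        have e : out k.+1 = out k ++ gout (upd r v k) g.
          by rewrite /out -addn1 iotaD map_cat flatten_cat /= cats0.
        rewrite /F e rev_cat -catA; ext.
        by rewrite -drop1 drop_drop add1n.
      by lia.
    - by rewrite /ne /tops /F /upd eqxx drop_size.
  apply: srun_le.
    apply: srun_seq; first by apply: run_copy => //; apply: Hv.
    have -> : upd s v Lam = F 0 by rewrite /F /out /= drop0 /rev /=; ext.
    apply: (srun_eq loop); rewrite /F drop_size.
    by have Ev := Hv _ hv nv; ext.
  by lia.
- case/and3P=> ht h1 h2 H; have [EL [EA EB EH EF] Hsc Hv] := H.
  apply: srun_le.
    apply: srun_seq; first exact: run_test ht H.
    apply: (@srun_le _ _ _ _ _ _ (4 + gtime g1 N + gtime g2 N).+2) => //.
    apply: srun_if; rewrite /ne /tops; case: (tval r t); last first.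
      by rewrite EF; apply: srun_le; [exact: IH2 h2 H|lia].
    have -> : upd s tF [:: mark] tF = [:: mark] by ext.
    apply: srun_le.
      apply: srun_seq; first exact: srun_pop.
      have -> : upd (upd s tF [:: mark]) tF (behead (upd s tF [:: mark] tF)) = s.
        by ext; rewrite /=; congruence.
      exact: IH1 h1 H.
    by lia.
  by lia.
Qed.

End Gen.

(** * The flow shop gadget *)

Section Packing.
Variables (m : nat) (s w : nat -> nat).
Hypothesis disj : forall i j, i < m -> j < m -> i <> j -> 0 < w i -> 0 < w j ->
  s i + w i <= s j \/ s j + w j <= s i.

Lemma sum_interval a b x l : a <= x -> x + l <= b ->
  \sum_(a <= t < b) (x <= t < x + l : nat) = l.
Proof.
move=> H1 H2; rewrite (big_cat_nat (n := x)) //=; last by lia.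
rewrite (big_cat_nat (m := x) (n := x + l)) //=; last by lia.
rewrite !big_nat big1 ?add0n; last by move=> t Ht; rewrite leqNgt; lia.
rewrite [X in _ + X]big1 ?addn0; last by move=> t Ht; lia.
rewrite (eq_bigr (fun _ => 1)); last by move=> t ->.
by rewrite -big_nat sum_nat_const_nat; lia.
Qed.

(** Double counting: a length is a number of time points, and each point of the window lies in at
    most one interval. *)
Lemma packing (A : pred nat) a b :
  (forall i, i < m -> A i -> a <= s i /\ s i + w i <= b) ->
  \sum_(0 <= i < m | A i) w i <= b - a.
Proof.
move=> H.
have -> : \sum_(0 <= i < m | A i) w i =
    \sum_(0 <= i < m | A i) \sum_(a <= t < b) (s i <= t < s i + w i : nat).
  rewrite big_nat_cond [RHS]big_nat_cond; apply: eq_bigr => i /andP[Hi Ai].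
  by have [h1 h2] := H i ltac:(lia) Ai; rewrite sum_interval.
rewrite exchange_big /= -[b - a]muln1 -sum_nat_const_nat.
apply: leq_sum => t _.
have [/hasP[i Hi /andP[Ai ti]]|/hasPn Hn] :=
    boolP (has (fun i => A i && (s i <= t < s i + w i)) (index_iota 0 m)).
  rewrite big_mkcond (bigD1_seq i) ?iota_uniq //= Ai ti big1_seq ?addn0 // => j /andP[ji].
  move: Hi; rewrite !mem_index_iota => Hi Hj; case: (A j) => //.
  case E: (s j <= t < s j + w j) => //.
  have := disj (i := i) (j := j) ltac:(lia) ltac:(lia) ltac:(by apply/eqP; rewrite eq_sym).
  by lia.
rewrite big1_seq // => i /andP[Ai Hi]; have := Hn i Hi; rewrite Ai /=.
by move=> /negbTE ->.
Qed.

(* If every interval of [A] ends in the window [X - cap, X], then one that is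
   longer than [cap] precedes all the others. *)
Lemma window (A : pred nat) X cap d : (forall i, A i -> i < m /\ 0 < w i) ->
  (forall i, A i -> s i + w i <= X <= s i + w i + cap) -> A d -> cap < w d ->
  \sum_(0 <= i < m | A i && (i != d)) w i <= cap.
Proof.
move=> Am H Ad wd; have := H d Ad => Hd.
apply: leq_trans (packing (a := s d + w d) (b := X) _) _; last by lia.
move=> i im /andP[Ai /eqP id]; have Hi := H i Ai; split; last by lia.
have := disj im (Am _ Ad).1 id (Am _ Ai).2 (Am _ Ad).2; lia.
Qed.

End Packing.

Lemma ordered n (s len : 'I_n -> nat) (i j : 'I_n) : one_at_a_time s len ->
  i <> j -> 0 < len i -> 0 < len j -> s i + len i <= s j \/ s j + len j <= s i.
Proof.
move=> H ij hi hj; have [h|h] := leqP (s i + len i) (s j); first by left.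
have [h'|h'] := leqP (s j + len j) (s i); first by right.
(* If neither precedes the other, the later start time lies in both intervals. *)
by case: ij; apply: (H (maxn (s i) (s j))); lia.
Qed.

(** * Schedules of the gadget and subsets with sum [tA] *)

Section Gadget.
Variables (ws : seq nat) (tA tB H R : nat).
Notation n := (size ws).
Notation L := (3 * R + (tA + tB)).
Hypothesis ws_pos : all (leq 1) ws.
Hypothesis ws_sum : \sum_(0 <= i < n) nth 0 ws i = tA + tB.
Hypothesis H_big : tA + tB < H.
Hypothesis R_pos : 0 < R.

(* Jobs 0 and 1 are the large zero-delay jobs: items started before job 0 fill
   a window of length [tA], the others one of length [tB], which ends at job 1.
   The first item of each window is exempt from its length bound; jobs 2 and 3
   are longer than both windows and have to be these first items. *)
Definition job1 (j : nat) : nat :=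
  match j with 0 => R | 1 => 2 * R | 2 | 3 => H | j.+4 => nth 0 ws j end.
Definition jobd (j : nat) : nat := if j < 2 then 0 else L.
Definition job2 (j : nat) : nat :=
  match j with 0 => 2 * R + tB | 1 => R + tA | _ => 1 end.

Definition gadget : instance :=
  @Instance n.+4 (fun j => job1 j) (fun j => jobd j) (fun j => job2 j).

Lemma gadget_delays : delays_0_or L gadget.
Proof. by move=> j; rewrite /= /jobd; case: ifP; [left|right]. Qed.

Lemma job1_pos j : j < n.+4 -> 0 < job1 j.
Proof.
case: j => [|[|[|[|j]]]] //=; try lia.
by move=> hj; apply: (all_nthP 0 ws_pos); lia.
Qed.

Lemma job2_pos j : 0 < job2 j.
Proof. by case: j => [|[|j]] //=; lia. Qed.

(** An operation of length 2R on machine 1 precedes nothing if all starts are below 2R, so job 1 is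
    last there. On machine 2 the unit operation of an item follows job 0, and also job 1 if the item
    starts after job 0. Subtracting [L] from these bounds, an item ends at most [tA] before job 0
    starts, or at most [tB] before job 1 starts. *)
Lemma gadget_sound (S : schedule gadget) : feasible S ->
  (forall j, start1 S j < 2 * R) ->
  exists P : pred nat, \sum_(0 <= i < n | P i) nth 0 ws i = tA.
Proof.
case=> Hd H1 H2 Hlt.
pose s j := start1 S (inord j : 'I_n.+4); pose s2 j := start2 S (inord j : 'I_n.+4).
have Hs2 j : j < n.+4 -> s2 j = s j + job1 j + jobd j.
  by move=> hj; rewrite /s2 Hd /= inordK.
have lt2R j : s j < 2 * R by apply: Hlt.
have D1 i j : i < n.+4 -> j < n.+4 -> i <> j -> 0 < job1 i -> 0 < job1 j ->
    s i + job1 i <= s j \/ s j + job1 j <= s i.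
  move=> hi hj ij pi pj.
  have := @ordered _ _ _ (inord i) (inord j) H1.
  rewrite /= !inordK //; apply=> // E; apply: ij.
  by rewrite -(inordK hi) E inordK.
have D2 i j : i < n.+4 -> j < n.+4 -> i <> j ->
    s2 i + job2 i <= s2 j \/ s2 j + job2 j <= s2 i.
  move=> hi hj ij.
  have := @ordered _ _ _ (inord i) (inord j) H2.
  rewrite /= !inordK //; apply; rewrite ?job2_pos // => E; apply: ij.
  by rewrite -(inordK hi) E inordK.
have Y : s 0 + R <= s 1.
  have := D1 0 1 isT isT (ltac:(by [])) R_pos (job1_pos (j := 1) isT) => /=.
  by have := lt2R 0; lia.
have item j : 1 < j < n.+4 ->
  [/\ 0 < job1 j, s2 j = s j + job1 j + L & job2 j = 1].
  move=> hj; split; first by apply: job1_pos; lia.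
    by rewrite Hs2 /jobd; last lia; rewrite ltnNge; have -> : 1 < j by lia.
  by case: j hj => [|[|j]].
have S0 : s2 0 = s 0 + R by rewrite Hs2 //= /jobd /= addn0.
have S1 : s2 1 = s 1 + 2 * R by rewrite Hs2 //= /jobd /= addn0.
have before1 j : 1 < j < n.+4 -> s j + job1 j <= s 1.
  move=> hj; have [p _ _] := item j hj.
  have := D1 1 j isT ltac:(lia) ltac:(lia) (job1_pos (j := 1) isT) p => /=.
  by have := lt2R j; lia.
have after0 j : 1 < j < n.+4 -> s2 0 + (2 * R + tB) <= s2 j.
  move=> hj; have [p e1 e2] := item j hj.
  have := D2 0 j isT ltac:(lia) ltac:(lia); rewrite e2 /=.
  by have := lt2R 0; lia.
pose A j := (1 < j < n.+4) && (s j < s 0).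
pose B j := (1 < j < n.+4) && ~~ (s j < s 0).
have WA d : A d -> tA < job1 d -> \sum_(0 <= i < n.+4 | A i && (i != d)) job1 i <= tA.
  apply: (window D1 (X := s 0)) => i /andP[hi lt].
    by have [p _ _] := item i hi; split; lia.
  have [p e1 e2] := item i hi; have := after0 i hi.
  have := D1 0 i isT ltac:(lia) ltac:(lia) R_pos p => /=.
  by lia.
have WB d : B d -> tB < job1 d -> \sum_(0 <= i < n.+4 | B i && (i != d)) job1 i <= tB.
  apply: (window D1 (X := s 1)) => i /andP[hi lt].
    by have [p _ _] := item i hi; split; lia.
  have [p e1 e2] := item i hi; have b1 := before1 i hi.
  have := D1 0 i isT ltac:(lia) ltac:(lia) R_pos p => /=.
  have := D2 1 i isT ltac:(lia) ltac:(lia); rewrite e2 /=.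
  by have := lt2R 1; lia.
pose P i := s i.+4 < s 0; exists P.
have shift (C : pred nat) : \sum_(0 <= i < n.+4 | C i) job1 i =
    C 0 * job1 0 + (C 1 * job1 1 + (C 2 * H + (C 3 * H +
      \sum_(0 <= i < n | C i.+4) nth 0 ws i))).
  rewrite big_mkcond /= !big_nat_recl //= -big_mkcond /=.
  by do !congr (_ + _); case: (C _); rewrite ?mul1n ?mul0n.
(* With job 2 exempted as first item of a window, job 3 in the same window would still exceed the
   cap. *)
have noboth (C : pred nat) cap : (forall d, C d -> cap < job1 d ->
    \sum_(0 <= i < n.+4 | C i && (i != d)) job1 i <= cap) -> cap < H ->
    ~~ (C 2 && C 3).
  move=> W hH; apply/negP => /andP[C2 C3]; have := W 2 C2 hH.
  by rewrite shift C3 /=; lia.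
have sumC (C : pred nat) cap : (forall d, C d -> cap < job1 d ->
    \sum_(0 <= i < n.+4 | C i && (i != d)) job1 i <= cap) -> cap < H ->
    C 2 || C 3 -> \sum_(0 <= i < n | C i.+4) nth 0 ws i <= cap.
  move=> W hH /orP[]C2; have := W _ C2 hH; rewrite shift /=;
    rewrite (eq_bigl (fun i => C i.+4)) => [|i]; rewrite ?andbT //; lia.
(* Each of jobs 2 and 3 starts on one side of job 0, so each window holds exactly one of them, and
   that one is its exempt item. *)
have nA := noboth A tA WA ltac:(lia); have nB := noboth B tB WB ltac:(lia).
have sA := sumC A tA WA ltac:(lia); have sB := sumC B tB WB ltac:(lia).
have {}sA : \sum_(0 <= i < n | P i) nth 0 ws i <= tA.
  move: sA; rewrite big_nat_cond (eq_bigl (fun i => (0 <= i < n) && P i)).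
    rewrite -big_nat_cond; apply; move: nA nB; rewrite /A /B /=.
    by case: (_ < _); case: (_ < _).
  by move=> i; rewrite /A /P; case hi: (0 <= i < n) => //=; rewrite hi.
have {}sB : \sum_(0 <= i < n | ~~ P i) nth 0 ws i <= tB.
  move: sB; rewrite big_nat_cond (eq_bigl (fun i => (0 <= i < n) && ~~ P i)).
    rewrite -big_nat_cond; apply; move: nA nB; rewrite /A /B /=.
    by case: (_ < _); case: (_ < _).
  by move=> i; rewrite /B /P; case hi: (0 <= i < n) => //=; rewrite hi.
(* The two bounds add up to the full sum [tA + tB], so both are attained. *)
by have E := ws_sum; rewrite (bigID P) /= in E; lia.
Qed.

Lemma gadget_complete (P : pred nat) :
  \sum_(0 <= i < n | P i) nth 0 ws i = tA ->
  exists2 S : schedule gadget, feasible S & makespan S <= 4 * R + 4 * H.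
Proof.
move=> HP.
have HB : \sum_(0 <= i < n | ~~ P i) nth 0 ws i = tB.
  by have E := ws_sum; rewrite (bigID P) /= in E; lia.
pose pre (C : pred nat) i := \sum_(0 <= k < i | C k) nth 0 ws k.
have preS (C : pred nat) i j : C i -> i < j -> pre C i + nth 0 ws i <= pre C j.
  move=> Ci ij; have <- : pre C i.+1 = pre C i + nth 0 ws i.
    by rewrite /pre big_mkcond big_nat_recr //= -big_mkcond Ci.
  by rewrite /pre [leqRHS](big_cat_nat (n := i.+1)) //= leq_addr.
have preA i : P i -> i < n -> pre P i + nth 0 ws i <= tA.
  by move=> Pi hi; rewrite -HP; apply: preS.
have preB i : ~~ P i -> i < n -> pre (predC P) i + nth 0 ws i <= tB.
  by move=> Pi hi; rewrite -HB; apply: (preS (predC P)).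
(* Machine 1 runs without idle time: job 2, the items of [P], job 0, job 3 (at [sB]), the other
   items, job 1. On machine 2, jobs 2 and 3 then start exactly when jobs 0 and 1 end. *)
pose sB := H + tA + R.
pose s1 j := match j with 0 => H + tA | 1 => sB + H + tB | 2 => 0 | 3 => sB
  | j.+4 => if P j then H + pre P j else sB + H + pre (predC P) j end.
pose s2 j := s1 j + job1 j + jobd j.
have oaat s l : (forall i j, i < j < n.+4 -> s i + l i <= s j \/ s j + l j <= s i) ->
    @one_at_a_time n.+4 (fun i => s i) (fun i => l i).
  move=> D t i j hi hj; apply/val_inj/eqP => /=; case: (ltngtP i j) => // lt.
    by have := D i j; rewrite lt ltn_ord => /(_ isT); lia.
  by have := D j i; rewrite lt ltn_ord => /(_ isT); lia.
(* Unit operations on machine 2 are spaced like the ends of the first operations, so positive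
   lengths keep them disjoint. *)
have w_pos i : i < n -> 0 < nth 0 ws i by move=> hi; apply: (all_nthP 0 ws_pos).
exists (@Schedule gadget (fun i => s1 i) (fun i => s2 i)).
  split=> /=; first by [].
  - apply: oaat => i j /andP[ij jn].
    case: i j ij jn => [|[|[|[|i]]]] [|[|[|[|j]]]] //= ij jn; rewrite /sB; try lia.
    1-4: by have := @preA j; have := @preB j; case: (P j) => /=; lia.
    have := @preA i; have := @preB i; have := @preA j; have := @preB j.
    have := @preS P i j; have := @preS (predC P) i j => /=.
    by case: (P i); case: (P j) => /=; lia.
  - apply: oaat => i j /andP[ij jn]; rewrite /s2 /jobd.
    case: i j ij jn => [|[|[|[|i]]]] [|[|[|[|j]]]] //= ij jn; rewrite /sB; try lia.
    1-4: by have := @preA j; have := @preB j; have := w_pos j; case: (P j) => /=; lia.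
    have := @preA i; have := @preB i; have := @preA j; have := @preB j.
    have := @preS P i j; have := @preS (predC P) i j; have := w_pos i; have := w_pos j => /=.
    by case: (P i); case: (P j) => /=; lia.
apply/bigmax_leqP => -[j hj] _ /=; rewrite geq_max /s2 /jobd.
case: j hj => [|[|[|[|j]]]] //= hj; rewrite /sB; try lia.
have := @preA j; have := @preB j; case: (P j) => /=; lia.
Qed.

(** Each kind of job takes at least 3R altogether: R + 2R for job 0, 2R + R for job 1, and [L] for
    an item. *)
Lemma gadget_small_start (S : schedule gadget) : feasible S ->
  makespan S < 5 * R -> forall j, start1 S j < 2 * R.
Proof.
case=> Hd _ _ HS j.
have : maxn (start1 S j + len1 j) (start2 S j + len2 j) < 5 * R.
  apply: leq_ltn_trans HS; exact: (leq_bigmax (F := fun j => maxn (start1 S j + len1 j) (start2 S j + len2 j))).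
rewrite gtn_max => /andP[_]; rewrite Hd; case: j => -[|[|j]] hj; rewrite /= ?/jobd /=; lia.
Qed.

End Gadget.

(** * From tilings to subset sums *)

Lemma digit_inj b x y x' y' : x < b -> x' < b -> x + b * y = x' + b * y' ->
  x = x' /\ y = y'.
Proof.
move=> hx hx' E; have b0 : 0 < b by lia.
have Ex : x = x'.
  by have := congr1 (modn^~ b) E; rewrite /= !(addnC _ (b * _)) !(mulnC b) !modnMDl !modn_small.
split=> //; apply/eqP; rewrite -(eqn_pmul2l b0); apply/eqP; lia.
Qed.

(** * Positional notation without carries *)

Section Radix.
Variables (P : eqType) (B : nat).

Definition dval (f : P -> nat) (ps : seq P) : nat :=
  foldr (fun p a => f p + B * a) 0 ps.

Lemma eq_dval f g ps : {in ps, f =1 g} -> dval f ps = dval g ps.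
Proof.
elim: ps => //= p ps IH H; rewrite H ?mem_head // IH // => q hq.
by rewrite H // inE hq orbT.
Qed.

Lemma dval_sum (J : Type) (r : seq J) (Q : pred J) (F : J -> P -> nat) ps :
  \sum_(j <- r | Q j) dval (F j) ps = dval (fun p => \sum_(j <- r | Q j) F j p) ps.
Proof.
elim: ps => [|p ps IH] /=; first by rewrite big1.
by rewrite big_split /= -big_distrr /= IH.
Qed.

Lemma dval_inj f g ps : (forall p, p \in ps -> f p < B) ->
  (forall p, p \in ps -> g p < B) -> dval f ps = dval g ps -> {in ps, f =1 g}.
Proof.
elim: ps => //= p ps IH Hf Hg E.
have [e1 e2] := digit_inj (Hf p (mem_head _ _)) (Hg p (mem_head _ _)) E.
move=> q; rewrite inE => /predU1P[->//|hq]; apply: IH => // r hr.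
  by apply: Hf; rewrite inE hr orbT.
by apply: Hg; rewrite inE hr orbT.
Qed.

Lemma dval_lt f ps : (forall p, p \in ps -> f p < B) -> dval f ps < B ^ size ps.
Proof.
elim: ps => //= p ps IH H.
have h1 := H p (mem_head _ _); have h2 : dval f ps < B ^ size ps.
  by apply: IH => q hq; apply: H; rewrite inE hq orbT.
rewrite expnS; apply: (@leq_trans (B * (dval f ps).+1)); last by rewrite leq_mul2l h2 orbT.
by rewrite mulnS; lia.
Qed.

End Radix.

Definition cnext (N k : nat) : nat := if k.+1 == N then 0 else k.+1.

Lemma cnext_lt N k : k < N -> cnext N k < N.
Proof. by rewrite /cnext; case: eqP; lia. Qed.

Section TilingToSubsetSum.
Variables (TT : finType) (ec wc nc sc : TT -> nat) (K N g : nat) (lab : nat -> nat).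
Hypotheses (ecK : forall x, ec x <= K) (wcK : forall x, wc x <= K).
Hypotheses (ncK : forall x, nc x <= K) (scK : forall x, sc x <= K).
Hypotheses (labK : forall k, lab k <= K) (N1 : 0 < N).
Notation b := (2 ^ g).
Hypothesis b_big : 2 * (#|TT| * K) + #|TT| + K + 1 < b.

(* A digit in base [2 ^ (3 * g)] packs three counters for a cell: its tiles, the
   colours of its east edge and those of its south edge.  Of the two tiles at
   an edge one adds the code of its colour and the other one [K] minus the code,
   so that the colours agree iff the counter is [K]. *)
Definition dig0 (x : TT) : nat := 1 + b * (ec x + b * (K - sc x)).
Definition dig1 (x : TT) : nat := b * (K - wc x).
Definition dig2 (x : TT) : nat := b * (b * nc x).

Definition grid : seq (nat * nat) := [seq (t, k) | t <- iota 0 N, k <- iota 0 N].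
Definition items : seq (nat * nat * TT) := [seq (p, x) | p <- grid, x <- enum TT].

(** A position collects from the cell itself, from its east neighbour, which completes the counter
    of the east edge, and from the cell below, which completes that of the south edge. *)
Definition digit (it : nat * nat * TT) (p : nat * nat) : nat :=
  (it.1 == p) * dig0 it.2 + (it.1 == (p.1, cnext N p.2)) * dig1 it.2
  + ((0 < p.1) && (it.1 == (p.1.-1, p.2))) * dig2 it.2.

(** In the bottom row no tile below completes the south counter; the prescribed label takes its
    place. *)
Definition target_digit (p : nat * nat) : nat :=
  1 + b * (K + b * (if p.1 == 0 then K - lab p.2 else K)).

Notation value f := (dval (2 ^ (3 * g)) f grid).

Definition weight (it : nat * nat * TT) : nat := value (digit it).

Definition tiling (f : nat -> nat -> TT) : Prop :=
  [/\ forall t k, t < N -> k < N -> ec (f t k) = wc (f t (cnext N k)),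
      forall t k, t.+1 < N -> k < N -> nc (f t k) = sc (f t.+1 k) &
      forall k, k < N -> sc (f 0 k) = lab k].

Lemma mem_grid t k : ((t, k) \in grid) = (t < N) && (k < N).
Proof.
apply/allpairsP/andP => [[[u v] /= [h1 h2 [-> ->]]]|[h1 h2]].
  by move: h1 h2; rewrite !mem_iota.
by exists (t, k); rewrite !mem_iota.
Qed.

Lemma uniq_grid : uniq grid.
Proof. by apply: allpairs_uniq; rewrite ?iota_uniq // => -[? ?] [? ?] _ _. Qed.

Lemma uniq_items : uniq items.
Proof.
apply: allpairs_uniq; rewrite ?uniq_grid ?enum_uniq //.
by move=> [? ?] [? ?] _ _.
Qed.

Lemma sum_grid (p : nat * nat) (F : nat * nat -> nat) : p \in grid ->
  \sum_(q <- grid) (q == p) * F q = F p.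
Proof.
move=> hp; rewrite (bigD1_seq p) ?uniq_grid //= eqxx mul1n big1 ?addn0 //.
by move=> q /negbTE ->.
Qed.

Definition csum (Q : pred (nat * nat * TT)) (p : nat * nat) (F : TT -> nat) : nat :=
  \sum_(x : TT) Q (p, x) * F x.

Lemma column_sum Q p : p \in grid ->
  \sum_(it <- items | Q it) digit it p =
  csum Q p (fun=> 1) + b * ((csum Q p ec + csum Q (p.1, cnext N p.2) (fun x => K - wc x)) +
     b * (csum Q p (fun x => K - sc x) + (0 < p.1) * csum Q (p.1.-1, p.2) nc)).
Proof.
case: p => t k hp; move: (hp); rewrite mem_grid => /andP[ht hk].
transitivity (csum Q (t, k) dig0 + csum Q (t, cnext N k) dig1 + (0 < t) * csum Q (t.-1, k) dig2).
  rewrite big_mkcond /= /items big_allpairs /= /digit /=.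
  transitivity (\sum_(q <- grid) ((q == (t, k)) * csum Q q dig0
      + (q == (t, cnext N k)) * csum Q q dig1
      + (0 < t) * ((q == (t.-1, k)) * csum Q q dig2))).
    apply: eq_bigr => q _; rewrite /csum !big_distrr /= big_enum -!big_split /=.
    apply: eq_bigr => x _; case: (Q (q, x)); rewrite ?mul1n ?mul0n ?muln0 //.
    by rewrite -mulnb mulnA.
  by rewrite !big_split /= -big_distrr /= !sum_grid // mem_grid ?cnext_lt ?hk ?ht //=; lia.
have scale q c F : csum Q q (fun x => c * F x) = c * csum Q q F.
  by rewrite /csum big_distrr /=; apply: eq_bigr => x _; rewrite mulnCA.
have -> : csum Q (t, k) dig0 = csum Q (t, k) (fun=> 1) +
    b * (csum Q (t, k) ec + b * csum Q (t, k) (fun x => K - sc x)).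
  rewrite mulnDr -!scale /csum -!big_split /=; apply: eq_bigr => x _.
  by rewrite -!mulnDr /dig0 mulnDr.
rewrite /dig1 /dig2 !scale -!addnA !mulnDr.
by case: (0 < t); rewrite ?mul1n ?mul0n ?muln0 /=; lia.
Qed.

Lemma csum_le Q p F M : (forall x, F x <= M) -> csum Q p F <= #|TT| * M.
Proof.
move=> H; rewrite -sum_nat_const; apply: leq_sum => x _.
by case: (Q _); rewrite ?mul1n ?mul0n.
Qed.

(** These bounds hold for every subset of the items, so neither the counters nor the digits ever
    carry. *)
Lemma column_small Q p : p \in grid ->
  [/\ csum Q p (fun=> 1) < b,
      csum Q p ec + csum Q (p.1, cnext N p.2) (fun x => K - wc x) < b,
      csum Q p (fun x => K - sc x) + (0 < p.1) * csum Q (p.1.-1, p.2) nc < b &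
      \sum_(it <- items | Q it) digit it p < 2 ^ (3 * g)].
Proof.
move=> hp.
have h1 : csum Q p (fun=> 1) < b.
  by have := @csum_le Q p (fun=> 1) 1 (fun=> leqnn 1); lia.
have h2 : csum Q p ec + csum Q (p.1, cnext N p.2) (fun x => K - wc x) < b.
  have := @csum_le Q p ec K ecK.
  have := @csum_le Q (p.1, cnext N p.2) (fun x => K - wc x) K (fun x => leq_subr _ _).
  by lia.
have h3 : csum Q p (fun x => K - sc x) + (0 < p.1) * csum Q (p.1.-1, p.2) nc < b.
  have := @csum_le Q p (fun x => K - sc x) K (fun x => leq_subr _ _).
  have := @csum_le Q (p.1.-1, p.2) nc K ncK; case: (0 < p.1); lia.
split=> //; rewrite column_sum //.
set x := csum _ _ _ in h1 *; set y := _ + _ in h2 *; set z := _ + _ in h3 *.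
have -> : 2 ^ (3 * g) = b * (b * b) by rewrite mulnC expnM !expnS expn0; lia.
have h4 : y + b * z < b * b by nia.
by nia.
Qed.

Lemma target_small p : target_digit p < 2 ^ (3 * g).
Proof.
have -> : 2 ^ (3 * g) = b * (b * b) by rewrite mulnC expnM !expnS expn0; lia.
rewrite /target_digit; set y := (if _ then _ else _).
have hy : y <= K by rewrite /y; case: ifP => _; lia.
have h4 : K + b * y < b * b by nia.
by nia.
Qed.

(** Without carries the sum meets the target counter by counter. A tile counter of 1 means one
    selected tile per cell; after that, an edge counter of [K] says that two codes agree. *)
Lemma tiling_of_subset Q : \sum_(it <- items | Q it) weight it = value target_digit ->
  exists f, tiling f.
Proof.
rewrite dval_sum => /dval_inj E.
have {}E p : p \in grid -> [/\ csum Q p (fun=> 1) = 1,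
    csum Q p ec + csum Q (p.1, cnext N p.2) (fun x => K - wc x) = K &
    csum Q p (fun x => K - sc x) + (0 < p.1) * csum Q (p.1.-1, p.2) nc =
      if p.1 == 0 then K - lab p.2 else K].
  move=> hp; have [h1 h2 h3 _] := column_small Q hp.
  have := E _ (fun p _ => target_small p) p hp; rewrite column_sum // => {}E.
  have [|||e1 e2] := digit_inj _ _ (E _); [by []|lia| |].
    by move=> q hq; have [_ _ _] := column_small Q hq.
  by have [||e3 e4] := digit_inj _ _ e2; [|lia|].
have pickQ p : p \in grid -> exists x0, forall F, csum Q p F = F x0.
  move=> hp; have [e1 _ _] := E p hp.
  have : #|[pred x | Q (p, x)]| = 1.
    rewrite -sum1_card -e1 /csum big_mkcond /=; apply: eq_bigr => x _.
    by rewrite inE muln1; case: (Q _).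
  move=> /mem_card1[x0 Hx0]; exists x0 => F.
  rewrite /csum (bigD1 x0) //= big1 => [|x /negbTE nx].
    by have := Hx0 x0; rewrite !inE eqxx => ->; rewrite mul1n addn0.
  by have := Hx0 x; rewrite !inE nx => ->.
(* The choice function below is total, so cells outside the grid need some default tile. *)
have [x0 _] : exists x0 : TT, True.
  by have [|x0 _] := pickQ (0, 0); [rewrite mem_grid N1|exists x0].
have [h Hh] : {h : nat * nat -> TT & forall p, p \in grid -> forall F, csum Q p F = F (h p)}.
  apply: (choice (P := fun p x => p \in grid -> forall F, csum Q p F = F x)) => p.
  have [hp|_] := boolP (p \in grid); last by exists x0.
  by have [x Hx] := pickQ p hp; exists x.
pose f t k := h (t, k).
have Hf t k F : t < N -> k < N -> csum Q (t, k) F = F (f t k).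
  by move=> ht hk; apply: Hh; rewrite mem_grid ht.
exists f; split=> [t k ht hk|t k ht hk|k hk].
- have [|_ + _] := E (t, k); first by rewrite mem_grid ht.
  by rewrite /= !Hf ?cnext_lt //; have := wcK (f t (cnext N k)); lia.
- have [|_ _ /=] := E (t.+1, k); first by rewrite mem_grid ht.
  rewrite !Hf //; last by lia.
  by have := scK (f t.+1 k); lia.
- have [|_ _ /=] := E (0, k); first by rewrite mem_grid N1.
  by rewrite !Hf //; have := scK (f 0 k); have := labK k; lia.
Qed.

Lemma subset_of_tiling f : tiling f ->
  exists Q, \sum_(it <- items | Q it) weight it = value target_digit.
Proof.
case=> He Hn Hl; exists (fun it => f it.1.1 it.1.2 == it.2).
rewrite dval_sum; apply: eq_dval => -[t k] hp; rewrite column_sum //.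
move: hp; rewrite mem_grid => /andP[ht hk].
have Hc u l F : csum (fun it => f it.1.1 it.1.2 == it.2) (u, l) F = F (f u l).
  rewrite /csum (bigD1 (f u l)) //= eqxx mul1n big1 ?addn0 // => x.
  by rewrite eq_sym => /negbTE ->.
rewrite /= !Hc /target_digit /= -He // (_ : ec _ + _ = K); last first.
  by have := ecK (f t k); lia.
congr (_ + b * (K + b * _)); case: t ht => [|t] ht /=; first by rewrite Hl // addn0.
by rewrite mul1n Hn //; have := scK (f t.+1 k); lia.
Qed.

Lemma weight_pos it : it.1 \in grid -> 0 < weight it.
Proof.
rewrite /weight; elim: grid => //= p ps IH; rewrite inE => /predU1P[e|hps].
  by rewrite addn_gt0 {1}/digit e eqxx mul1n /dig0 !addn_gt0.
by rewrite addn_gt0 muln_gt0 expn_gt0 IH ?orbT.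
Qed.

(** Summed over all items, a digit depends only on whether it belongs to the bottom row, so two
    constants suffice to print the total. *)
Definition total_digit (p : nat * nat) : nat :=
  \sum_(x : TT) (dig0 x + dig1 x) + (0 < p.1) * \sum_(x : TT) dig2 x.

Lemma total_digitE p : p \in grid -> \sum_(it <- items) digit it p = total_digit p.
Proof.
case: p => t k hp; move: (hp); rewrite mem_grid => /andP[ht hk].
rewrite /items big_allpairs /=.
transitivity (\sum_(q <- grid) ((q == (t, k)) * \sum_x dig0 x
      + (q == (t, cnext N k)) * \sum_x dig1 x
      + (0 < t) * ((q == (t.-1, k)) * \sum_x dig2 x))).
  apply: eq_bigr => q _; rewrite big_enum /= /digit /= !big_distrr -!big_split /=.
  by apply: eq_bigr => x _; rewrite -mulnb mulnA.
have const p c : p \in grid -> \sum_(q <- grid) (q == p) * c = c.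
  exact: (sum_grid (fun=> c)).
rewrite /total_digit [X in _ = X + _]big_split /=.
move: (\sum_x dig0 x) (\sum_x dig1 x) (\sum_x dig2 x) => S0 S1 S2.
rewrite !big_split /= -big_distrr /= !const //.
- by rewrite mem_grid hk (leq_ltn_trans (leq_pred t) ht).
- by rewrite mem_grid ht cnext_lt.
Qed.

Lemma total_weight : \sum_(it <- items) weight it = value total_digit.
Proof. by rewrite dval_sum; apply: eq_dval => p /total_digitE. Qed.

Lemma total_small : value total_digit < (2 ^ (3 * g)) ^ size grid.
Proof.
apply: dval_lt => p hp; rewrite -total_digitE //.
by have [_ _ _] := column_small xpredT hp.
Qed.

(** This lets [tB] be the digitwise difference of total and target, without borrows. West and south
    codes are at most half of [K] and there are at least two tiles, so the complements [K - wc x]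
    alone reach [K], and likewise for [sc]. *)
Lemma target_le_total p : (forall x, 2 * wc x <= K) -> (forall x, 2 * sc x <= K) ->
  1 < #|TT| -> target_digit p <= total_digit p.
Proof.
move=> hw hs hT; apply: (@leq_trans (\sum_(x : TT) (dig0 x + dig1 x))); last exact: leq_addr.
have half (F : TT -> nat) : (forall x, 2 * F x <= K) -> K <= \sum_x (K - F x).
  move=> hF; have : #|TT| * K <= 2 * \sum_x (K - F x).
    rewrite -sum_nat_const big_distrr /=; apply: leq_sum => x _; have := hF x; lia.
  have : 2 * K <= #|TT| * K by rewrite leq_mul2r hT orbT.
  by lia.
have -> : \sum_(x : TT) (dig0 x + dig1 x) =
    #|TT| + b * ((\sum_x ec x + \sum_x (K - wc x)) + b * \sum_x (K - sc x)).
  rewrite -sum1_card -big_split /= [b * \sum_x _]big_distrr -big_split /=.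
  rewrite [b * \sum_x _]big_distrr -big_split /=.
  by apply: eq_bigr => x _; rewrite /dig0 /dig1; lia.
rewrite /target_digit leq_add //; first by lia.
rewrite leq_mul2l leq_add ?orbT //; first by have := half _ hw; lia.
rewrite leq_mul2l; apply/orP; right; apply: leq_trans (half _ hs); case: ifP => _; lia.
Qed.

End TilingToSubsetSum.

(** * From machines to tilings *)

Definition oor (A : Type) (a b : option A) : option A := if a is Some _ then a else b.

Lemma oorN (A : Type) (a : option A) : oor a None = a.
Proof. by case: a. Qed.

(** * Tapes indexed relative to their heads *)

Section CyclicTape.
Variables (A : Type) (N : nat).

Definition cprev (k : nat) : nat := if k == 0 then N.-1 else k.-1.

Lemma cnextK k : k < N -> cprev (cnext N k) = k.
Proof. by rewrite /cprev /cnext; case: (eqVneq k.+1 N) => [<-|]. Qed.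

Lemma cprevK k : k < N -> cnext N (cprev k) = k.
Proof. by rewrite /cprev /cnext; case: (eqVneq k 0) => [->|k0] /=; case: eqP; lia. Qed.

Lemma cprev_lt k : k < N -> cprev k < N.
Proof. by rewrite /cprev; case: (eqVneq k 0) => [->|k0]; lia. Qed.

(* Cells are indexed relative to the head, modulo [N]. *)
Definition cell_at (l r : seq (option A)) (k : nat) : option A :=
  oor (nth None r k) (nth None l (N.-1 - k)).

Variables (l r : seq (option A)) (s : option A).
Hypothesis lrN : size l + size r + 2 <= N.

Lemma cell_at0 : cell_at l r 0 = head None r.
Proof. by rewrite /cell_at (nth_default None (s := l)) ?oorN ?nth0 //; lia. Qed.

(** A left move renumbers all cells one column up; the cell just written had index 0. The slack in
    the bound on [N] leaves room for the cell that a step may add. *)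
Lemma cell_at_left k : k < N -> cell_at (behead l) (head None l :: s :: behead r) k =
  if cprev k == 0 then s else cell_at l r (cprev k).
Proof.
rewrite /cell_at /cprev; case: k => [|[|k]] hk /=.
- have -> : (N.-1 == 0) = false by lia.
  rewrite (nth_default None (s := behead l)) ?size_behead; last by lia.
  by rewrite oorN subnn nth0 (nth_default None (s := r)) //; lia.
- by rewrite (nth_default None (s := behead l)) ?size_behead ?oorN //; lia.
- by rewrite !nth_behead /=; congr (oor _ (nth _ _ _)); lia.
Qed.

Lemma cell_at_stay k : k < N -> cell_at l (s :: behead r) k =
  if k == 0 then s else cell_at l r k.
Proof.
rewrite /cell_at; case: k => [|k] hk /=; last by rewrite nth_behead.
by rewrite (nth_default None (s := l)) ?oorN //; lia.
Qed.

Lemma cell_at_right k : k < N -> cell_at (s :: l) (behead r) k =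
  if cnext N k == 0 then s else cell_at l r (cnext N k).
Proof.
rewrite /cell_at /cnext => hk; case: (eqVneq k.+1 N) => [E|nE] /=.
  rewrite nth_behead (nth_default None (s := r)) /=; last by lia.
  by have -> : N.-1 - k = 0 by lia.
by rewrite nth_behead; have -> : N.-1 - k = (N.-1 - k.+1).+1 by lia.
Qed.

End CyclicTape.

Section Columns.
Variables (M : machine) (N : nat).
Notation cel := (cell M).
Notation content := {ffun 'I_(ntapes M).+1 -> cel}.

Definition column (c : config M) (k : nat) : content :=
  [ffun i => cell_at N (c.2 i).1 (c.2 i).2 k].

Definition next_state (q : state M) (h : content) : state M :=
  if halting q then q else (trans q h).1.

(** Each tape shifts with its own head, so its new cell comes from the column before, the same one
    or the one after. The flag marks the column under the heads, whose cell was overwritten. *)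
Definition next_content (q : state M) (h : content) (a b d : content * bool) : content :=
  if halting q then b.1 else
  [ffun i => let x := (trans q h).2 i in
     let: (u, hd) := match x.2 with MoveLeft => a | Stay => b | MoveRight => d end in
     if hd then x.1 else u i].

Definition fits (c : config M) : Prop :=
  forall i, size (c.2 i).1 + size (c.2 i).2 + 2 <= N.

Lemma column0 c : fits c -> column c 0 = [ffun i => read (c.2 i)].
Proof.
by move=> H; apply/ffunP => i; rewrite !ffunE; apply: (cell_at0 (H i)).
Qed.

Lemma next_stateE c : fits c -> next_state c.1 (column c 0) = (step c).1.
Proof.
move=> H; rewrite /next_state /step; case: ifP => // _; rewrite column0 //.
by case: (trans _ _).
Qed.

Lemma columnS c k : fits c -> k < N ->
  column (step c) k = next_content c.1 (column c 0)
    (column c (cprev N k), cprev N k == 0) (column c k, k == 0)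
    (column c (cnext N k), cnext N k == 0).
Proof.
move=> Hf hk; rewrite /next_content /step column0 //; case: ifP => // _.
case: (trans _ _) => q act /=; apply/ffunP => i; rewrite !ffunE /=.
have := Hf i; case E: (c.2 i) => [l r]; case: (act i) => s [] Hi /=.
- by rewrite ffunE E; exact: (cell_at_left s Hi).
- by rewrite ffunE E; exact: (cell_at_stay s Hi).
- by rewrite ffunE E; exact: (cell_at_right s Hi).
Qed.

Lemma size_config n (x : seq bool) i :
  size ((iter n (@step M) (initial M x)).2 i).1 <= n /\
  size ((iter n (@step M) (initial M x)).2 i).2 <= size x + n + 1.
Proof.
elim: n => [|n [IH1 IH2]] /=.
  by rewrite ffunE; case: (i == ord0); rewrite /= ?size_map; split=> //; lia.
move: IH1 IH2; set c := iter n _ _; rewrite /step; case: ifP => _; first by lia.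
case: (trans _ _) => q act /=; rewrite ffunE; case: (c.2 i) => l r /=.
by case: (act i) => s [] /=; rewrite /= ?size_behead; lia.
Qed.

End Columns.

(** * Tiles that enforce the computation of a machine *)

Section MachineTiles.
Variable M : machine.
Notation cel := (cell M).
Notation content := {ffun 'I_(ntapes M).+1 -> cel}.

(* Labels of the bottom row: an input bit, flagged in column 0; a cell to be
   guessed; a blank. *)
Definition label : finType := ((bool * bool) + bool)%type.
Definition guess_label : label := inr true.
Definition blank_label : label := inr false.

(* A column is described by the state of the machine, the cells of all tapes and
   whether the heads are there; horizontal edges carry the cells under the heads
   and the contents of both adjacent columns, or, in the bottom row, whether the
   guess may still continue. *)
Definition vcol : finType := (label + (state M * content * bool))%type.
Definition hcol : finType := (bool + (content * (content * bool) * (content * bool)))%type.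

Definition on_tape0 (c : cel) : content := [ffun i => if i == ord0 then c else None].

(** Once the guess has stopped it cannot resume, so the guessed bits form one block, possibly
    shorter than the columns provided. Input columns ignore [g], since column 0 receives it
    cyclically from the last column. *)
Definition valid_bottom (lb : label) (g g' : bool) (v : state M * content * bool) : bool :=
  let: (q, u, hd') := v in
  (q == start M) &&
  match lb with
  | inl (hd, b) => [&& g', u == on_tape0 (Some (inl b)) & hd' == hd]
  | inr true => ~~ hd' &&
    ([&& g, g' & (u == on_tape0 (Some (inl true))) || (u == on_tape0 (Some (inl false)))]
     || ~~ g' && (u == on_tape0 None))
  | inr false => [&& ~~ g', u == on_tape0 None & ~~ hd']
  end.

(* Below a head in a halting state tape 0 must hold [true], whence only accepting
   runs have tilings. *)
Definition valid_step (w e : content * (content * bool) * (content * bool))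
    (s n : state M * content * bool) : bool :=
  let: (h, a, b1) := w in let: (h', b2, d) := e in
  let: (q, b, hb) := s in let: (q', u, hb') := n in
  [&& h == h', b1 == (b, hb), b2 == (b, hb), hb ==> (h == b) &
   [&& q' == next_state q h, u == next_content q h a (b, hb) d, hb' == hb &
       hb && halting q ==> (b ord0 == Some (inl true))]].

Definition valid_tile (x : hcol * hcol * vcol * vcol) : bool :=
  match x with
  | (inl g, inl g', inl lb, inr v) => valid_bottom lb g g' v
  | (inr w, inr e, inr s, inr n) => valid_step w e s n
  | _ => false
  end.

Definition tile : finType := {x : hcol * hcol * vcol * vcol | valid_tile x}.
Definition west (x : tile) : hcol := (val x).1.1.1.
Definition east (x : tile) : hcol := (val x).1.1.2.
Definition south (x : tile) : vcol := (val x).1.2.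
Definition north (x : tile) : vcol := (val x).2.

Lemma bottom_tile (x : tile) lb : south x = inl lb -> exists g g' v,
  [/\ west x = inl g, east x = inl g', north x = inr v & valid_bottom lb g g' v].
Proof.
case: x => -[[[w e] s] n]; rewrite /south /west /east /north /= => + E.
rewrite {s}E; case: w => [g|w]; case: e => [g'|e]; case: n => [lb'|v] //= H.
by exists g, g', v.
Qed.

Lemma step_tile (x : tile) v : south x = inr v -> exists w e n,
  [/\ west x = inr w, east x = inr e, north x = inr n & valid_step w e v n].
Proof.
case: x => -[[[w e] s] n]; rewrite /south /west /east /north /= => + E.
rewrite {s}E; case: w => [g|w]; case: e => [g'|e]; case: n => [lb'|n] //= H.
by exists w, e, n.
Qed.

Definition code (A : finType) (a : A) : nat := enum_rank a.

Lemma code_inj (A : finType) : injective (@code A).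
Proof. by move=> a b /val_inj /enum_rank_inj. Qed.

Lemma code_lt (A : finType) (a : A) : code a < #|A|.
Proof. exact: ltn_ord. Qed.

(** The factor 2 keeps codes at or below half of the bound, as [target_le_total] demands. *)
Definition code_max : nat := 2 * (#|hcol| + #|vcol|).

Lemma code_le_h (a : hcol) : 2 * code a <= code_max.
Proof. by have h := code_lt a; rewrite /code_max; lia. Qed.

Lemma code_le_v (a : vcol) : 2 * code a <= code_max.
Proof. by have h := code_lt a; rewrite /code_max; lia. Qed.

Definition input_labels (x : seq bool) : seq label :=
  [seq inl (i == 0, nth false x i) | i <- iota 0 (size x)].

Definition labels (z : seq bool) (q e : nat) : seq label :=
  input_labels z ++ nseq q guess_label ++ nseq e blank_label.

Definition label_code (ls : seq label) (k : nat) : nat :=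
  code (inl (nth blank_label ls k) : vcol).

(** * Tilings correspond to accepting runs *)

Section Correctness.
Variables (x : seq bool) (q e T : nat).
Notation z := (enc_bits x).
Notation ls := (labels z q e).
Notation N := (size ls).
Hypothesis N_big : 2 * T + (size z + q) + 5 <= N.
Hypothesis decides : forall y, size y <= q ->
  exists b, outputs_within M T (enc_pair x y) [:: b].

Notation machine_tiling := (tiling (fun t => code (east t)) (fun t => code (west t))
  (fun t => code (north t)) (fun t => code (south t)) N (label_code ls)).

Lemma size_labels : N = size z + q + e.
Proof. by rewrite !size_cat !size_nseq size_map size_iota addnA. Qed.

Lemma z_pos : 0 < size z.
Proof. by rewrite size_rcons. Qed.

Lemma nth_labels k : nth blank_label ls k =
  if k < size z then inl (k == 0, nth false z k)
  else if k < size z + q then guess_label else blank_label.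
Proof.
rewrite !nth_cat size_map size_iota size_nseq; case: ltnP => h.
  by rewrite (nth_map 0) ?size_iota // nth_iota // add0n.
case: ltnP => h1; case: ltnP => h2; rewrite ?nth_nseq ?h1 //; try lia.
by case: ifP.
Qed.

Definition run (y : seq bool) (t : nat) := iter t (@step M) (initial M (enc_pair x y)).

(** Halted configurations repeat, so the space bound for time [T] holds in all [N] rows of the
    tiling. *)
Lemma run_min y t : size y <= q -> run y t = run y (minn t T).
Proof.
move=> hy; have [b [hb _]] := decides hy; case: (leqP t T) => h; first by [].
by rewrite /run -(subnK (ltnW h)) iterD halted_iter.
Qed.

Lemma run_fits y t : size y <= q -> fits N (run y t).
Proof.
move=> hy i; rewrite run_min //.
have := size_config (minn t T) (enc_pair x y) i; rewrite -/(run y _).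
by rewrite size_cat; have := geq_minr t T; lia.
Qed.

Lemma initial_column y k : size y <= q ->
  column N (run y 0) k = on_tape0 (nth None [seq Some (inl b) | b <- enc_pair x y] k).
Proof.
move=> hy; apply/ffunP => i; rewrite !ffunE /cell_at.
by case: (i == ord0) => /=; rewrite !nth_nil ?oorN.
Qed.

Lemma halted_output y t : size y <= q -> halting (run y t).1 ->
  exists2 b, read ((run y t).2 ord0) = Some (inl b) & outputs_within M T (enc_pair x y) [:: b].
Proof.
move=> hy ht; have [b [hb eb]] := decides hy; exists b; last by split.
have -> : run y t = run y T.
  case: (leqP t T) => h; last by rewrite run_min // (minn_idPr (ltnW h)).
  by rewrite /run -[in RHS](subnK h) iterD (@halted_iter M (T - t)).
move: eb; rewrite /output /read /run; case: (_.2) => [|[[b'|]|] r] //=.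
by case=> ->.
Qed.

(** The labels and guess colours of the bottom row yield a certificate, and matching colours force
    every further row to be the next configuration. Row [T + 1] holds a halted one, whose tile at
    column 0 demands the output [true]. *)
Lemma accepting_of_tiling f : machine_tiling f ->
  exists2 y, size y <= q & outputs_within M T (enc_pair x y) [:: true].
Proof.
case=> He Hn Hs.
have {}He t k : t < N -> k < N -> west (f t k) = east (f t (cprev N k)).
  move=> ht hk; apply: code_inj; rewrite He ?cprev_lt // cprevK //.
have {}Hn t k : t.+1 < N -> k < N -> south (f t.+1 k) = north (f t k).
  by move=> ht hk; apply: code_inj; rewrite Hn.
have {}Hs k : k < N -> south (f 0 k) = inl (nth blank_label ls k).
  by move=> hk; apply: code_inj; rewrite Hs.
have zp := z_pos; have sN := size_labels.
pose g k := if east (f 0 k) is inl true then true else false.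
have row0 k : k < N -> exists2 u, north (f 0 k) = inr (start M, u, k == 0) &
  if k < size z then g k /\ u = on_tape0 (Some (inl (nth false z k)))
  else if k < size z + q then
    (exists b, [/\ g k.-1, g k & u = on_tape0 (Some (inl b))]) \/
    (~~ g k /\ u = on_tape0 None)
  else u = on_tape0 None.
  move=> hk; have := Hs k hk; rewrite nth_labels => /bottom_tile.
  case=> [g0 [g1 [[[q' u] hd] [Ew Ee -> /= /andP[/eqP -> V]]]]].
  have Eg : g k = g1 by rewrite /g Ee; case: (g1).
  have Eg' : g (cprev N k) = g0.
    by rewrite /g -He ?Ew //; [case: (g0)|lia].
  move: V; rewrite -{}Eg -{}Eg'; case: ifP => h1.
    by case/and3P=> g1' /eqP -> /eqP ->; exists (on_tape0 (Some (inl (nth false z k)))).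
  have k0 : (k == 0) = false by lia.
  rewrite k0 /cprev k0; case: ifP => h2.
    case/andP=> /negbTE -> /orP H; exists u => //.
    case: H => [/and3P[hg hge /orP hu]|/andP[hge /eqP ->]]; last by right.
    by left; case: hu => /eqP ->; [exists true|exists false].
  by case/and3P=> _ /eqP -> /negbTE ->; exists (on_tape0 None).
(* Induction from the right end: [j] guess columns remain from column [k] on. If the guess has ended
   before column [k], only blanks follow. *)
have guess j k : size z <= k -> k + j = size z + q -> exists y,
   [/\ size y <= j, ~~ g k.-1 -> y = [::] & forall i, i < j ->
     north (f 0 (k + i)) = inr (start M, on_tape0 (nth None [seq Some (inl b) | b <- y] i), false)].
  elim: j k => [|j IH] k hk kj; first by exists [::].
  have [y [y1 y2 y3]] := IH k.+1 ltac:(lia) ltac:(lia).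
  have [u Eu] := row0 k ltac:(lia).
  have -> : k < size z = false by lia.
  have -> : k < size z + q by lia.
  have k0 : (k == 0) = false by lia.
  rewrite k0 in Eu; case=> [[b [g1 g2 E]]|[g1 E]].
    exists (b :: y); split=> //=; first by rewrite g1.
    case=> [|i] hi; first by rewrite addn0 Eu E.
    by rewrite addnS -addSn y3.
  exists [::]; split=> // -[|i] hi; first by rewrite addn0 Eu E.
  by rewrite addnS -addSn y3 // (y2 g1) !nth_nil.
have [y [y1 _ y3]] := guess q (size z) (leqnn _) erefl.
have base k : k < N -> south (f 1 k) = inr ((run y 0).1, column N (run y 0) k, k == 0).
  move=> hk; rewrite Hn //; last by lia.
  rewrite initial_column // /enc_pair map_cat nth_cat size_map.
  have [u Eu] := row0 k hk; case: (ltnP k (size z)) => h1.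
    by case=> _ E; rewrite Eu E (nth_map false).
  have k0 : (k == 0) = false by lia.
  case: (ltnP k (size z + q)) => h2.
    by move=> _; have := y3 (k - size z) ltac:(lia); rewrite subnKC // k0.
  by move=> E; rewrite Eu E nth_default // size_map; lia.
have rows t : t.+1 < N -> forall k, k < N ->
    south (f t.+1 k) = inr ((run y t).1, column N (run y t) k, k == 0).
  elim: t => [|t IH] ht; first exact: base.
  have {}IH := IH ltac:(lia).
  have shape k : k < N -> exists h a d, [/\
      west (f t.+1 k) = inr (h, a, (column N (run y t) k, k == 0)),
      east (f t.+1 k) = inr (h, (column N (run y t) k, k == 0), d),
      k = 0 -> h = column N (run y t) 0 &
      north (f t.+1 k) = inr (next_state (run y t).1 h,
        next_content (run y t).1 h a (column N (run y t) k, k == 0) d, k == 0)].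
    move=> hk; have [[[h a] b1] [[[h' b2] d] [[[q' u] hb']]]] := step_tile (IH k hk).
    case=> -> -> -> /= /and5P[/eqP <- /eqP -> /eqP -> H /and4P[/eqP -> /eqP -> /eqP -> _]].
    by exists h, a, d; split=> // k0; move: H; rewrite k0 /= => /eqP.
  (* Column 0 fixes the cells under the heads, and matching horizontal colours hand them on to the
     right. *)
  have same k : k < N -> exists a d, [/\
      west (f t.+1 k) = inr (column N (run y t) 0, a, (column N (run y t) k, k == 0)),
      east (f t.+1 k) = inr (column N (run y t) 0, (column N (run y t) k, k == 0), d) &
      north (f t.+1 k) = inr (next_state (run y t).1 (column N (run y t) 0),
        next_content (run y t).1 (column N (run y t) 0) a (column N (run y t) k, k == 0) d, k == 0)].
    elim: k => [|k IHk] hk.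
      by have [h [a [d [E1 E2 E3 E4]]]] := shape 0 hk; have Eh := E3 erefl; subst h; exists a, d.
    have [h [a [d [E1 E2 _ E4]]]] := shape k.+1 hk; have [a' [d' [_ E2' _]]] := IHk ltac:(lia).
    have := He t.+1 k.+1 ltac:(lia) hk; rewrite E1 /cprev /= E2' => -[Eh _ _].
    by subst h; exists a, d.
  move=> k hk; rewrite Hn //; have [a [d [E1 E2 ->]]] := same k hk.
  have [a' [d' [_ E2' _]]] := same (cprev N k) (cprev_lt hk).
  have kn := cnext_lt hk.
  have [a'' [d'' [E1'' _ _]]] := same (cnext N k) kn.
  have := He t.+1 k ltac:(lia) hk; rewrite E1 E2' => -[-> _].
  have := He t.+1 (cnext N k) ltac:(lia) kn; rewrite cnextK // E1'' E2 => -[_ <-].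
  have Hf := @run_fits y t y1.
  by rewrite next_stateE // -columnS.
exists y => //; have [b [hb eb]] := decides y1.
have [[[h a] b1] [[[h' b2] d] [[[q' u] hb'] [_ _ _ /=]]]] :=
  step_tile (rows T ltac:(lia) 0 ltac:(lia)).
case/and5P=> _ _ _ _ /and4P[_ _ _]; rewrite [halting _]hb /= => /eqP.
rewrite column0; last exact: run_fits.
rewrite ffunE; have [b' -> H] := halted_output y1 hb.
by case=> <-.
Qed.

Lemma tiling_of_accepting y : size y <= q ->
  outputs_within M T (enc_pair x y) [:: true] -> exists f, machine_tiling f.
Proof.
move=> hy [hT oT]; have zp := z_pos; have sN := size_labels.
pose V t k : vcol := if t is t'.+1 then inr ((run y t').1, column N (run y t') k, k == 0)
                     else inl (nth blank_label ls k).
pose Hh t k : hcol := if t is t'.+1 then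
    inr (column N (run y t') 0, (column N (run y t') k, k == 0),
         (column N (run y t') (cnext N k), cnext N k == 0))
  else inl (k < size (enc_pair x y)).
pose tl t k := (Hh t (cprev N k), Hh t k, V t k, V t.+1 k).
have ok t k : k < N -> valid_tile (tl t k).
  move=> hk; case: t => [|t]; rewrite /tl /=.
    have spair : size (enc_pair x y) = size z + size y by rewrite size_cat.
    rewrite nth_labels initial_column //; case: ifP => h1.
      rewrite /= eqxx (nth_map false) ?spair ?ltn_addr //=.
      by rewrite /enc_pair nth_cat h1 !eqxx.
    have -> : (k == 0) = false by lia.
    have -> : cprev N k = k.-1 by rewrite /cprev; have -> : (k == 0) = false by lia.
    case: ifP => h2 /=; rewrite eqxx /=; last first.
      by rewrite nth_default ?size_map ?eqxx ?andbT /= spair; lia.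
    case: (ltnP k (size (enc_pair x y))) => h3.
      rewrite (nth_map false) // (leq_ltn_trans (leq_pred k) h3) /=.
      by case: (nth _ _ _); rewrite eqxx ?orbT.
    by rewrite nth_default ?size_map // eqxx orbT.
  rewrite cprevK // !eqxx /=; apply/and3P; split.
  - by apply/implyP => /eqP ->.
  - by rewrite next_stateE //; exact: run_fits.
  - apply/andP; split; first by rewrite -columnS //; exact: run_fits.
    apply/implyP => /andP[/eqP -> hh].
    rewrite column0; last exact: run_fits.
    rewrite ffunE; have [b -> [_ ob]] := halted_output hy hh.
    by move: oT; rewrite ob => -[->].
have N0 : 0 < N by lia.
(* Validity of [tl t k] is known only for [k < N]; where it fails, the tile of the origin is the
   default. *)
pose f t k : tile := insubd (Sub (tl 0 0) (ok 0 0 N0)) (tl t k).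
have fE t k : k < N -> val (f t k) = tl t k.
  by move=> hk; rewrite val_insubd ok.
exists f; split=> [t k ht hk|t k ht hk|k hk].
- have kn := cnext_lt hk.
  by congr (code _); rewrite /east /west !fE //= cnextK.
- by congr (code _); rewrite /north /south !fE.
- by congr (code _); rewrite /south fE.
Qed.

End Correctness.
End MachineTiles.

(** * Number streams *)

Definition bval (bs : seq bool) : nat := foldr (fun (b : bool) a => b + 2 * a) 0 bs.

Lemma bval_cat s1 s2 : bval (s1 ++ s2) = bval s1 + 2 ^ size s1 * bval s2.
Proof. by elim: s1 => [|b s1 IH] /=; rewrite ?mul1n // IH expnS; lia. Qed.

Lemma bval_nseq0 n : bval (nseq n false) = 0.
Proof. by elim: n => //= n ->. Qed.

(** By this, comparing a start time with a power of two is a matter of counting its digits. *)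
Lemma size_bits_le n r : (size (bits n) <= r) = (n < 2 ^ r).
Proof.
rewrite size_mkseq; apply/idP/idP => h.
  by apply: leq_trans (leq_pexp2l (isT : 0 < 2) h); apply: up_logP.
exact: up_log_min.
Qed.

Lemma bits_cons (b : bool) n : bits (b + 2 * n) = if 0 < b + 2 * n then b :: bits n else [::].
Proof.
case: ifP => h; last by have -> : b + 2 * n = 0 by lia.
have E : size (bits (b + 2 * n)) = (size (bits n)).+1.
  have h1 : n < 2 ^ size (bits n) by rewrite -size_bits_le.
  have h2 : b + 2 * n < 2 ^ size (bits (b + 2 * n)) by rewrite -size_bits_le.
  have h3 : size (bits (b + 2 * n)) <= (size (bits n)).+1.
    by rewrite size_bits_le expnS; case: (b); lia.
  suff h4 : (size (bits n)).+1 <= size (bits (b + 2 * n)) by lia.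
  case: (size (bits (b + 2 * n))) h2 => [|m] h2; first by rewrite expn0 in h2; lia.
  by rewrite ltnS size_bits_le; rewrite expnS in h2; lia.
rewrite /bits in E *; move: E; rewrite !size_mkseq => ->.
rewrite /mkseq /= expn0 divn1 -[1]/(1 + 0) iotaDl -map_comp; congr (_ :: _).
  by rewrite oddD mul2n odd_double addbF; case: b {h}.
apply: eq_map => i /=; rewrite expnS divnMA; congr (odd (_ %/ _)).
by rewrite addnC mulnC divnMDl // divn_small ?addn0 //; case: b {h}.
Qed.

Definition digit_bits (m d : nat) : seq bool := [seq odd (d %/ 2 ^ i) | i <- iota 0 m].

Lemma bval_digit_bits m d : d < 2 ^ m -> bval (digit_bits m d) = d.
Proof.
elim: m d => [|m IH] d; first by rewrite expn0; case: d.
rewrite /digit_bits /= expn0 divn1 expnS => h.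
have -> : [seq odd (d %/ 2 ^ i) | i <- iota 1 m] = digit_bits m (d./2).
  rewrite -[1]/(1 + 0) iotaDl -map_comp; apply: eq_map => i /=.
  by rewrite expnS divnMA divn2.
rewrite IH; last by rewrite ltn_half_double -mul2n.
by rewrite mul2n odd_double_half.
Qed.

Section NumberStream.
Variable S : finType.
Notation cel := (option (bool + S)).
Variable hash : cel.
Hypothesis hashP : forall b, hash <> Some (inl b).

Definition bit_cells (s : seq bool) : seq cel := [seq Some (inl b) | b <- s].

Definition number_cells (s : seq bool) : seq cel := bit_cells s ++ [:: hash].

(* Numbers are scanned from the most significant bit; the flag records whether a
   nonzero bit was met, so that leading zeros are dropped. *)
Definition post_step (c : cel) (st : seq bool * bool) : seq bool * bool :=
  match c with
  | Some (inl b) => if b || st.2 then ([:: true, b & st.1], true) else st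
  | _ => (false :: st.1, false)
  end.

Definition post (s : seq cel) : seq bool * bool := foldr post_step ([::], false) s.

(** The scan meets the end mark [hash] of a number first; it emits the closing [false] of [enc_bits]
    and clears the flag, so consecutive numbers do not interact. *)
Lemma post_number s st :
  (foldr post_step st (number_cells s)).1 = enc_bits (bits (bval s)) ++ st.1.
Proof.
rewrite foldr_cat /=; have -> : post_step hash st = (false :: st.1, false).
  by rewrite /post_step; move: hashP; case: (hash) => [[b|]|] // /(_ b).
suff -> : forall acc, foldr post_step (acc, false) (bit_cells s) =
    (flatten [seq [:: true; b] | b <- bits (bval s)] ++ acc, 0 < bval s).
  by rewrite /enc_bits cat_rcons.
move=> acc; elim: s => //= b s ->; rewrite bits_cons /=.
case: b; rewrite ?add1n //= add0n muln_gt0 /=; case: ifP => //= h.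
have -> : bval s = 0 by lia.
by rewrite (_ : bits 0 = [::]) //; exact: (bits_cons false 0).
Qed.

Lemma post_numbers ns :
  (post (flatten [seq number_cells s | s <- ns])).1 = enc_nats [seq bval s | s <- ns].
Proof.
rewrite /post /enc_nats -map_comp; elim: ns => //= s ns IH.
by rewrite foldr_cat post_number IH.
Qed.

End NumberStream.

(** * The reduction as a loop program *)

Lemma flatten_allpairs (A B C : Type) (f : A -> B -> seq C) s t :
  flatten [seq f x y | x <- s, y <- t] =
  flatten [seq flatten [seq f x y | y <- t] | x <- s].
Proof. by elim: s => //= x s IH; rewrite flatten_cat IH. Qed.

Lemma flatten_flatten (A : Type) (ss : seq (seq (seq A))) :
  flatten (flatten ss) = flatten [seq flatten s | s <- ss].
Proof. by elim: ss => //= s ss IH; rewrite flatten_cat IH. Qed.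

Section InstanceGen.
Variables (TT : finType) (ec wc nc sc : TT -> nat) (K g : nat).
Variables (lab : label -> nat) (ls : seq label) (c : nat).
Notation N := (size ls).
Notation b := (2 ^ g).
Hypotheses (ecK : forall x, ec x <= K) (ncK : forall x, nc x <= K).
Hypotheses (wcK : forall x, 2 * wc x <= K) (scK : forall x, 2 * sc x <= K).
Hypotheses (labK : forall l, lab l <= K) (N1 : 1 < N) (T1 : 1 < #|TT|).
Hypothesis b_big : 2 * (#|TT| * K) + #|TT| + K + 1 < b.
Hypothesis head_label : forall k hd d, k < N -> nth blank_label ls k = inl (hd, d) -> hd = (k == 0).
Hypothesis head_label0 : exists d, nth blank_label ls 0 = inl (true, d).

Notation labk := (fun k => lab (nth blank_label ls k)).
Notation digit := (digit ec wc nc sc K N g).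
Notation target_digit := (target_digit K g labk).
Notation total_digit := (total_digit ec wc nc sc K g).
Notation grid := (grid N).
Notation items := (items TT N).
Notation beta := (3 * g).
Notation value f := (dval (2 ^ beta) f grid).
Notation weight := (weight ec wc nc sc K N g).

Definition rest_digit (p : nat * nat) : nat := total_digit p - target_digit p.

(** As a power of two just above the range of the grid numbers, it lets multiples of H and R be
    added to such a number by appending binary digits. *)
Definition unit_H : nat := (2 ^ beta) ^ size grid.
Definition unit_R : nat := 2 ^ c * unit_H.
Definition weights : seq nat := [seq weight it | it <- items].
Definition capA : nat := value target_digit.
Definition capB : nat := value rest_digit.
Definition instance_L : nat := 3 * unit_R + (capA + capB).
Definition the_gadget : instance := gadget weights capA capB unit_H unit_R.

Lemma target_lt p : target_digit p < 2 ^ beta.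
Proof. exact: (target_small (N := N) labk (ltnW N1) b_big). Qed.

Lemma total_lt p : p \in grid -> total_digit p < 2 ^ beta.
Proof.
move=> hp; rewrite -(total_digitE _ _ _ _ _ _ hp).
by have [] := column_small wc sc ecK ncK (ltnW N1) b_big xpredT hp.
Qed.

Lemma rest_lt p : p \in grid -> rest_digit p < 2 ^ beta.
Proof. by move=> /total_lt; apply: leq_ltn_trans; apply: leq_subr. Qed.

Lemma caps_sum : capA + capB = \sum_(it <- items) weight it.
Proof.
rewrite total_weight; have := @dval_sum _ (2 ^ beta) _ [:: target_digit; rest_digit] xpredT id grid.
rewrite !big_cons big_nil addn0 => ->; apply: eq_dval => p hp.
rewrite !big_cons big_nil addn0 /rest_digit subnKC //.
exact: (target_le_total ec nc labk (ltnW N1) b_big).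
Qed.

Lemma caps_small : capA + capB < unit_H.
Proof. by rewrite caps_sum total_weight; apply: total_small b_big => //; exact: ltnW. Qed.

Lemma weights_pos : all (leq 1) weights.
Proof.
apply/allP => w /mapP[[p x] /allpairsP[[p' x'] /= [hp _ [-> ->]]] ->].
exact: weight_pos.
Qed.

Lemma weights_sum : \sum_(0 <= i < size weights) nth 0 weights i = capA + capB.
Proof. by rewrite -(big_nth 0 xpredT id) caps_sum big_map. Qed.

Lemma unit_R_pos : 0 < unit_R.
Proof. by rewrite muln_gt0 !expn_gt0. Qed.

Definition number_bits (f : nat * nat -> nat) : seq bool :=
  flatten [seq digit_bits beta (f p) | p <- grid].

Lemma size_number_bits f : 2 ^ size (number_bits f) = unit_H.
Proof.
rewrite /unit_H /number_bits; elim: grid => //= p ps IH.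
by rewrite size_cat size_map size_iota expnD IH expnS.
Qed.

Lemma bval_number f tail : (forall p, p \in grid -> f p < 2 ^ beta) ->
  bval (number_bits f ++ tail) = value f + unit_H * bval tail.
Proof.
move=> H; rewrite bval_cat size_number_bits; congr (_ + _).
rewrite /number_bits; elim: grid H => //= p ps IH H.
rewrite bval_cat bval_digit_bits ?H ?mem_head // size_map size_iota IH // => q hq.
by rewrite H // inE hq orbT.
Qed.

Definition zero_digit : nat * nat -> nat := fun=> 0.

Lemma value_zero : value zero_digit = 0.
Proof. by elim: grid => //= p ps ->; rewrite muln0. Qed.

Definition zc : seq bool := nseq c false.

(** [capA + capB] is the total weight, which gives the lower digits; the two ones after [c] zeros
    are the 3 of 3R. *)
Definition bits_L := number_bits total_digit ++ zc ++ [:: true; true].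
Definition bits_R := number_bits zero_digit ++ zc ++ [:: true].
Definition bits_2R := number_bits zero_digit ++ zc ++ [:: false; true].
Definition bits_2RB := number_bits rest_digit ++ zc ++ [:: false; true].
Definition bits_RA := number_bits target_digit ++ zc ++ [:: true].
Definition bits_H := number_bits zero_digit ++ [:: true].

Definition head_numbers : seq (seq bool) :=
  [:: bits_L; bits_R; [::]; bits_2RB; bits_2R; [::]; bits_RA;
      bits_H; bits_L; [:: true]; bits_H; bits_L; [:: true]].

Definition instance_numbers : seq (seq bool) :=
  head_numbers ++ flatten [seq [:: number_bits (digit it); bits_L; [:: true]] | it <- items].

Lemma bval_zc s : bval (zc ++ s) = 2 ^ c * bval s.
Proof. by rewrite bval_cat bval_nseq0 size_nseq. Qed.

Lemma bval_L : bval bits_L = instance_L.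
Proof.
rewrite bval_number ?bval_zc; last exact: total_lt.
by rewrite -total_weight -caps_sum /instance_L /unit_R /=; lia.
Qed.

Lemma zero_lt p : p \in grid -> zero_digit p < 2 ^ beta.
Proof. by rewrite expn_gt0. Qed.

Lemma instance_numbersE : enc_instance instance_L the_gadget =
  enc_nats [seq bval s | s <- instance_numbers].
Proof.
have E1 : bval bits_R = unit_R.
  by rewrite bval_number ?bval_zc ?value_zero //=; [rewrite /unit_R; move: unit_H (2 ^ c) => h k; lia|exact: zero_lt].
have E2 : bval bits_2R = 2 * unit_R.
  by rewrite bval_number ?bval_zc ?value_zero //=; [rewrite /unit_R; move: unit_H (2 ^ c) => h k; lia|exact: zero_lt].
have E3 : bval bits_2RB = 2 * unit_R + capB.
  rewrite bval_number ?bval_zc -/capB /=; last exact: rest_lt.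
  by rewrite /unit_R; move: unit_H (2 ^ c) capB => h k v; lia.
have E4 : bval bits_RA = unit_R + capA.
  rewrite bval_number ?bval_zc -/capA /=; last by move=> p _; exact: target_lt.
  by rewrite /unit_R; move: unit_H (2 ^ c) capA => h k v; lia.
have E5 : bval bits_H = unit_H.
  by rewrite bval_number ?value_zero /= ?muln1 //; exact: zero_lt.
have E6 it : it \in items -> bval (number_bits (digit it)) = weight it.
  move=> hit; rewrite -[number_bits _]cats0 bval_number ?muln0 ?addn0 // => p hp.
  apply: leq_ltn_trans (total_lt hp); rewrite -(total_digitE _ _ _ _ _ _ hp).
  by rewrite (big_rem it) //= leq_addr.
rewrite /enc_instance /instance_numbers /= !bval_L E1 E2 E3 E4 E5; congr enc_nats.
rewrite -[LHS]cat1s -[RHS]cat1s; congr (_ ++ _).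
rewrite (eq_map (g := (fun j => [:: job1 weights unit_H unit_R j; jobd capA capB unit_R j; job2 capA capB unit_R j]) \o val)) //.
rewrite map_comp val_enum_ord /=; do 12! congr (_ :: _).
rewrite -[4]/(4 + 0) iotaDl -map_comp map_flatten -map_comp.
transitivity (flatten [seq [:: weight it; instance_L; 1] | it <- items]).
  rewrite [in RHS](map_comp (fun w => [:: w; instance_L; 1]) weight) -/weights.
  by rewrite -[in RHS](mkseq_nth 0 weights) /mkseq -map_comp.
by congr flatten; apply/eq_in_map => it hit /=; rewrite E6 // bval_L.
Qed.

Section Program.
Variables (I S : finType) (lc : label -> S).
Notation cel := (option (bool + S)).
Hypothesis lc_inj : injective lc.
Variables (hash : cel) (vt vk ut uk : I).
Hypothesis vars_uniq : uniq [:: vt; vk; ut; uk].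

Definition label_cell (l : label) : cel := Some (inr (lc l)).
Definition is_head_cell (x : cel) : bool :=
  (x == label_cell (inl (true, true))) || (x == label_cell (inl (true, false))).

Notation Lam := [seq label_cell l | l <- ls].
Notation gen := (gen I S).
Notation out r G := (gout Lam r G).

Lemma label_cell_inj : injective label_cell.
Proof. by move=> l1 l2 [] /lc_inj. Qed.

Lemma is_head_cellP k : k < size Lam -> is_head_cell (nth None Lam k) = (k == 0).
Proof.
rewrite size_map => hk; rewrite (nth_map blank_label) // /is_head_cell !(inj_eq label_cell_inj).
case: k hk => [|k] hk; first by have [[] ->] := head_label0.
case E: (nth _ _ _) => [[hd d]|] //=; have -> := head_label hk E.
by rewrite /eq_op /= /eq_op /=.
Qed.

Definition gcells (s : seq cel) : gen := foldr (fun x G => GSeq (GEmit I x) G) (GNil I S) s.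

Lemma out_gcells r s : out r (gcells s) = s.
Proof. by elim: s => //= x s ->. Qed.

Definition gdigit (d : nat) : gen := gcells (bit_cells S (digit_bits beta d)).

Definition gnumber (F : gen) (tail : seq bool) : gen :=
  GSeq (GFor ut (GFor uk F)) (gcells (bit_cells S tail ++ [:: hash])).

Definition at_pos (r : I -> nat) (p : nat * nat) := upd (upd r ut p.1) uk p.2.

Lemma out_gnumber r F f tail : (forall p, p \in grid ->
    out (at_pos r p) F = bit_cells S (digit_bits beta (f p))) ->
  out r (gnumber F tail) = number_cells hash (number_bits f ++ tail).
Proof.
move=> H; rewrite /= out_gcells /number_cells /number_bits /bit_cells map_cat -catA; congr (_ ++ _).
rewrite map_flatten -map_comp /grid map_allpairs /= flatten_allpairs size_map.
congr flatten; apply/eq_in_map => t ht; congr flatten; apply/eq_in_map => k hk.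
apply: (H (t, k)); rewrite mem_grid.
by move: ht hk; rewrite !mem_iota !add0n /= => -> ->.
Qed.

Definition glabel (f : label -> nat) : gen :=
  foldr (fun l G => GIf (TLab uk (fun x => x == label_cell l)) (gdigit (f l)) G)
    (GNil I S) (enum label).

Lemma out_glabel r p f : p \in grid -> out (at_pos r p) (glabel f) =
  bit_cells S (digit_bits beta (f (nth blank_label ls p.2))).
Proof.
case: p => t k; rewrite mem_grid => /andP[ht hk] /=.
have : nth blank_label ls k \in enum label by rewrite mem_enum.
rewrite /glabel; elim: (enum label) => //= l e IH.
rewrite {1}/at_pos {1}/upd eqxx (nth_map blank_label) // (inj_eq label_cell_inj) inE.
by case: eqP => [->|_] //=; rewrite out_gcells.
Qed.

(* Digits that depend on the row only through its being the bottom row, where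
   they depend on the label of the column. *)
Definition grow (f0 : label -> nat) (f1 : nat) : gen :=
  GIf (TLab ut is_head_cell) (glabel f0) (gdigit f1).

Lemma out_grow r p f0 f1 : p \in grid -> out (at_pos r p) (grow f0 f1) =
  bit_cells S (digit_bits beta (if p.1 == 0 then f0 (nth blank_label ls p.2) else f1)).
Proof.
move=> hp; have utuk : (ut == uk) = false.
  by move: vars_uniq; rewrite /= !inE; case: (ut == uk); rewrite ?andbF.
rewrite /= {1}/at_pos {1}/upd utuk {1}/upd eqxx is_head_cellP.
  by case: eqP => _; [rewrite out_glabel|rewrite out_gcells].
by case: p hp => t k; rewrite mem_grid size_map => /andP[].
Qed.

Definition total0 : nat := \sum_(x : TT) (dig0 ec sc K g x + dig1 wc K g x).
Definition total1 : nat := total0 + \sum_(x : TT) dig2 nc g x.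
Definition target0 (l : label) : nat := 1 + b * (K + b * (K - lab l)).
Definition target1 : nat := 1 + b * (K + b * K).

Definition gtotal := grow (fun=> total0) total1.
Definition gtarget := grow target0 target1.
Definition grest := grow (fun l => total0 - target0 l) (total1 - target1).
Definition gzero := gdigit 0.

Lemma out_gtotal r p : p \in grid ->
  out (at_pos r p) gtotal = bit_cells S (digit_bits beta (total_digit p)).
Proof.
move=> hp; rewrite out_grow //; congr (bit_cells S (digit_bits _ _)).
by rewrite /total_digit /total1 /total0; case: (p.1) => [|t] /=; rewrite ?mul1n ?mul0n ?addn0.
Qed.

Lemma out_gtarget r p : p \in grid ->
  out (at_pos r p) gtarget = bit_cells S (digit_bits beta (target_digit p)).
Proof.
move=> hp; rewrite out_grow //; congr (bit_cells S (digit_bits _ _)).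
by rewrite /target_digit /target0 /target1; case: (p.1).
Qed.

Lemma out_grest r p : p \in grid ->
  out (at_pos r p) grest = bit_cells S (digit_bits beta (rest_digit p)).
Proof.
move=> hp; rewrite out_grow //; congr (bit_cells S (digit_bits _ _)).
rewrite /rest_digit /total_digit /target_digit /target0 /target1 /total1 /total0.
by case: (p.1) => [|t] /=; rewrite ?mul1n ?mul0n ?addn0.
Qed.

(** The three contributions to a position exclude each other, because [1 < N] makes the east
    neighbour a different cell. Hence each digit is a constant selected by tests. *)
Definition gitem (x : TT) : gen :=
  GIf (TEq S vt ut)
    (GIf (TEq S vk uk) (gdigit (dig0 ec sc K g x))
       (GIf (TCyc S vk uk) (gdigit (dig1 wc K g x)) gzero))
    (GIf (TSucc S ut vt)
       (GIf (TEq S vk uk) (gdigit (dig2 nc g x)) gzero) gzero).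

Lemma out_gitem r t k x p : t < N -> k < N -> r vt = t -> r vk = k -> p \in grid ->
  out (at_pos r p) (gitem x) = bit_cells S (digit_bits beta (digit ((t, k), x) p)).
Proof.
case: p => t' k'; rewrite mem_grid => ht hk Et Ek /andP[ht' hk'].
move: vars_uniq; rewrite /= !inE !negb_or -!andbA.
case/and5P=> /negbTE n1 /negbTE n2 /negbTE n3 /negbTE n4 /and3P[/negbTE n5 /negbTE n6 _].
have Evt : at_pos r (t', k') vt = t by rewrite /at_pos /upd n2 n3.
have Evk : at_pos r (t', k') vk = k by rewrite /at_pos /upd n4 n5.
have Eut : at_pos r (t', k') ut = t' by rewrite /at_pos /upd n6 eqxx.
have Euk : at_pos r (t', k') uk = k' by rewrite /at_pos /upd eqxx.
have cyc : (if k'.+1 == size Lam then 0 else k'.+1) = cnext N k' by rewrite size_map.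
rewrite /= Evt Evk Eut Euk cyc /digit /= !xpair_eqE.
have ck : (cnext N k' == k') = false.
  by have := N1; rewrite /cnext; case: (eqVneq k'.+1 N) => [<- ?|_ _]; apply/negbTE/eqP; lia.
have -> : ((0 < t') && ((t == t'.-1) && (k == k'))) = (t' == t.+1) && (k == k').
  by case: (t') => [|u] //=; rewrite eqSS [u == t]eq_sym.
case: (eqVneq t t') => [<-|nt] /=.
  have -> : (t == t.+1) = false by lia.
  case: (eqVneq k k') => [->|nk] /=.
    by rewrite eq_sym ck out_gcells !mul0n !addn0 mul1n.
  by case: (k == cnext N k'); rewrite out_gcells !mul0n ?mul1n ?addn0.
by case: (t' == t.+1); case: (k == k'); rewrite /= out_gcells !mul0n ?mul1n ?addn0.
Qed.

Definition gL := gnumber gtotal (zc ++ [:: true; true]).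

Fixpoint gseqs (Gs : seq gen) : gen := if Gs is G :: Gs' then GSeq G (gseqs Gs') else GNil I S.

Lemma out_gseqs r Gs : out r (gseqs Gs) = flatten [seq out r G | G <- Gs].
Proof. by elim: Gs => //= G Gs ->. Qed.

Definition gconst s := gcells (number_cells hash s).

Definition ginstance : gen :=
  GSeq (gseqs [:: gL; gnumber gzero (zc ++ [:: true]); gconst [::];
      gnumber grest (zc ++ [:: false; true]); gnumber gzero (zc ++ [:: false; true]);
      gconst [::]; gnumber gtarget (zc ++ [:: true]);
      gnumber gzero [:: true]; gL; gconst [:: true];
      gnumber gzero [:: true]; gL; gconst [:: true]])
  (GFor vt (GFor vk (gseqs [seq gseqs [:: gnumber (gitem x) [::]; gL; gconst [:: true]]
     | x <- enum TT]))).

Lemma out_ginstance r :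
  out r ginstance = flatten [seq number_cells hash s | s <- instance_numbers].
Proof.
have EL r' : out r' gL = number_cells hash bits_L by apply: out_gnumber => p; exact: out_gtotal.
have Ezero r' s : out r' (gnumber gzero s) = number_cells hash (number_bits zero_digit ++ s).
  by apply: out_gnumber => p _; rewrite out_gcells.
have Erest r' s : out r' (gnumber grest s) = number_cells hash (number_bits rest_digit ++ s).
  by apply: out_gnumber => p; exact: out_grest.
have Etarget r' s : out r' (gnumber gtarget s) = number_cells hash (number_bits target_digit ++ s).
  by apply: out_gnumber => p; exact: out_gtarget.
have Eitem t k x r' : t < N -> k < N -> r' vt = t -> r' vk = k ->
    out r' (gseqs [:: gnumber (gitem x) [::]; gL; gconst [:: true]]) =
    flatten [seq number_cells hash s
      | s <- [:: number_bits (digit ((t, k), x)); bits_L; [:: true]]].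
  move=> ht hk Et Ek; rewrite out_gseqs !map_cons EL out_gcells; congr (flatten (_ :: _)).
  rewrite -[number_bits _]cats0; apply: out_gnumber => p; exact: out_gitem.
have Efor r' v G : out r' (GFor v G) = flatten [seq out (upd r' v j) G | j <- iota 0 N].
  by rewrite /= size_map.
have vtvk : (vt == vk) = false.
  by move: vars_uniq; rewrite /= !inE; case: (vt == vk).
rewrite /instance_numbers map_cat flatten_cat.
have -> : out r ginstance = out r (gseqs [:: gL; gnumber gzero (zc ++ [:: true]); gconst [::];
      gnumber grest (zc ++ [:: false; true]); gnumber gzero (zc ++ [:: false; true]);
      gconst [::]; gnumber gtarget (zc ++ [:: true]);
      gnumber gzero [:: true]; gL; gconst [:: true];
      gnumber gzero [:: true]; gL; gconst [:: true]]) ++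
   out r (GFor vt (GFor vk (gseqs [seq gseqs [:: gnumber (gitem x) [::]; gL; gconst [:: true]]
     | x <- enum TT]))) by [].
congr (_ ++ _).
  by rewrite out_gseqs /head_numbers !map_cons EL !Ezero Erest Etarget !out_gcells.
rewrite map_flatten -map_comp flatten_flatten -map_comp Efor.
rewrite /items map_allpairs flatten_allpairs /grid map_allpairs flatten_allpairs.
congr flatten; apply/eq_in_map => t ht; rewrite Efor.
congr flatten; apply/eq_in_map => k hk; rewrite out_gseqs -map_comp.
congr flatten; apply/eq_in_map => x _; move: ht hk; rewrite !mem_iota !add0n /= => ht hk.
by apply: Eitem => //; rewrite /upd ?vtvk eqxx.
Qed.

End Program.

End InstanceGen.

(** * Polynomial bounds *)

Section PolyBound.
Import GRing.Theory.
Local Open Scope ring_scope.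

Definition poly_bounded (f : nat -> nat) : Prop :=
  exists p : {poly nat}, forall n, (f n <= p.[n])%N.

Lemma horner_mono (p : {poly nat}) m n : (m <= n)%N -> (p.[m] <= p.[n])%N.
Proof.
move=> h; rewrite /horner; elim: (p : seq nat) => //= a s IH.
by apply: leq_add => //; apply: leq_mul.
Qed.

Lemma poly_bounded_poly (p : {poly nat}) : poly_bounded (fun n => p.[n]).
Proof. by exists p. Qed.

Lemma poly_bounded_const a : poly_bounded (fun=> a).
Proof. by exists a%:P => n; rewrite hornerC. Qed.

Lemma poly_bounded_id : poly_bounded id.
Proof. by exists 'X => n; rewrite hornerX. Qed.

Lemma poly_bounded_add f h : poly_bounded f -> poly_bounded h ->
  poly_bounded (fun n => f n + h n)%N.
Proof. by case=> p Hp [q Hq]; exists (p + q) => n; rewrite hornerD leq_add. Qed.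

Lemma poly_bounded_mul f h : poly_bounded f -> poly_bounded h ->
  poly_bounded (fun n => f n * h n)%N.
Proof. by case=> p Hp [q Hq]; exists (p * q) => n; rewrite hornerM leq_mul. Qed.

Lemma poly_bounded_le f h : (forall n, (f n <= h n)%N) -> poly_bounded h -> poly_bounded f.
Proof. by move=> H [p Hp]; exists p => n; apply: leq_trans (H n) (Hp n). Qed.

Lemma poly_bounded_comp f h : poly_bounded f -> poly_bounded h ->
  poly_bounded (f \o h).
Proof.
case=> p Hp [q Hq]; exists (p \Po q) => n; rewrite horner_comp.
by apply: leq_trans (Hp _) _; apply: horner_mono.
Qed.

End PolyBound.

Ltac poly_bounded_tac :=
  repeat first [ assumption | exact: poly_bounded_id | exact: poly_bounded_const
    | exact: poly_bounded_poly | apply: poly_bounded_add | apply: poly_bounded_mul ].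

(** * Counters and polynomials *)

Section GenTime.
Variables (I S : finType) (Lam : seq (option (bool + S))).

Lemma gtime_poly (G : gen I S) : poly_bounded (gtime G).
Proof.
elim: G => [|g1 H1 g2 H2|c|v g H|t g1 H1 g2 H2] /=.
- exact: poly_bounded_const.
- apply: (@poly_bounded_le _ (fun n => gtime g1 n + gtime g2 n + 1)) => [n|]; first by rewrite addn1.
  by poly_bounded_tac.
- exact: poly_bounded_const.
- by poly_bounded_tac.
- by poly_bounded_tac.
Qed.

(** Every emitted cell costs time, so the time bound also limits the length of the instance. *)
Lemma size_gout r (G : gen I S) : size (gout Lam r G) <= gtime G (size Lam).
Proof.
elim: G r => [|g1 H1 g2 H2|c|v g H|t g1 H1 g2 H2] r //=.
- by rewrite size_cat; have := H1 r; have := H2 r; lia.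
- rewrite size_flatten /shape -map_comp sumnE big_map.
  apply: (@leq_trans (\sum_(k <- iota 0 (size Lam)) gtime g (size Lam))).
    by apply: leq_sum => k _; apply: H.
  by rewrite big_const_seq iter_addn_0 count_predT size_iota; lia.
- by case: ifP => _; [have := H1 r|have := H2 r]; lia.
Qed.

End GenTime.

Section StackPrograms.
Variables (I S : finType) (b : bool).
Notation cel := (option (bool + S)).
Notation store := (I -> seq cel).
Notation srun := (@srun I S b).
Notation mark := (mark S).

(** The invariant is indexed by what is left on the stack; the suffix condition tells the body how
    much has been consumed. *)
Lemma srun_drain (i : I) (B : prog I S) (Inv : seq cel -> store) t u :
  (forall v, Inv v i = v) -> all isSome u ->
  (forall x v, isSome x -> suffix (x :: v) u -> srun B (Inv (x :: v)) (Inv v) t) ->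
  srun (While (@ne I S i) B) (Inv u) (Inv [::]) (size u * t.+2).+1.
Proof.
move=> Hi; elim: u => [|x u IH] /=.
  by move=> _ _; apply: srun_while0; rewrite /ne /tops Hi.
case/andP=> hx hu HB; apply: srun_le.
  apply: srun_whileS; first by rewrite /ne /tops Hi.
    by apply: HB => //; exact: suffix_refl.
  apply: IH => // y v hy hv; apply: HB => //.
  by apply: suffix_trans hv _; exact: (suffix_suffix [:: x]).
by rewrite mulSn; move: (size u * _) => m; lia.
Qed.

Fixpoint push_ones (i : I) (a : nat) : prog I S :=
  if a is a'.+1 then Seq (Push i (fun=> mark)) (push_ones i a') else Skip.

Lemma run_push_ones i a s : srun (push_ones i a) s (upd s i (nseq a mark ++ s i)) (4 * a + 1).
Proof.
elim: a s => [|a IH] s /=; first by apply: srun_eq; [exact: srun_skip|ext].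
apply: srun_le.
  apply: srun_seq; first exact: srun_push.
  apply: srun_eq; first exact: IH.
  by ext; elim: (a) => //= k ->.
by lia.
Qed.

Variables (tn tD tA tB : I).
Hypothesis tapes_uniq : uniq [:: tn; tD; tA; tB].

Definition eval_coefs (cs : seq nat) (n : nat) : nat := foldr (fun a v => v * n + a) 0 cs.

Lemma horner_eval_coefs (p : {poly nat}) n : (p.[n])%R = eval_coefs p n.
Proof. by rewrite /horner; elim: (p : seq nat) => //= a cs ->. Qed.

Definition mul_step : prog I S :=
  Seq (Pop S tA)
  (Seq (While (@ne I S tn) (Seq (Push tD (fun=> mark)) (Mv S tn tB)))
       (While (@ne I S tB) (Mv S tB tn))).

(** Horner's scheme in unary: the previous value moves to [tA], and each of its marks adds [n] to
    [tD]. *)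
Fixpoint eval_prog (cs : seq nat) : prog I S :=
  if cs is a :: cs' then
    Seq (eval_prog cs') (Seq (While (@ne I S tD) (Mv S tD tA))
      (Seq (While (@ne I S tA) mul_step) (push_ones tD a)))
  else Skip.

Fixpoint eval_time (cs : seq nat) (n : nat) : nat :=
  if cs is a :: cs' then
    eval_time cs' n + 7 * eval_coefs cs' n + eval_coefs cs' n * (18 * n + 10) + 4 * a + 10
  else 1.

Lemma all_nseq_one m : all isSome (nseq m mark).
Proof. by rewrite all_nseq orbT. Qed.

Lemma run_eval cs n s : s tn = nseq n mark -> s tD = [::] -> s tA = [::] -> s tB = [::] ->
  srun (eval_prog cs) s (upd s tD (nseq (eval_coefs cs n) mark)) (eval_time cs n).
Proof.
move: tapes_uniq; rewrite /= !inE !negb_or -!andbA.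
case/and5P=> /eqP nD /eqP nA /eqP nB /eqP DA /and3P[/eqP DB /eqP AB _] En ED EA EB.
elim: cs => [|a cs IH] /=; first by apply: srun_eq; [exact: srun_skip|ext].
set v := eval_coefs cs n in IH *.
have step s1 m k : s1 tn = nseq n mark -> s1 tB = [::] -> s1 tA = nseq m.+1 mark ->
    s1 tD = nseq k mark -> srun mul_step s1 (upd (upd s1 tA (nseq m mark)) tD (nseq (k + n) mark))
      (18 * n + 6).
  move=> E1 E2 E3 E4; apply: srun_le.
    apply: srun_seq; first exact: srun_pop.
    rewrite E3 /=; apply: srun_seq.
      pose Inv u := upd (upd (upd (upd s1 tA (nseq m mark)) tn u) tB (nseq (n - size u) mark)) tD (nseq (k + (n - size u)) mark).
      have -> : upd s1 tA (nseq m mark) = Inv (nseq n mark).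
        by rewrite /Inv size_nseq subnn addn0; ext.
      apply: (@srun_drain tn _ Inv 9); [by rewrite /Inv => u; ext|exact: all_nseq_one|].
      move=> x u hx /suffixP[w Ew]; have hs : n = size w + (size u).+1.
        by have := congr1 size Ew; rewrite size_nseq size_cat.
      have -> : x = mark.
        have : x \in nseq n mark by rewrite Ew mem_cat mem_head orbT.
        by rewrite mem_nseq => /andP[_ /eqP].
      apply: srun_le.
        apply: srun_seq; first exact: srun_push.
        apply: srun_eq.
          by apply: (@srun_mv _ _ _ tn tB mark u); [|rewrite /Inv; ext].
        have e : n - size u = (n - (size u).+1).+1 by lia.
        by rewrite /Inv e /= addnS; ext.
      by [].
    rewrite /= subn0.
    apply: srun_eq.
      apply: (@srun_moves _ _ _ tB tn (nseq n mark)); [congruence|by ext|exact: all_nseq_one].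
    by rewrite rev_nseq; ext; rewrite cats0 //; congruence.
  by rewrite !size_nseq; lia.
apply: srun_le.
  apply: srun_seq; first exact: IH.
  apply: srun_seq.
    apply: (@srun_moves _ _ _ tD tA (nseq v mark)) => //; [by ext|exact: all_nseq_one].
  apply: srun_seq.
    pose Inv u := upd (upd (upd s tn (nseq n mark)) tA u) tD (nseq ((v - size u) * n) mark).
    have -> : upd (upd (upd s tD (nseq v mark)) tA (rev (nseq v mark) ++ upd s tD (nseq v mark) tA)) tD [::]
       = Inv (nseq v mark).
      by rewrite /Inv size_nseq subnn mul0n rev_nseq; ext; rewrite EA cats0.
    apply: (@srun_drain tA _ Inv (18 * n + 6)); [by rewrite /Inv => u; ext|exact: all_nseq_one|].
    move=> x u hx /suffixP[w Ew]; have hs : v = size w + (size u).+1.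
      by have := congr1 size Ew; rewrite size_nseq size_cat.
    have Eu : x :: u = nseq (size u).+1 mark.
      apply/all_pred1P => /=; rewrite -/(all _ (x :: u)).
      have : all (pred1 mark) (w ++ x :: u) by rewrite -Ew all_pred1_nseq.
      by rewrite all_cat => /andP[].
    have Ex : x = mark /\ u = nseq (size u) mark by case: Eu.
    apply: srun_eq.
      apply: (step _ (size u) ((v - (size u).+1) * n)).
      - by rewrite /Inv; ext.
      - by rewrite /Inv; ext.
      - by rewrite -Eu /Inv; ext.
      - by rewrite /Inv; ext.
    rewrite -(proj2 Ex) /Inv /=.
    have -> : v - size u = (v - (size u).+1).+1 by lia.
    by rewrite mulSn addnC; ext.
  apply: srun_eq; first exact: run_push_ones.
  rewrite /upd eqxx subn0 -nseqD addnC.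
  by ext.
by rewrite !size_nseq; lia.
Qed.

Lemma eval_coefs_poly cs : poly_bounded (eval_coefs cs).
Proof. by elim: cs => [|a cs IH] /=; poly_bounded_tac. Qed.

Lemma eval_time_poly cs : poly_bounded (eval_time cs).
Proof.
elim: cs => [|a cs IH] /=; first exact: poly_bounded_const.
by have H := eval_coefs_poly cs; poly_bounded_tac.
Qed.

End StackPrograms.

(** * Input, output and the final test *)

Lemma size_enc_bits x : size (enc_bits x) = 2 * size x + 1.
Proof.
rewrite size_rcons size_flatten /shape -map_comp sumnE big_map /=.
by rewrite big_const_seq count_predT iter_addn_0; lia.
Qed.

Section Phases.
Variables (I S : finType) (b : bool).
Notation cel := (option (bool + S)).
Notation store := (I -> seq cel).
Notation srun := (@srun I S b).
Notation mark := (mark S).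

Definition is_bit (c : cel) : bool := if c is Some (inl _) then true else false.
Definition flag (g : bool) : seq cel := if g then [:: mark] else [::].

Lemma bit_cells_some s : all isSome (bit_cells S s).
Proof. by elim: s. Qed.

Definition read_prog (t0 tX tn : I) : prog I S :=
  While (@ne I S t0) (Seq (Push tn (fun=> mark)) (Mv S t0 tX)).

Lemma run_read t0 tX tn u s : t0 <> tX -> t0 <> tn -> tX <> tn -> all isSome u ->
  s t0 = u ->
  srun (read_prog t0 tX tn) s
    (upd (upd (upd s tn (nseq (size u) mark ++ s tn)) tX (rev u ++ s tX)) t0 [::])
    (size u * 11).+1.
Proof.
move=> n1 n2 n3; elim: u s => [|c u IH] s /=.
  by move=> _ E; apply: srun_eq; [apply: srun_while0; rewrite /ne /tops E|rewrite /rev /=; ext].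
case/andP=> hc hu E; apply: srun_le.
  apply: srun_whileS; first by rewrite /ne /tops E.
    apply: srun_seq; first exact: srun_push.
    by apply: (@srun_mv _ _ _ t0 tX c u) => //; ext.
  apply: srun_eq; first by apply: IH hu _; ext.
  rewrite rev_cons cat_rcons; ext.
  by elim: (size u) => //= k ->.
by move: (size u) => k; lia.
Qed.

Definition fill_prog (tD tL : I) (c : cel) : prog I S :=
  While (@ne I S tD) (Seq (Pop S tD) (Push tL (fun=> c))).

Lemma run_fill tD tL c k s : tD <> tL -> s tD = nseq k mark ->
  srun (fill_prog tD tL c) s (upd (upd s tL (nseq k c ++ s tL)) tD [::]) (k * 7).+1.
Proof.
move=> n1; elim: k s => [|k IH] s /= E.
  by apply: srun_eq; [apply: srun_while0; rewrite /ne /tops E|ext].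
apply: srun_le.
  apply: srun_whileS; first by rewrite /ne /tops E.
    by apply: srun_seq; [exact: srun_pop|exact: srun_push].
  apply: srun_eq; first by apply: IH; rewrite E; ext.
  by ext; elim: (k) => //= m ->.
by lia.
Qed.

Section Labels.
Variable lc : label -> S.
Notation lcell := (label_cell lc).
Hypothesis lc_inj : injective lc.
Variables (tX tL : I).
Hypothesis XL : tX <> tL.

Definition plain (d : bool) : cel := lcell (inl (false, d)).

Definition plain_of (c : cel) : cel := if c is Some (inl d) then plain d else None.

(** [tX] holds the input reversed, so the labels of [enc_bits] are pushed from its end: the closing
    [false], then each bit with its prefix [true] on top. The top label finally receives the head
    flag; it carries [false] exactly for the empty input. *)
Definition labels_prog : prog I S :=
  Seq (Push tL (fun=> plain false))
  (Seq (While (@ne I S tX)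
         (Seq (Push tL (fun r => plain_of (r tX)))
              (Seq (Push tL (fun=> plain true)) (Pop S tX))))
       (Put tL (fun r => lcell (inl (true, r tL == plain true))))).

Lemma run_labels x s : s tX = rev (bit_cells S x) ->
  srun labels_prog s
    (upd (upd s tX [::]) tL ([seq lcell l | l <- input_labels (enc_bits x)] ++ s tL))
    (size x * 11 + 7).
Proof.
move=> E.
have loop y s1 : s1 tX = bit_cells S y ->
   srun (While (@ne I S tX)
         (Seq (Push tL (fun r => plain_of (r tX)))
              (Seq (Push tL (fun=> plain true)) (Pop S tX)))) s1
   (upd (upd s1 tX [::]) tL ([seq plain d | d <- flatten [seq [:: true; d] | d <- rev y]] ++ s1 tL))
   (size y * 11).+1.
  elim: y s1 => [|d y IH] s1 /= E1.
    by apply: srun_eq; [apply: srun_while0; rewrite /ne /tops E1|rewrite /rev /=; ext].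
  apply: srun_le.
    apply: srun_whileS; first by rewrite /ne /tops E1.
      by apply: srun_seq; [exact: srun_push|apply: srun_seq; [exact: srun_push|exact: srun_pop]].
    apply: srun_eq; first by apply: IH; ext; rewrite E1.
    rewrite rev_cons -cats1 map_cat flatten_cat map_cat -catA /=.
    by rewrite {3}/upd /tops; ext; rewrite E1.
  by rewrite /=; lia.
apply: srun_le.
  apply: srun_seq; first exact: srun_push.
  apply: srun_seq.
    by apply: (loop (rev x)); rewrite /bit_cells map_rev -/(bit_cells S x) -E; ext.
  apply: srun_eq; first exact: srun_put.
  rewrite revK; set u := flatten _.
  have -> : enc_bits x = u ++ [:: false] by rewrite cats1.
  have map_plain z : [seq lcell l | l <- input_labels z] =
      if z is d :: z' then lcell (inl (true, d)) :: map plain z' else [::].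
    rewrite /input_labels; case: z => //= d z; congr (_ :: _).
    rewrite -[1]/(1 + 0) iotaDl -!map_comp -[in RHS](mkseq_nth false z) /mkseq -map_comp.
    exact: eq_map.
  have plain_eq d : (plain d == plain true) = d.
    by rewrite /plain (inj_eq (label_cell_inj lc_inj)); case: d; rewrite ?eqxx //=; apply/eqP.
  rewrite map_plain /tops; case: u => [|d u] /=; ext; rewrite /= ?plain_eq //.
  by rewrite map_cat -catA.
by rewrite size_rev; lia.
Qed.

End Labels.

(** A nonempty [tF] is the flag of [post_step]: [Put] raises it and [Pop] lowers it, whatever it
    was. *)
Definition post_prog (tO t0 tF : I) : prog I S :=
  While (@ne I S tO)
    (Seq (If (fun r => is_bit (r tO))
           (If (fun r => (r tO == mark) || isSome (r tF))
              (Seq (Push t0 (fun r => r tO))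
                   (Seq (Push t0 (fun=> mark)) (Put tF (fun=> mark))))
              Skip)
           (Seq (Push t0 (fun=> Some (inl false))) (Pop S tF)))
         (Pop S tO)).

Lemma run_post tO t0 tF u st s : tO <> t0 -> tO <> tF -> t0 <> tF ->
  all isSome u -> s tO = u -> s t0 = bit_cells S st.1 -> s tF = flag st.2 ->
  let st' := foldl (fun st c => post_step c st) st u in
  srun (post_prog tO t0 tF) s
    (upd (upd (upd s t0 (bit_cells S st'.1)) tF (flag st'.2)) tO [::]) (size u * 17).+1.
Proof.
move=> n1 n2 n3; elim: u st s => [|c u IH] [z g] s /=.
  by move=> _ E0 E1 E2; apply: srun_eq; [apply: srun_while0; rewrite /ne /tops E0|ext].
case/andP=> hc hu E0 E1 E2.
pose F st := upd (upd s t0 (bit_cells S st.1)) tF (flag st.2).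
apply: srun_le.
  apply: srun_whileS; first by rewrite /ne /tops E0.
    apply: (@srun_seq _ _ _ _ _ _ (F (post_step c (z, g))) _ 13); last exact: srun_pop.
    apply: srun_if; rewrite {1}/tops E0 /=; case: c hc E0 {IH} => [[d|h]|] //= _ E0.
      apply: (@srun_le _ _ _ _ _ _ (9.+2)); last by [].
      apply: srun_if; rewrite /tops E0 E2 /=.
      have -> : (Some (inl d) == mark :> cel) || isSome (head None (flag g)) = d || g.
        by case: d {E0}; case: g {E2}.
      case: ifP => _.
        apply: srun_eq.
          apply: (srun_seq (t1 := 3) (t2 := 5)); first exact: srun_push.
          apply: (srun_seq (t1 := 3) (t2 := 1)); [exact: srun_push|exact: srun_put].
        by rewrite /F /=; case: g E2 => /= E2; ext; rewrite /tops /= ?E0 ?E1 ?E2.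
      by apply: srun_le; [apply: srun_eq; [exact: srun_skip|rewrite /F; ext]|].
    apply: (@srun_le _ _ _ _ _ _ 5); last by [].
    apply: srun_eq.
      apply: (srun_seq (t1 := 3) (t2 := 1)); [exact: srun_push|exact: srun_pop].
    by rewrite /F /=; case: g E2 => /= E2; ext; rewrite /= ?E1 ?E2.
  apply: srun_eq.
    by apply: (IH (post_step c (z, g))) => //; rewrite /F ?E0; ext; rewrite /= E0.
  by rewrite /F; ext.
by move: (size u) => k; lia.
Qed.

Section Check.
Variables (t0 tR tD tG : I).
Hypotheses (n0R : t0 <> tR) (n0D : t0 <> tD) (n0G : t0 <> tG).
Hypotheses (nRD : tR <> tD) (nRG : tR <> tG) (nDG : tD <> tG).

(** [tR] holds the threshold in unary, and every digit takes one mark from it. A digit that finds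
    [tR] empty raises [tG], which stays raised for all later numbers. *)
Definition count_prog : prog I S :=
  Seq (While (fun r => r t0 == mark)
        (Seq (Pop S t0) (Seq (Pop S t0)
           (If (@ne I S tR) (Mv S tR tD) (Put tG (fun=> mark))))))
      (Seq (Pop S t0) (While (@ne I S tD) (Mv S tD tR))).

(** Start times on machine 2 alternate with those on machine 1 in the output and are passed over. *)
Definition skip_prog : prog I S :=
  Seq (While (fun r => r t0 == mark) (Seq (Pop S t0) (Pop S t0))) (Pop S t0).

Definition check_prog : prog I S :=
  While (fun r => is_bit (r t0)) (Seq count_prog skip_prog).

Notation pairs u := (bit_cells S (flatten [seq [:: true; d] | d <- u])).

Lemma pairs_cells u (rest : seq cel) :
  bit_cells S (enc_bits u) ++ rest = pairs u ++ Some (inl false) :: rest.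
Proof. by rewrite /enc_bits /bit_cells map_rcons cat_rcons. Qed.

Lemma run_skip u (rest : seq cel) s : s t0 = bit_cells S (enc_bits u) ++ rest ->
  srun skip_prog s (upd s t0 rest) (size u * 5 + 3).
Proof.
rewrite pairs_cells => E.
have loop v s1 : s1 t0 = pairs v ++ Some (inl false) :: rest ->
    srun (While (fun r => r t0 == mark) (Seq (Pop S t0) (Pop S t0))) s1
      (upd s1 t0 (Some (inl false) :: rest)) (size v * 5).+1.
  elim: v s1 => [|d v IH] s1 /= E1.
    by apply: srun_eq; [apply: srun_while0; rewrite /tops E1|ext].
  apply: srun_le.
    apply: srun_whileS; first by rewrite /tops E1.
      by apply: srun_seq; exact: srun_pop.
    by apply: srun_eq; [apply: IH; ext; rewrite E1|ext].
  by lia.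
apply: srun_le.
  apply: srun_seq; first exact: loop E.
  by apply: srun_eq; [exact: srun_pop|ext].
by lia.
Qed.

Lemma run_count u (rest : seq cel) m g s : s t0 = bit_cells S (enc_bits u) ++ rest ->
  s tR = nseq m mark -> s tD = [::] -> s tG = flag g ->
  srun count_prog s (upd (upd s t0 rest) tG (flag (g || (m < size u)))) (size u * 20 + 10).
Proof.
rewrite pairs_cells => E0 ER ED EG.
pose F j := upd (upd (upd (upd s t0 (pairs (drop j u) ++ Some (inl false) :: rest))
  tR (nseq (m - j) mark)) tD (nseq (minn j m) mark)) tG (flag (g || (m < j))).
have EF j : tops (F j) t0 = head None (pairs (drop j u) ++ Some (inl false) :: rest).
  by rewrite /F /tops; ext.
have loop : srun (While (fun r => r t0 == mark) (Seq (Pop S t0) (Seq (Pop S t0)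
           (If (@ne I S tR) (Mv S tR tD) (Put tG (fun=> mark)))))) (F 0) (F (size u))
   (size u * 13).+1.
  apply: srun_iter => [j hj|j hj|].
  - by rewrite EF (drop_nth false hj).
  - pose G := upd (F j) t0 (pairs (drop j.+1 u) ++ Some (inl false) :: rest).
    apply: (@srun_seq _ _ _ _ _ _ (upd (F j) t0 (behead (F j t0))) _ 1 9); first exact: srun_pop.
    apply: (@srun_seq _ _ _ _ _ _ G _ 1 7).
      apply: srun_eq; first exact: srun_pop.
      by rewrite /G /F (drop_nth false hj) /=; ext.
    apply: srun_if; rewrite /ne {1}/tops.
    have -> : G tR = nseq (m - j) mark by rewrite /G /F; ext.
    have [jm|mj] := ltnP j m.
      have e : m - j = (m - j.+1).+1 by lia.
      rewrite e /=; apply: srun_eq.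
        by apply: (@srun_mv _ _ _ tR tD mark (nseq (m - j.+1) mark)) => //; rewrite /G /F; ext; rewrite e.
      have e2 : minn j.+1 m = (minn j m).+1 by lia.
      have e3 : (m < j.+1) = (m < j) by lia.
      by rewrite /G /F e2 e3; ext.
    have e : m - j = 0 by lia.
    have e' : m - j.+1 = 0 by lia.
    have e2 : minn j.+1 m = minn j m by lia.
    have e3 : m < j.+1 by lia.
    rewrite e /=; apply: (@srun_le _ _ _ _ _ _ 1); last by [].
    apply: srun_eq; first exact: srun_put.
    rewrite /G /F e2 e' e e3 orbT /=; ext.
    by rewrite /= ; case: (g || _).
  - by rewrite EF drop_size.
apply: srun_le.
  apply: srun_seq.
    have -> : s = F 0 by rewrite /F drop0 subn0 min0n ltn0 orbF; ext.
    exact: loop.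
  apply: srun_seq; first exact: srun_pop.
  apply: srun_eq.
    by apply: (@srun_moves _ _ _ tD tR (nseq (minn (size u) m) mark));
      [congruence|rewrite /F; ext|exact: all_nseq_one].
  rewrite rev_nseq /F drop_size /=; ext.
    rewrite -nseqD (_ : minn (size u) m + (m - size u) = m); last by lia.
    congruence.
  by [].
by rewrite size_nseq; have := geq_minl (size u) m; lia.
Qed.

Lemma run_check (us : seq (seq bool * seq bool)) (rest : seq cel) m g s :
  s t0 = bit_cells S (flatten [seq enc_bits p.1 ++ enc_bits p.2 | p <- us]) ++ rest ->
  is_bit (head None rest) = false ->
  s tR = nseq m mark -> s tD = [::] -> s tG = flag g ->
  srun check_prog s
    (upd (upd s t0 rest) tG (flag (g || has (fun p => m < size p.1) us)))
    (size (flatten [seq enc_bits p.1 ++ enc_bits p.2 | p <- us]) * 40 + 1).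
Proof.
elim: us g s => [|[u v] us IH] g s /= E0 Er ER ED EG.
  by apply: srun_eq; [apply: srun_while0; rewrite /tops E0|rewrite orbF; ext].
have E0' : s t0 = bit_cells S (enc_bits u) ++ (bit_cells S (enc_bits v) ++
    (bit_cells S (flatten [seq enc_bits p.1 ++ enc_bits p.2 | p <- us]) ++ rest)).
  by rewrite E0 /bit_cells !map_cat -!catA.
apply: srun_le.
  apply: srun_whileS; first by rewrite /tops E0' pairs_cells; case: (u).
    apply: srun_seq; first exact: run_count E0' ER ED EG.
    by apply: run_skip; ext.
  apply: srun_eq.
    by apply: (IH (g || (m < size u))) => //; ext.
  by rewrite orbA; ext.
rewrite !size_cat; set k := size (flatten _).
by rewrite !size_enc_bits; lia.
Qed.

End Check.
End Phases.

(** * P is contained in NP *)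

Section Layout.
Variables (k W : nat).
Definition tsplit (i : 'I_(k + W).+1) : 'I_k.+1 + 'I_W := @split k.+1 W i.
Definition tunsplit (i : 'I_k.+1 + 'I_W) : 'I_(k + W).+1 := @unsplit k.+1 W i.

Lemma tsplitK : cancel tsplit tunsplit. Proof. exact: splitK. Qed.
Lemma tunsplitK : cancel tunsplit tsplit. Proof. exact: unsplitK. Qed.

Lemma tsplit0 : tsplit ord0 = inl ord0.
Proof. by apply: (can_inj tunsplitK); rewrite tsplitK; apply: val_inj. Qed.

End Layout.

Lemma leading_bits_split (M : machine) (r : seq (cell M)) : exists rest,
  r = [seq Some (inl b) | b <- leading_bits r] ++ rest /\
  (if head None rest is Some (inl _) then false else true).
Proof.
elim: r => [|[[b|s]|] r [rest [E1 E2]]] /=; first by exists [::].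
- by exists rest; rewrite -E1.
- by exists (Some (inr s) :: r).
- by exists (None :: r).
Qed.

Lemma size_leading_bits (M : machine) (r : seq (cell M)) : size (leading_bits r) <= size r.
Proof. by elim: r => [|[[b|s]|] r IH]. Qed.

Section RunWithWork.
Variables (M : machine) (W : nat) (X : finType).

Definition wtape : finType := ('I_(ntapes M).+1 + 'I_W)%type.
Definition wsym : finType := ((sym M + state M) + X)%type.
Notation cel := (option (bool + wsym)).

Definition sym_in (s : sym M) : wsym := inl (inl s).
Definition sym_out (s : wsym) : option (sym M) := if s is inl (inl s') then Some s' else None.
Definition state_in (s : state M) : wsym := inl (inr s).
Definition state_out (s : wsym) : option (state M) := if s is inl (inr s') then Some s' else None.
Definition machine_tape (i : wtape) : option 'I_(ntapes M).+1 := if i is inl j then Some j else None.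
Definition tape0 : wtape := inl ord0.

Variable tq : 'I_W.

Definition run_machine : prog wtape wsym :=
  RunM sym_in sym_out state_in state_out (fun i => inl i : wtape) machine_tape (inr tq).

(** The nonbit after the output tells the next program where to stop, and the bound on [size y]
    limits its running time. *)
Lemma run_machine_spec (s : wtape -> seq cel) z n y :
  s (inr tq) = [:: Some (inr (state_in (start M)))] ->
  (forall i, s (inl i) = if i == ord0 then bit_cells wsym z else [::]) ->
  outputs_within M n z y ->
  forall T, rep true T s -> exists s' rest, [/\
    (forall j, j != tq -> s' (inr j) = s (inr j)),
    s' tape0 = bit_cells wsym y ++ rest, is_bit (head None rest) = false,
    size y <= size z + n + 1 &
    exists2 T', rep false T' s' & runs run_machine T T' (n * 3).+1].
Proof.
move=> sq si [hh ho] T R.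
have syK : pcancel sym_in sym_out by [].
have stK : pcancel state_in state_out by [].
have miK : pcancel (fun i => inl i : wtape) machine_tape by [].
have imK : ocancel machine_tape (fun i => inl i : wtape) by case.
have [T' R1 R2] := @runM_rep M wtape wsym _ _ _ _ syK stK _ _ (inr tq) miK imK erefl s z n sq si hh T R.
set c := iter n _ _ in hh ho R1 R2 *.
have [rest [E1 E2]] := leading_bits_split (c.2 ord0).2.
move: R2; set s' := (X in rep false T' X) => R2.
exists s', (map (emb sym_in) rest); split.
- by move=> j jt; rewrite /s' /=; case: eqP => // -[E]; rewrite E eqxx in jt.
- rewrite /s' /= E1 map_cat -[X in bit_cells _ X]ho /output; congr (_ ++ _).
  by rewrite /bit_cells -map_comp.
- by case: rest E2 {E1} => [|[[?|?]|] rest].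
- rewrite -ho /output; apply: leq_trans (size_leading_bits _) _.
  exact: (size_config n z ord0).2.
- by exists T'.
Qed.

End RunWithWork.

Section EasyDirection.
Variables (A : language) (M : machine) (p : {poly nat}).
Hypothesis MP : forall x,
    exists2 b : bool, outputs_within M p.[size x]%R x [:: b] & (b <-> A x).

(** The verifier for a language in P ignores the certificate and decides the first component. On
    strings that encode no pair its value is arbitrary. *)
Fixpoint dec_pair (z : seq bool) : seq bool :=
  if z is true :: b :: z' then b :: dec_pair z' else [::].

Lemma enc_pairK x y : dec_pair (enc_pair x y) = x.
Proof. by rewrite /enc_pair /enc_bits cat_rcons; elim: x => //= b x ->. Qed.

Lemma size_dec_pair z : size (dec_pair z) <= size z.
Proof.
have [n] := ubnP (size z); elim: n z => // n IH [|[] [|b z]] //= h.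
by rewrite ltnS; apply: leq_trans (IH _ _) _ => //; lia.
Qed.

Definition etX : wtape M 2 := inr (@Ordinal 2 0 isT).
Definition etQ : 'I_2 := @Ordinal 2 1 isT.
Notation I := (wtape M 2).
Notation S := (wsym M unit).
Notation t0 := (tape0 M 2).

Definition dec_prog : prog I S :=
  While (fun r => r t0 == mark S)
    (Seq (Pop S t0) (If (@ne I S t0) (Mv S t0 etX) Skip)).

Lemma run_dec b z (s : I -> seq (option (bool + S))) : s t0 = bit_cells S z ->
  exists2 z', size z' <= size z &
    srun b dec_prog s (upd (upd s t0 (bit_cells S z')) etX (bit_cells S (rev (dec_pair z)) ++ s etX))
      (size z * 11).+1.
Proof.
have n0X : t0 <> etX by [].
have [n] := ubnP (size z); elim: n z s => // n IH [|[] [|d z]] s /= h E.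
- exists [::] => //; apply: srun_eq; first by apply: srun_while0; rewrite /tops E.
  by rewrite /rev /=; ext.
- exists [::] => //; apply: srun_le.
    apply: srun_whileS; first by rewrite /tops E.
      apply: (srun_seq (t1 := 1) (t2 := 3)); first exact: srun_pop.
      by apply: srun_if; rewrite E /ne /tops {1}/upd eqxx /=; exact: srun_skip.
    apply: srun_eq; first by apply: srun_while0; rewrite /tops /upd eqxx.
    by rewrite ?E /rev /=; ext.
  by [].
- have [||z' hz R] := IH z (upd (upd s t0 (bit_cells S z)) etX (Some (inl d) :: s etX)) _ _.
  + by rewrite /= in h; lia.
  + by ext.
  exists z'; first by lia.
  apply: srun_le.
    apply: srun_whileS; first by rewrite /tops E.
      apply: (@srun_eq _ _ _ _ _ _ (upd (upd s t0 (bit_cells S z)) etX (Some (inl d) :: s etX)) _ _).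
        apply: (srun_seq (t1 := 1) (t2 := 7)); first exact: srun_pop.
        apply: srun_if; rewrite E /ne /tops {1}/upd eqxx /=.
        by apply: (@srun_mv _ _ _ _ etX (Some (inl d)) (bit_cells S z)) => //; ext.
      by ext.
    apply: srun_eq; first exact: R.
    by rewrite rev_cons /bit_cells map_rcons cat_rcons; ext.
  by rewrite /=; lia.
- exists [:: false] => //; apply: (@srun_le _ _ _ _ _ _ 1) => //; apply: srun_eq; first by apply: srun_while0; rewrite /tops E.
  by rewrite /rev /=; ext.
- exists [:: false, d & z] => //; apply: (@srun_le _ _ _ _ _ _ 1) => //; apply: srun_eq; first by apply: srun_while0; rewrite /tops E.
  by rewrite /rev /=; ext.
Qed.

(** The decoded word lies reversed on [etX]; moving it back restores its order, once the remainder
    of the input has been cleared from tape 0. *)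
Definition easy_prog : prog I S :=
  Seq dec_prog (Seq (While (@ne I S t0) (Pop S t0))
   (Seq (While (@ne I S etX) (Mv S etX t0))
     (Seq (Push (inr etQ : I) (fun=> Some (inr (@state_in M unit (start M))))) (@run_machine M 2 unit etQ)))).

Lemma run_clear b z (s : I -> seq (option (bool + S))) : s t0 = bit_cells S z ->
  srun b (While (@ne I S t0) (Pop S t0)) s (upd s t0 [::]) (size z * 3).+1.
Proof.
elim: z s => [|d z IH] s /= E.
  by apply: srun_eq; [apply: srun_while0; rewrite /ne /tops E|ext].
apply: srun_le.
  apply: srun_whileS; first by rewrite /ne /tops E.
    exact: srun_pop.
  by apply: srun_eq; [apply: IH; ext; rewrite E|ext].
by lia.
Qed.

Lemma in_P_dec : in_P (fun z => A (dec_pair z)).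
Proof.
pose time n := n * 11 + n * 3 + n * 7 + 3 * p.[n]%R + 20.
have [P HP] : poly_bounded time by rewrite /time; poly_bounded_tac.
pose C := compile (k := ntapes M + 2) (@tsplit _ _) (@tunsplit _ _) easy_prog.
exists C, P => z; have [d [hd1 hd2] hd] := MP (dec_pair z); exists d => //.
pose s0 : I -> seq (option (bool + S)) := fun i => if i == t0 then bit_cells S z else [::].
have [z' hz R1] := @run_dec true z s0 erefl.
set s1 := upd _ _ _ in R1.
have R2 := @run_clear true z' s1 erefl.
have n0X : etX <> t0 by [].
have R3 := @srun_moves I S true etX t0 (bit_cells S (rev (dec_pair z))) (upd s1 t0 [::]) n0X
  (cats0 _) (bit_cells_some _ _).
set s3 := upd (upd (upd s1 _ _) _ _) _ _ in R3.
have R4 := @srun_push I S true (inr etQ : I) (fun=> Some (inr (@state_in M unit (start M)))) s3.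
set s4 := upd _ _ _ in R4.
have E4 i : s4 (inl i) = if i == ord0 then bit_cells S (dec_pair z) else [::].
  case: (i =P ord0) => [->|ne].
    have -> : s4 (inl ord0) = rev (bit_cells S (rev (dec_pair z))) ++ [::] by [].
    by rewrite cats0 /bit_cells map_rev revK.
  have e : (inl i == t0 :> I) = false by apply/eqP => -[].
  by rewrite /s4 /s3 /s1 /s0 /upd !e.
pose T := input_store S (@tsplit (ntapes M) 2) z.
have RT : rep true T s0.
  by move=> i; rewrite /T /input_store tsplit0.
have [s5 [rest [_ E5 E6 _ [T' RT' RM]]]] : exists s' rest, [/\
    (forall j, j != etQ -> s' (inr j) = s4 (inr j)),
    s' t0 = bit_cells S [:: d] ++ rest, is_bit (head None rest) = false,
    size [:: d] <= size (dec_pair z) + p.[size (dec_pair z)]%R + 1 &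
    exists2 T', rep false T' s' & runs easy_prog T T' (time (size z))].
  have [T1 RT1 Q1] := R1 _ RT; have [T2 RT2 Q2] := R2 _ RT1.
  have [T3 RT3 Q3] := R3 _ RT2; have [T4 RT4 Q4] := R4 _ RT3.
  have [s5 [rest [F1 F2 F3 F4 [T' RT' Q5]]]] :=
    @run_machine_spec M 2 unit etQ s4 _ _ _ erefl E4 (conj hd1 hd2) T4 RT4.
  exists s5, rest; split=> //; exists T' => //.
  apply: runs_le (runs_seq Q1 (runs_seq Q2 (runs_seq Q3 (runs_seq Q4 Q5)))) _.
  have h1 := size_dec_pair z; have h2 := horner_mono p h1.
  by rewrite /bit_cells size_map size_rev /time; lia.
apply: (compile_outputs (@tsplitK _ _) (@tunsplitK _ _) (runs_le RM (HP _))); rewrite tsplit0 (RT' t0).1 E5.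
  by case.
by move: E6; case: (rest) => [|[[?|?]|] ?].
Qed.

End EasyDirection.

Lemma in_P_in_NP A : in_P A -> in_NP A.
Proof.
case=> M [p MP]; exists (fun z => A (dec_pair z)), 0%R; split; first exact: in_P_dec MP.
move=> x; split=> [Ax|[y _]]; last by rewrite enc_pairK.
by exists [::]; rewrite // enc_pairK.
Qed.

(** * The gap *)

(** The approximation guarantee speaks only about a given optimum; well-ordering of the makespans
    supplies one. *)
Lemma optimum_exists (I : instance) B :
  (exists2 S : schedule I, feasible S & makespan S <= B) ->
  exists2 m, optimum I m & m <= B.
Proof.
case=> S0 f0 h0.
pose P k := `[< exists2 S : schedule I, feasible S & makespan S = k >].
have exP : exists k, P k by exists (makespan S0); apply/asboolP; exists S0.
case: (ex_minnP exP) => m /asboolP Hm min_m; exists m.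
  by split=> // S fS; apply: min_m; apply/asboolP; exists S.
by apply: leq_trans h0; apply: min_m; apply/asboolP; exists S0.
Qed.

(** Origin of [c]: in (5/4 - eps)(4R + 4H) the surplus 5H over 5R has to be outweighed by 4 eps R =
    4 eps 2^c H. *)
Lemma exp_unbounded (R : realType) (eps : R) : (0 < eps)%R ->
  exists c : nat, (5 < 4 * eps * (2 ^ c)%:R)%R.
Proof.
move=> e0; have h : (0 <= 5 / (4 * eps))%R.
  by apply: Num.Theory.divr_ge0 => //; lra.
have := Num.Theory.archi_boundP h; set c := Num.bound _ => hc; exists c.
have h2 : (c%:R <= (2 ^ c)%:R :> R)%R by rewrite Num.Theory.ler_nat ltnW // ltn_expl.
have := Order.POrderTheory.lt_le_trans hc h2.
rewrite Num.Theory.ltr_pdivrMr; first by rewrite GRing.mulrC.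
by lra.
Qed.

Lemma gap_arith (R : realType) (eps : R) c H s m : (5 < 4 * eps * (2 ^ c)%:R)%R ->
  (0 < eps)%R -> 0 < H -> m <= 4 * (2 ^ c * H) + 4 * H ->
  (s%:R <= (5%:R / 4%:R - eps) * m%:R)%R -> s < 5 * (2 ^ c * H).
Proof.
move=> hc e0 H0 hm hs; rewrite -(Num.Theory.ltr_nat R).
apply: Order.POrderTheory.le_lt_trans hs _.
have {}hm : (m%:R <= (4 * (2 ^ c * H) + 4 * H)%:R :> R)%R by rewrite Num.Theory.ler_nat.
have {}H0 : (0 < H%:R :> R)%R by rewrite Num.Theory.ltr0n.
move: hm; rewrite !GRing.natrD !GRing.natrM => hm.
have m0 : (0 <= m%:R :> R)%R by exact: Num.Theory.ler0n.
set k : R := (2 ^ c)%:R%R in hc hm *; set h : R := H%:R%R in H0 hm *.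
set u : R := m%:R%R in hm m0 *.
have k0 : (0 < k)%R by rewrite /k Num.Theory.ltr0n expn_gt0.
have kh : (0 < k * h)%R by rewrite Num.Theory.mulr_gt0.
(* The bound on [m] may be multiplied by the ratio only if that is nonnegative; a negative ratio
   leaves [s] at most 0. *)
have [rho|rho] := Order.TotalTheory.ltP (5 / 4 - eps)%R 0%R; first by nra.
have h1 : ((5 / 4 - eps) * u <= (5 / 4 - eps) * (4 * (k * h) + 4 * h))%R by nra.
have h2 : (5 * h < 4 * eps * k * h)%R by nra.
have h3 : (0 < eps * h)%R by nra.
apply: Order.POrderTheory.le_lt_trans h1 _.
by nra.
Qed.

Lemma hcode_le (M : machine) (a : hcol M) : code a <= code_max M.
Proof. by have := code_le_h a; lia. Qed.

Lemma vcode_le (M : machine) (a : vcol M) : code a <= code_max M.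
Proof. by have := code_le_v a; lia. Qed.

(** * The instance belonging to an input word *)

Section Reduction.
Variables (MV : machine) (x : seq bool) (q e T c : nat).
Notation TT := (tile MV).
Notation K := (code_max MV).
Notation ec := (fun t : TT => code (east t)).
Notation wc := (fun t : TT => code (west t)).
Notation nc := (fun t : TT => code (north t)).
Notation sc := (fun t : TT => code (south t)).
Notation g := (2 * (#|TT| * K) + #|TT| + K + 1).
Notation lab := (fun l : label => code (inl l : vcol MV)).
Notation ls := (labels (enc_bits x) q e).
Notation N := (size ls).
Hypothesis N_big : 2 * T + (size (enc_bits x) + q) + 5 <= N.
Hypothesis decides : forall y, size y <= q ->
  exists b, outputs_within MV T (enc_pair x y) [:: b].

(** The exponent [g] is the bound itself. It depends on the verifier alone, so it is a constant of
    the reduction program. *)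
Lemma radix_big : 2 * (#|TT| * K) + #|TT| + K + 1 < 2 ^ g.
Proof. exact: ltn_expl. Qed.

Lemma labels_big : 1 < N.
Proof. by apply: leq_trans N_big; lia. Qed.

Lemma tiles_big : 1 < #|TT|.
Proof.
have ok b : valid_tile (inl true : hcol MV, inl true : hcol MV,
    inl (inl (true, b)) : vcol MV, inr (start MV, on_tape0 (Some (inl b)), true) : vcol MV).
  by rewrite /= !eqxx.
by apply/card_gt1P; exists (Sub _ (ok true)), (Sub _ (ok false)).
Qed.

Lemma labels_head k hd d : k < N -> nth blank_label ls k = inl (hd, d) -> hd = (k == 0).
Proof.
by move=> _; rewrite (nth_labels N_big); case: ifP => _; [case|case: ifP].
Qed.

Lemma labels_head0 : exists d, nth blank_label ls 0 = inl (true, d).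
Proof. by rewrite (nth_labels N_big) z_pos; exists (nth false (enc_bits x) 0). Qed.

Notation inst := (the_gadget ec wc nc sc K g lab ls c).
Notation R1 := (unit_R g ls c).
Notation wts := (weights ec wc nc sc K g ls).
Notation tA := (capA K g lab ls).
Notation tB := (capB ec wc nc sc K g lab ls).

Lemma inst_caps : tA + tB < unit_H g ls.
Proof.
apply: caps_small; try exact: radix_big; try exact: tiles_big; try exact: labels_big.
- by move=> t; exact: hcode_le.
- by move=> t; exact: vcode_le.
- by move=> t; exact: code_le_h.
- by move=> t; exact: code_le_v.
Qed.

Lemma inst_sum : \sum_(0 <= i < size wts) nth 0 wts i = tA + tB.
Proof.
apply: weights_sum; try exact: radix_big; try exact: tiles_big; try exact: labels_big.
- by move=> t; exact: code_le_h.
- by move=> t; exact: code_le_v.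
Qed.

Lemma inst_pos : all (leq 1) wts.
Proof. exact: weights_pos. Qed.

Lemma size_wts : size wts = size (items TT N).
Proof. exact: size_map. Qed.

Lemma inst_complete y : size y <= q -> outputs_within MV T (enc_pair x y) [:: true] ->
  exists2 S : schedule inst, feasible S & makespan S <= 4 * R1 + 4 * unit_H g ls.
Proof.
move=> hy hT; have [f Hf] := tiling_of_accepting N_big decides hy hT.
have [Q HQ] := subset_of_tiling (fun t => hcode_le (east t)) (fun t => vcode_le (south t))
  (ltnW labels_big) radix_big Hf.
pose it0 : nat * nat * TT := ((0, 0), f 0 0).
pose P i := Q (nth it0 (items TT N) i).
apply: (gadget_complete inst_pos inst_sum inst_caps (unit_R_pos g ls c) (P := P)).
rewrite /capA -HQ [RHS](big_nth it0) size_wts big_nat_cond [RHS]big_nat_cond.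
by apply: eq_bigr => i /andP[hi _]; rewrite /weights (nth_map it0).
Qed.

Lemma inst_sound (S : schedule inst) : feasible S -> (forall j, start1 S j < 2 * R1) ->
  exists2 y, size y <= q & outputs_within MV T (enc_pair x y) [:: true].
Proof.
move=> fS hS; have [P HP] := gadget_sound inst_pos inst_sum inst_caps (unit_R_pos g ls c) fS hS.
have [t0 _] : exists t : TT, True.
  by have /card_gt1P[t _] := tiles_big; exists t.
(* The gadget selects positions in the list of weights; items are distinct, so positions and items
   determine each other. *)
pose Q (it : nat * nat * TT) := P (index it (items TT N)).
have [|f Hf] := tiling_of_subset (fun t => hcode_le (east t)) (fun t => hcode_le (west t))
  (fun t => vcode_le (north t)) (fun t => vcode_le (south t))
  (fun k => vcode_le (inl (nth blank_label ls k))) (ltnW labels_big) radix_big (Q := Q).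
  have <- : tA = dval (2 ^ (3 * g)) (target_digit K g (fun k => lab (nth blank_label ls k))) (grid N) by [].
  rewrite -HP (big_nth ((0, 0), t0)) size_wts big_nat_cond [RHS]big_nat_cond.
  apply: eq_big => [i|i /andP[hi _]]; last by rewrite /weights (nth_map ((0, 0), t0)).
  by case hi: (0 <= i < _) => //=; rewrite /Q index_uniq // uniq_items.
exact: (accepting_of_tiling N_big decides Hf).
Qed.

End Reduction.

(** * The decision procedure *)

Section Scope.
Variables (TT : finType) (ec wc nc sc : TT -> nat) (K g : nat).
Variables (lab : label -> nat) (c : nat).
Variables (I S : finType) (lc : label -> S) (hash : option (bool + S)) (vt vk ut uk : I).
Hypothesis vars_uniq : uniq [:: vt; vk; ut; uk].
Notation vars := [:: vt; vk; ut; uk].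

Lemma scope_gcells sco (s : seq (option (bool + S))) : gscope vars sco (gcells I s).
Proof. by elim: s => //= a s ->. Qed.

Lemma scope_gnumber sco F tail : ut \notin sco -> uk \notin sco ->
  gscope vars [:: uk, ut & sco] F -> gscope vars sco (gnumber hash ut uk F tail).
Proof.
move=> h1 h2 h3; rewrite /= h1 scope_gcells h3 !inE negb_or h2 !eqxx !orbT /= andbT.
by move: vars_uniq; rewrite /= !inE; case: (eqVneq ut uk) => [->|]; rewrite ?eqxx ?andbF // eq_sym => ->.
Qed.

Lemma scope_grow sco f0 f1 :
  gscope vars [:: uk, ut & sco] (grow g lc ut uk f0 f1).
Proof.
rewrite /= !inE eqxx orbT scope_gcells andbT /=.
by rewrite /glabel; elim: (enum _) => //= l e ->; rewrite !inE eqxx scope_gcells.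
Qed.

Lemma scope_gitem x : gscope vars [:: uk; ut; vk; vt] (gitem ec wc nc sc K g S vt vk ut uk x).
Proof.
move: vars_uniq; rewrite /= !inE !negb_or -!andbA.
case/and5P=> n1 n2 n3 n4 /and3P[n5 n6 _].
by rewrite !scope_gcells !eqxx !orbT n2 n5 [ut == vt]eq_sym n2 /=.
Qed.

Lemma scope_gseqs sco (Gs : seq (gen I S)) : all (gscope vars sco) Gs -> gscope vars sco (gseqs Gs).
Proof. by elim: Gs => //= G Gs IH /andP[-> /IH ->]. Qed.

Lemma scope_ginstance : gscope vars [::] (ginstance ec wc nc sc K g lab c lc hash vt vk ut uk).
Proof.
have H sco f0 f1 tail : ut \notin sco -> uk \notin sco ->
    gscope vars sco (gnumber hash ut uk (grow g lc ut uk f0 f1) tail).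
  by move=> h1 h2; apply: scope_gnumber => //; exact: scope_grow.
have H0 sco tail : ut \notin sco -> uk \notin sco ->
    gscope vars sco (gnumber hash ut uk (gzero g I S) tail).
  by move=> h1 h2; apply: scope_gnumber => //; exact: scope_gcells.
have hu := vars_uniq; rewrite /= !inE !negb_or -!andbA in hu.
case/and5P: hu => n1 n2 n3 n4 /and3P[n5 n6 _].
have u1 : ut \notin [:: vk; vt] by rewrite !inE negb_or ![ut == _]eq_sym n2 n4.
have u2 : uk \notin [:: vk; vt] by rewrite !inE negb_or ![uk == _]eq_sym n3 n5.
have E (A B : gen I S) : gscope vars [::] (GSeq A B) = gscope vars [::] A && gscope vars [::] B by [].
rewrite /ginstance E; apply/andP; split.
  apply: scope_gseqs; rewrite /gL /gtotal /grest /gtarget.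
  by do !(apply/andP; split; first by [exact: H|exact: H0|exact: scope_gcells]).
have E2 v w (G : gen I S) : gscope vars [::] (GFor v (GFor w G)) =
   [&& v \in vars, w \in vars, w \notin [:: v] & gscope vars [:: w; v] G] by [].
have [i1 i2 i3] : [/\ vt \in vars, vk \in vars & vk \notin [:: vt]].
  by rewrite !inE !eqxx orbT [vk == vt]eq_sym n1.
rewrite E2 i1 i2 i3 !andTb; apply: scope_gseqs.
rewrite all_map; apply/allP => x _; apply: scope_gseqs; rewrite /gL /gtotal.
apply/andP; split; first by apply: scope_gnumber => //; exact: scope_gitem.
by do !(apply/andP; split; first by [exact: H|exact: scope_gcells]).
Qed.

End Scope.

(** * The machine deciding the language *)

Section Assembly.
Variables (MA MV : machine) (qc ecf : seq nat) (c : nat).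
Notation I := (wtape MA 16).
Notation S := (wsym MA (option label)).
Notation TT := (tile MV).
Notation K := (code_max MV).
Notation g := (2 * (#|TT| * K) + #|TT| + K + 1).
Notation cel := (option (bool + S)).

Definition lcs (l : label) : S := inr (Some l).
Definition hash : cel := Some (inr (inr None)).

Lemma lcs_inj : injective lcs.
Proof. by move=> l1 l2 []. Qed.

Definition wt (j : nat) (h : j < 16) : I := inr (Ordinal h).
Notation w j := (@wt j isT).
Notation t0 := (tape0 MA 16).
Notation iQ := (@Ordinal 16 0 isT).
Notation tQ := (w 0).
Notation tL := (w 1).
Notation tA := (w 2).
Notation tB := (w 3).
Notation tH := (w 4).
Notation tF := (w 5).
Notation tO := (w 6).
Notation vt := (w 7).
Notation vk := (w 8).
Notation ut := (w 9).
Notation uk := (w 10).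
Notation tX := (w 11).
Notation tn := (w 12).
Notation tD := (w 13).
Notation tR := (w 14).
Notation tG := (w 15).
Notation mark := (mark S).

Definition reduction_gen : gen I S :=
  ginstance (fun t : TT => code (east t)) (fun t => code (west t)) (fun t => code (north t))
    (fun t => code (south t)) K g (fun l => code (inl l : vcol MV)) c lcs hash vt vk ut uk.

(** Prints log2 of 2R in unary: [3 * g] for each of the N^2 digits of H, [c] for R over H, and one
    for the factor 2. *)
Definition threshold_gen : gen I S :=
  GSeq (GFor vt (GFor vk (gcells I (nseq (3 * g) mark)))) (gcells I (nseq c.+1 mark)).

Definition run_gen_prog (tO' : I) (G : gen I S) : prog I S :=
  gprog tL tA tB tH tF tO' (is_head_cell lcs) G.

(** Labels go onto the stack [tL] from the right: blanks, guesses, input. The flag left by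
    [post_prog] is popped because the second generator expects [tF] empty. *)
Definition prepare_prog : prog I S :=
  Seq (read_prog S t0 tX tn)
  (Seq (eval_prog S tn tD tA tB ecf)
  (Seq (fill_prog tD tL (label_cell lcs blank_label))
  (Seq (eval_prog S tn tD tA tB qc)
  (Seq (fill_prog tD tL (label_cell lcs guess_label))
  (Seq (labels_prog lcs tX tL)
  (Seq (run_gen_prog tO reduction_gen)
  (Seq (post_prog S tO t0 tF)
  (Seq (Pop S tF)
  (Seq (run_gen_prog tR threshold_gen)
       (Push tQ (fun=> Some (inr (state_in (M:=MA) (option label) (start MA)))))))))))))).

(** The blank written below the answer keeps the output to a single bit. *)
Definition decide_prog : prog I S :=
  Seq (check_prog S t0 tR tD tG)
  (Seq (Put t0 (fun=> None))
       (If (@ne I S tG) (Push t0 (fun=> Some (inl false))) (Push t0 (fun=> mark)))).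

Definition whole_prog : prog I S :=
  Seq prepare_prog (Seq (run_machine MA (option label) iQ) decide_prog).

Section Run.
Variable x : seq bool.
Notation n := (size x).
Notation q := (eval_coefs qc n).
Notation e := (eval_coefs ecf n).
Notation ls := (labels (enc_bits x) q e).
Notation Lam := [seq label_cell lcs l | l <- ls].
Hypothesis big : 1 < size ls.
Hypothesis head1 : forall k hd d, k < size ls -> nth blank_label ls k = inl (hd, d) -> hd = (k == 0).
Hypothesis head0 : exists d, nth blank_label ls 0 = inl (true, d).

Definition stream : seq cel := gout Lam (fun=> 0) reduction_gen.
Definition threshold : nat := 3 * g * (size ls * size ls) + c.+1.

Definition prepare_time : nat :=
  n * 11 + eval_time ecf n + e * 7 + eval_time qc n + q * 7 + n * 11 + 7
  + gtime reduction_gen (size ls) + size stream * 17 + gtime threshold_gen (size ls) + 100.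

Lemma run_prepare : all isSome stream -> forall T, rep true T
    (fun i => if i == t0 then bit_cells S x else [::]) ->
  exists s : I -> seq cel, [/\
    s tQ = [:: Some (inr (state_in (M:=MA) (option label) (start MA)))],
    forall i, s (inl i) = if i == ord0 then bit_cells S (post stream).1 else [::],
    s tR = nseq threshold mark, s tD = [::] /\ s tG = [::] &
    exists2 T', rep true T' s & runs prepare_prog T T' prepare_time].
Proof.
move=> Hstream T RT.
pose s0 (i : I) := if i == t0 then bit_cells S x else [::].
pose s1 := upd (upd (upd s0 tn (nseq (size (bit_cells S x)) mark ++ [::])) tX (rev (bit_cells S x) ++ [::])) t0 [::].
have R1 : srun true (read_prog S t0 tX tn) s0 s1 _ :=
  @run_read I S true t0 tX tn (bit_cells S x) s0 ltac:(by []) ltac:(by []) ltac:(by []) (bit_cells_some _ _) erefl.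
have E1 : s1 tn = nseq n mark.
  by rewrite (_ : s1 tn = nseq (size (bit_cells S x)) mark ++ [::]) // cats0 size_map.
pose s2 := upd s1 tD (nseq e mark).
have R2 : srun true (eval_prog S tn tD tA tB ecf) s1 s2 _ :=
  @run_eval I S true tn tD tA tB isT ecf n s1 E1 erefl erefl erefl.
pose s3 := upd (upd s2 tL (nseq e (label_cell lcs blank_label) ++ [::])) tD [::].
have R3 : srun true (fill_prog tD tL (label_cell lcs blank_label)) s2 s3 _ :=
  @run_fill I S true tD tL (label_cell lcs blank_label) e s2 ltac:(by []) erefl.
pose s4 := upd s3 tD (nseq q mark).
have R4 : srun true (eval_prog S tn tD tA tB qc) s3 s4 _ :=
  @run_eval I S true tn tD tA tB isT qc n s3 E1 erefl erefl erefl.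
pose s5 := upd (upd s4 tL (nseq q (label_cell lcs guess_label) ++ (nseq e (label_cell lcs blank_label) ++ [::]))) tD [::].
have R5 : srun true (fill_prog tD tL (label_cell lcs guess_label)) s4 s5 _ :=
  @run_fill I S true tD tL (label_cell lcs guess_label) q s4 ltac:(by []) erefl.
have E5 : s5 tX = rev (bit_cells S x).
  by rewrite (_ : s5 tX = rev (bit_cells S x) ++ [::]) // cats0.
have R6 := @run_labels I S true lcs lcs_inj tX tL ltac:(by []) x s5 E5.
pose s6 := upd (upd s5 tX [::]) tL ([seq label_cell lcs l | l <- input_labels (enc_bits x)] ++ s5 tL).
have E6 : s6 tL = Lam.
  rewrite (_ : s6 tL = [seq label_cell lcs l | l <- input_labels (enc_bits x)] ++
    (nseq q (label_cell lcs guess_label) ++ (nseq e (label_cell lcs blank_label) ++ [::]))) //.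
  by rewrite cats0 /labels !map_cat !map_nseq.
have LamS : all isSome Lam by rewrite all_map; apply/allP.
have vars_blank s : s vt = [::] -> s vk = [::] -> s ut = [::] -> s uk = [::] ->
    forall v, v \in [:: vt; vk; ut; uk] -> v \notin [::] -> s v = [::] :> seq cel.
  by move=> h1 h2 h3 h4 v; rewrite !inE => /or4P[] /eqP ->.
have R7 : srun true (run_gen_prog tO reduction_gen) s6 (upd s6 tO (rev stream ++ s6 tO)) (gtime reduction_gen (size Lam)).
  apply: (@run_gen I S true Lam tL tA tB tH tF tO [:: vt; vk; ut; uk] isT (is_head_cell lcs)
    (is_head_cellP head1 head0 lcs_inj) LamS reduction_gen [::] (fun=> 0) s6).
    exact: scope_ginstance.
  by split=> //; apply: vars_blank.
pose s7 := upd s6 tO (rev stream ++ s6 tO).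
have E7 : s7 tO = rev stream by rewrite (_ : s7 tO = rev stream ++ [::]) // cats0.
have R8 := @run_post I S true tO t0 tF (rev stream) ([::], false) s7 ltac:(by []) ltac:(by []) ltac:(by [])
  ltac:(by rewrite all_rev) E7 erefl erefl.
rewrite /= foldl_rev -/(post stream) in R8.
pose s8 := upd (upd (upd s7 t0 (bit_cells S (post stream).1)) tF (flag S (post stream).2)) tO [::].
pose s9 := upd s8 tF [::].
have R9 : srun true (Pop S tF) s8 s9 1.
  apply: srun_eq; first exact: srun_pop.
  rewrite /s9; congr (upd s8 tF _); rewrite (_ : s8 tF = flag S (post stream).2) //.
  by case: (post stream).2.
pose s10 := upd s9 tR (rev (gout Lam (fun=> 0) threshold_gen) ++ s9 tR).
have R10 : srun true (run_gen_prog tR threshold_gen) s9 s10 (gtime threshold_gen (size Lam)).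
  apply: (@run_gen I S true Lam tL tA tB tH tF tR [:: vt; vk; ut; uk] isT (is_head_cell lcs)
    (is_head_cellP head1 head0 lcs_inj) LamS threshold_gen [::] (fun=> 0) s9).
    by rewrite /threshold_gen /=; rewrite !scope_gcells.
  by split=> //; apply: vars_blank.
have E10 : s10 tR = nseq threshold mark.
  rewrite (_ : s10 tR = rev (gout Lam (fun=> 0) threshold_gen) ++ [::]) // cats0.
  have flat m k (f : nat -> seq cel) : (forall j, f j = nseq k mark) ->
      flatten [seq f j | j <- iota 0 m] = nseq (m * k) mark.
    by move=> Hf; elim: m 0 => //= m IH j; rewrite IH Hf -nseqD mulSn.
  have out2 (G1 G2 : gen I S) r : gout Lam r (GSeq G1 G2) = gout Lam r G1 ++ gout Lam r G2 by [].
  have outF v (G : gen I S) r : gout Lam r (GFor v G) =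
    flatten [seq gout Lam (upd r v j) G | j <- iota 0 (size Lam)] by [].
  rewrite /threshold_gen out2 out_gcells outF (flat _ (size Lam * (3 * g))); last first.
    by move=> j; rewrite outF; apply: flat => j'; rewrite out_gcells.
  rewrite -nseqD rev_nseq size_map /threshold; congr nseq; lia.
pose s11 := upd s10 tQ [:: Some (inr (state_in (M:=MA) (option label) (start MA)))].
have R11 : srun true (Push tQ (fun=> Some (inr (state_in (M:=MA) (option label) (start MA))))) s10 s11 3.
  exact: srun_push.
exists s11; split=> //.
- move=> i; case: (i =P ord0) => [->|ne]; first by [].
  have ei : (inl i == t0 :> I) = false by apply/eqP => -[].
  by rewrite /s11 /s10 /s9 /s8 /s7 /s6 /s5 /s4 /s3 /s2 /s1 /s0 /upd !ei.
have [T1 RT1 Q1] := R1 _ RT; have [T2 RT2 Q2] := R2 _ RT1.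
have [T3 RT3 Q3] := R3 _ RT2; have [T4 RT4 Q4] := R4 _ RT3.
have [T5 RT5 Q5] := R5 _ RT4; have [T6 RT6 Q6] := R6 _ RT5.
have [T7 RT7 Q7] := R7 _ RT6; have [T8 RT8 Q8] := R8 _ RT7.
have [T9 RT9 Q9] := R9 _ RT8; have [T10 RT10 Q10] := R10 _ RT9.
have [T11 RT11 Q11] := R11 _ RT10; exists T11 => //.
apply: runs_le (runs_seq Q1 (runs_seq Q2 (runs_seq Q3 (runs_seq Q4 (runs_seq Q5
  (runs_seq Q6 (runs_seq Q7 (runs_seq Q8 (runs_seq Q9 (runs_seq Q10 Q11)))))))))) _.
have hL : size Lam = size ls by rewrite size_map.
have hx : size (bit_cells S x) = n by rewrite size_map.
rewrite hL hx size_rev /prepare_time.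
move: (size stream) (gtime reduction_gen (size ls)) (gtime threshold_gen (size ls)) => a1 a2 a3.
by move: (eval_time ecf n) (eval_time qc n) (eval_coefs ecf n) (eval_coefs qc n) => a4 a5 a6 a7; lia.
Qed.

Lemma run_decide s us rest : s t0 = bit_cells S (flatten [seq enc_bits p.1 ++ enc_bits p.2 | p <- us]) ++ rest ->
  is_bit (head None rest) = false -> s tR = nseq threshold mark -> s tD = [::] -> s tG = [::] ->
  exists2 s', s' t0 = [:: Some (inl (~~ has (fun p => threshold < size p.1) us)), None & behead rest] &
    srun false decide_prog s s'
      (size (flatten [seq enc_bits p.1 ++ enc_bits p.2 | p <- us]) * 40 + 9).
Proof.
move=> E0 Er ER ED EG.
have R1 := @run_check I S false t0 tR tD tG ltac:(by []) ltac:(by []) ltac:(by []) ltac:(by []) ltac:(by []) ltac:(by [])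
  us rest threshold false s E0 Er ER ED EG.
pose bad := has (fun p : seq bool * seq bool => threshold < size p.1) us.
pose s1 := upd (upd s t0 rest) tG (flag S (false || bad)).
pose s2 := upd s1 t0 (None :: behead (s1 t0)).
have R2 : srun false (Put t0 (fun=> None)) s1 s2 1 by exact: srun_put.
pose s3 := upd s2 t0 (Some (inl (~~ bad)) :: s2 t0).
have R3 : srun false (If (@ne I S tG) (Push t0 (fun=> Some (inl false))) (Push t0 (fun=> mark))) s2 s3 5.
  apply: srun_if; rewrite /ne /tops (_ : s2 tG = flag S bad) //.
  by rewrite /s3; case: (bad); exact: srun_push.
exists s3; first by [].
by apply: srun_le; [exact: (srun_seq R1 (srun_seq R2 R3))|lia].
Qed.

Lemma run_whole tm us : all isSome stream ->
  outputs_within MA tm (post stream).1 (flatten [seq enc_bits p.1 ++ enc_bits p.2 | p <- us]) ->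
  outputs_within (compile (k := ntapes MA + 16) (@tsplit _ _) (@tunsplit _ _) whole_prog)
    (prepare_time + 43 * tm + 40 * size (post stream).1 + 60) x
    [:: ~~ has (fun p => threshold < size p.1) us].
Proof.
move=> Hs Hout; pose T := input_store S (@tsplit (ntapes MA) 16) x.
have RT : rep true T (fun i => if i == t0 then bit_cells S x else [::]).
  by move=> i; rewrite /T /input_store tsplit0.
have [s [EQ Et ER [ED EG] [T1 RT1 Q1]]] := run_prepare Hs RT.
have [s2 [rest [F1 F2 F3 F4 [T2 RT2 Q2]]]] :=
  @run_machine_spec MA 16 (option label) iQ s _ tm _ EQ Et Hout T1 RT1.
have [s3 E3 R3] := run_decide F2 F3 (etrans (F1 (@Ordinal 16 14 isT) isT) ER)
  (etrans (F1 (@Ordinal 16 13 isT) isT) ED) (etrans (F1 (@Ordinal 16 15 isT) isT) EG).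
have [T3 RT3 Q3] := R3 _ RT2.
have RM : runs whole_prog T T3 (prepare_time + 43 * tm + 40 * size (post stream).1 + 60).
  apply: runs_le (runs_seq Q1 (runs_seq Q2 Q3)) _.
  move: F4; move: (size (flatten _)) (size (post stream).1) prepare_time => a1 a2 a3; lia.
apply: (compile_outputs (@tsplitK _ _) (@tunsplitK _ _) RM); rewrite tsplit0 (RT3 t0).1 E3.
  by case.
by [].
Qed.

End Run.
End Assembly.

Lemma size_post (S : finType) (s : seq (option (bool + S))) : size (post s).1 <= 2 * size s.
Proof.
elim: s => //= a s; case: (post s) => z nz /= IH.
by case: a => [[b|h]|] /=; [case: ifP => _ /=| |]; lia.
Qed.

Lemma enc_scheduleE (I : instance) (S : schedule I) : enc_schedule S =
  flatten [seq enc_bits p.1 ++ enc_bits p.2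
    | p <- [seq (bits (start1 S j), bits (start2 S j)) | j <- enum 'I_(njobs I)]].
Proof.
rewrite /enc_schedule /enc_nats -map_comp; elim: (enum _) => //= j js IH.
by rewrite IH catA.
Qed.

Lemma outputs_within_le (M : machine) t t' x y :
  t <= t' -> outputs_within M t x y -> outputs_within M t' x y.
Proof. by move=> h [h1 h2]; rewrite /outputs_within -(subnK h) iterD halted_iter. Qed.

Lemma in_NP_in_P (R : realType) (eps : R) (A : language) :
  (0 < eps)%R -> polytime_approx_0L (5%:R / 4%:R - eps)%R -> in_NP A -> in_P A.
Proof.
move=> e0 [MA [pA HA]] [V [pq [[MV [pV HV]] HAV]]].
have [c hc] := exp_unbounded e0.
pose m n := 2 * n + 1 + pq.[n]%R.
(* The program computes the number of blank columns by evaluating a polynomial, so one is chosen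
   above the space requirement that [N_big] states. *)
have [pE HE] : poly_bounded (fun n => 2 * pV.[m n]%R + 5).
  have hm : poly_bounded m by rewrite /m; poly_bounded_tac.
  have := poly_bounded_comp (poly_bounded_poly pV) hm; rewrite /comp => H.
  by poly_bounded_tac.
pose N n := m n + pE.[n]%R.
pose G1 := reduction_gen MA MV c.
pose G2 := threshold_gen MA MV c.
(* Bounds the encoded instance: the stream is at most as long as its generation time, and [post] at
   most doubles it. *)
pose Z n := 2 * gtime G1 (N n).
pose time n := n * 11 + eval_time pE n + pE.[n]%R * 7 + eval_time pq n + pq.[n]%R * 7 + n * 11 + 7
  + gtime G1 (N n) + gtime G1 (N n) * 17 + gtime G2 (N n) + 100
  + 43 * pA.[Z n]%R + 40 * Z n + 60.
have hN : poly_bounded N by rewrite /N /m; poly_bounded_tac.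
have hG1 := poly_bounded_comp (gtime_poly G1) hN.
have hG2 := poly_bounded_comp (gtime_poly G2) hN.
have hZ : poly_bounded Z by apply: poly_bounded_mul; [exact: poly_bounded_const|exact: hG1].
have hpA := poly_bounded_comp (poly_bounded_poly pA) hZ.
have [P HP] : poly_bounded time.
  have h1 := eval_time_poly pE; have h2 := eval_time_poly pq.
  rewrite /comp in hG1 hG2 hpA; rewrite /time; by poly_bounded_tac.
exists (compile (k := ntapes MA + 16) (@tsplit _ _) (@tunsplit _ _) (whole_prog MA MV pq pE c)), P => x.
pose n := size x; pose q := eval_coefs pq n; pose e := eval_coefs pE n.
pose ls := labels (enc_bits x) q e.
have Eq : q = pq.[n]%R by rewrite horner_eval_coefs.
have Ee : e = pE.[n]%R by rewrite horner_eval_coefs.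
have sN : size ls = N n by rewrite size_labels size_enc_bits Eq Ee.
pose T := pV.[m n]%R.
have N_big : 2 * T + (size (enc_bits x) + q) + 5 <= size ls.
  by rewrite sN size_enc_bits /N Eq /m; have := HE n; rewrite /T /m -/n; lia.
have small y : size y <= q -> size (enc_pair x y) <= m n.
  by rewrite /enc_pair size_cat size_enc_bits /m Eq; lia.
have decides2 y : size y <= q ->
    exists2 b : bool, outputs_within MV T (enc_pair x y) [:: b] & b <-> V (enc_pair x y).
  move=> hy; have [b h1 h2] := HV (enc_pair x y); exists b => //.
  exact: outputs_within_le (horner_mono pV (small y hy)) h1.
have decides y : size y <= q -> exists b, outputs_within MV T (enc_pair x y) [:: b].
  by move=> /decides2[b h _]; exists b.
have big := labels_big N_big.
pose K := code_max MV; pose g := 2 * (#|tile MV| * K) + #|tile MV| + K + 1.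
pose lab := fun l : label => code (inl l : vcol MV).
pose ec := fun t : tile MV => code (east t); pose wc := fun t : tile MV => code (west t).
pose nc := fun t : tile MV => code (north t); pose sc := fun t : tile MV => code (south t).
pose strm := stream MA MV pq pE c x.
have Estream : strm = flatten [seq number_cells (hash MA) s | s <- instance_numbers ec wc nc sc K g lab ls c].
  by apply: out_ginstance => //; [exact: tiles_big|exact: radix_big|exact: labels_head N_big|
     exact: labels_head0 N_big|exact: lcs_inj].
have Hs : all isSome strm.
  rewrite Estream; elim: (instance_numbers _ _ _ _ _ _ _ _ _) => //= s ns IH.
  by rewrite all_cat IH all_cat bit_cells_some.
pose inst := the_gadget ec wc nc sc K g lab ls c.
pose L := instance_L ec wc nc sc K g lab ls c.
have Epost : (post strm).1 = enc_instance L inst.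
  rewrite Estream post_numbers // -instance_numbersE //.
  - by move=> t; exact: hcode_le.
  - by move=> t; exact: vcode_le.
  - by move=> t; exact: code_le_h.
  - by move=> t; exact: code_le_v.
  - exact: tiles_big.
  - exact: radix_big.
have [S [HS fS ratio]] := HA L inst (@gadget_delays _ _ _ _ _).
pose us := [seq (bits (start1 S j), bits (start2 S j)) | j <- enum 'I_(njobs inst)].
rewrite enc_scheduleE -/us -Epost in HS.
have RW := run_whole big (labels_head N_big) (labels_head0 N_big) Hs HS.
set thr := threshold _ _ _ _ _ in RW.
exists (~~ has (fun p => thr < size p.1) us).
  apply: outputs_within_le RW; apply: leq_trans (HP n).
  have hs : size strm <= gtime G1 (N n).
    by rewrite -sN; apply: leq_trans (size_gout _ _ _) _; rewrite size_map.
  have hz : size (post strm).1 <= Z n.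
    by apply: leq_trans (size_post _) _; rewrite leq_mul2l.
  have hp := horner_mono pA hz.
  rewrite /prepare_time -/n -/q -/e sN -/strm -/G1 -/G2 /time -Eq -Ee.
  move: hs hz hp; rewrite -/strm.
  move: (size strm) (size (post strm).1) (Z n) => a1 a2 a3.
  move: (gtime G1 (N n)) (gtime G2 (N n)) (pA.[a2])%R (pA.[a3])%R => a4 a5 a6 a7.
  by move: (eval_time pE n) (eval_time pq n) (q) (e) => a8 a9 a10 a11; lia.
have Ethr : 2 ^ thr = 2 * unit_R g ls c.
  rewrite /thr /threshold /unit_R /unit_H size_allpairs size_iota -expnM expnD expnS.
  by rewrite [LHS]mulnC -mulnA.
have Hhas : ~~ has (fun p => thr < size p.1) us <-> forall j, start1 S j < 2 * unit_R g ls c.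
  rewrite -all_predC all_map; split=> [/allP H j|H].
    by have := H j; rewrite mem_enum => /(_ isT) /=; rewrite -leqNgt size_bits_le Ethr.
  by apply/allP => j _ /=; rewrite -leqNgt size_bits_le Ethr.
(* Acceptance is sound for any feasible schedule; the approximation ratio is used only when a
   certificate exists. *)
rewrite Hhas HAV; split=> [Hsmall|[y hy Vy]].
  have [y hy [h1 h2]] := inst_sound N_big decides fS Hsmall.
  exists y; first by rewrite -Eq.
  have [b [b1 b2] hb] := decides2 y hy; apply/hb.
  by move: b2; rewrite h2 => -[<-].
rewrite -Eq in hy; have [b hb1 hb2] := decides2 y hy.
have {hb2}hb : b by apply/hb2.
rewrite hb in hb1.
have [m0 opt hm0] := optimum_exists (inst_complete c N_big decides hy hb1).
have hM : makespan S < 5 * unit_R g ls c.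
  apply: (gap_arith hc e0 _ hm0 (ratio m0 opt)).
  by rewrite !expn_gt0.
have X := @gadget_small_start (weights ec wc nc sc K g ls) (capA K g lab ls) (capB ec wc nc sc K g lab ls) (unit_H g ls) (unit_R g ls c) (inst_pos MV x q e) _ _ _ S fS hM.
apply: X; [exact: (inst_sum MV N_big)|exact: (inst_caps MV N_big)|exact: unit_R_pos].
Qed.

Local Open Scope ring_scope.

Theorem theorem1 (R : realType) (eps : R) :
  0 < eps -> polytime_approx_0L (5%:R / 4%:R - eps) -> P_eq_NP.
Proof.
move=> e0 H A; split; first exact: in_P_in_NP.
exact: in_NP_in_P e0 H.
Qed.
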